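(* Let $d\in\mathbb N$ and $k\in\mathbb N\cup\{0\}$. Then, as $\lambda\to\infty$, $$\lambda^{k(d-1)}e^{\theta\lambda}\,p_{k+1}(\lambda)=\alpha_{k+1}+O(\lambda^{-1}).$$
   Context: $\mathbb N=\{1,2,\ldots\}$. $\|\cdot\|$ is the Euclidean norm on $\mathbb R^d$, $o$ is the origin, $B(x,s)=\{y\in\mathbb R^d:\|y-x\|\le s\}$, and $\theta$ is the Lebesgue measure of the unit-radius ball in $\mathbb R^d$. For a locally finite set $\mathcal X\subset\mathbb R^d$ and $r>0$, $G(\mathcal X,r)$ is the graph with vertex set $\mathcal X$ and an edge between each pair of distinct points at Euclidean distance at most $r$. For $\lambda>0$, $\mathcal H_\lambda$ is a homogeneous Poisson point process of intensity $\lambda$ in $\mathbb R^d$ (viewed as a random set), and $\mathcal C(\lambda)$ is the vertex set of the connected component containing $o$ of $G(\mathcal H_\lambda\cup\{o\},1)$. For $k\in\mathbb N$, $p_k(\lambda):=\Pr[|\mathcal C(\lambda)|=k]$. For $k\in\mathbb N$ and $\mathbf z=(z_1,\ldots,z_k)\in(\mathbb R^d)^k$ let $D(\mathbf z):=\bigcup_{i=1}^kB(\tfrac12z_i,\|z_i\|/2)$ and $g(\mathbf z):=\int_{D(\mathbf z)}\|x\|^{1-d}\,dx$. Set $\alpha_1:=1$ and, for $k\in\mathbb N$, $\alpha_{k+1}:=\frac1{k!}\int_{(\mathbb R^d)^k}\exp(-g(\mathbf z))\,d\mathbf z$. *)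

(* Defs.v *)
From HB Require Import structures.
From mathcomp Require Import all_boot all_order all_algebra.
From mathcomp Require Import all_classical all_reals all_analysis.

Set Implicit Arguments.
Unset Strict Implicit.
Unset Printing Implicit Defensive.

Import Order.TTheory GRing.Theory Num.Theory.
Import numFieldNormedType.Exports.

Local Open Scope classical_set_scope.
Local Open Scope card_scope.
Local Open Scope ring_scope.

Section power_measure.
Context {R : realType} d {T : measurableType d}.

Definition cons_pair n (p : T * n.-tuple T) : n.+1.-tuple T :=
  [the n.+1.-tuple T of p.1 :: p.2].

Definition uncons n (t : n.+1.-tuple T) : T * n.-tuple T :=
  (thead t, [tuple of behead t]).

Fixpoint power_measure (mu : set T -> \bar R) n : set (n.-tuple T) -> \bar R :=
  match n with
  | 0 => \d_([tuple] : 0.-tuple T)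
  | n.+1 => pushforward (mu \x @power_measure mu n)%E (@cons_pair n)
  end.

Arguments power_measure : clear implicits.

Lemma measurable_cons_pair n : measurable_fun setT (@cons_pair n).
Proof.
by apply: measurable_cons; [exact: measurable_fst|exact: measurable_snd].
Qed.

Lemma measurable_uncons n : measurable_fun setT (@uncons n).
Proof.
apply: measurable_fun_pair; last exact: measurable_behead.
exact: measurable_tnth.
Qed.

Lemma cons_pairK n : cancel (@cons_pair n) (@uncons n).
Proof.
by move=> [x t]; rewrite /uncons /cons_pair /= theadE; congr pair;
   exact/val_inj.
Qed.

Lemma power_measure_ex (mu : {sigma_finite_measure set T -> \bar R}) n :
  exists m : {sigma_finite_measure set (n.-tuple T) -> \bar R},
    power_measure mu n = m.
Proof.
elim: n => [|n [m mE]]; first by exists \d_([tuple] : 0.-tuple T).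
have [nu nuE] : exists nu : {measure set (n.+1.-tuple T) -> \bar R},
    pushforward (mu \x m)%E (@cons_pair n) = nu.
  by unshelve eexists (pushforward (mu \x m)%E (@cons_pair n));
    first exact: measurable_cons_pair.
have nu_fin : sigma_finite setT nu.
  have /sigma_finiteP[F [FT ndF Ffin]] := sigma_finiteT mu.
  have /sigma_finiteP[G [GT ndG Gfin]] := sigma_finiteT m.
  exists (fun i => @uncons n @^-1` (F i `*` G i)).
    apply/esym; rewrite -subTset => t _ /=.
    have [i _ Fi] : (\bigcup_i F i) (thead t) by rewrite -FT.
    have [j _ Gj] : (\bigcup_i G i) [tuple of behead t] by rewrite -GT.
    exists (maxn i j) => //; split.
    - by move: Fi; exact/subsetPset/ndF/leq_maxl.
    - by move: Gj; exact/subsetPset/ndG/leq_maxr.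
  move=> i; have [mF Fi] := Ffin i; have [mG Gi] := Gfin i; split.
    rewrite -[X in measurable X]setTI.
    by apply: measurable_uncons => //; exact: measurableX.
  rewrite -nuE /pushforward -comp_preimage.
  rewrite (_ : @uncons n \o @cons_pair n = id).
    by rewrite preimage_id product_measure1E// lte_mul_pinfty// ge0_fin_numE.
  by apply/funext => p; exact: cons_pairK.
pose nu_sfin := isSFinite.Build _ _ _ (Measure.sort nu)
  (sfinite_measure_sigma_finite nu_fin).
pose nu_sigfin := isSigmaFinite.Build _ _ _ (Measure.sort nu) nu_fin.
pose nu' := HB.pack_for (SigmaFiniteMeasure.type (n.+1.-tuple T) R)
  (Measure.sort nu) nu_sfin nu_sigfin.
by exists nu'; rewrite /= mE nuE.
Qed.

Variables (mu : {sigma_finite_measure set T -> \bar R}) (n : nat).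

Let power_measure0 : power_measure mu n set0 = 0%E.
Proof. by have [m ->] := power_measure_ex mu n; exact: measure0. Qed.

Let power_measure_ge0 A : (0 <= power_measure mu n A)%E.
Proof. by have [m ->] := power_measure_ex mu n; exact: measure_ge0. Qed.

Let power_measure_sigma_additive : semi_sigma_additive (power_measure mu n).
Proof.
by have [m ->] := power_measure_ex mu n; exact: measure_semi_sigma_additive.
Qed.

HB.instance Definition _ := isMeasure.Build _ _ _ (power_measure mu n)
  power_measure0 power_measure_ge0 power_measure_sigma_additive.

Let power_measure_sigma_finite : sigma_finite setT (power_measure mu n).
Proof. by have [m ->] := power_measure_ex mu n; exact: sigma_finiteT. Qed.

HB.instance Definition _ := Measure_isSigmaFinite.Build _ _ _
  (power_measure mu n) power_measure_sigma_finite.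

End power_measure.

Arguments power_measure {R d T} mu n.

(* Points are tuples rather than row vectors: tuples carry the product
   (Borel) sigma-algebra, and the norm of ['rV[R]_d] is the sup norm. *)
Notation euclidean R d := (d.-tuple (measurableTypeR R)).

Definition lebesgue_rd (R : realType) d : set (euclidean R d) -> \bar R :=
  power_measure lebesgue_measure d.

HB.instance Definition _ (R : realType) d :=
  SigmaFiniteMeasure.on (@lebesgue_rd R d).

Section geometry.
Context {R : realType} {d : nat}.
Implicit Types x y : euclidean R d.

Definition origin : euclidean R d := [tuple (0 : R) | i < d].
Definition escale (a : R) x : euclidean R d := [tuple a * tnth x i | i < d].
Definition esub x y : euclidean R d := [tuple (tnth x i : R) - tnth y i | i < d].
Definition enorm x : R := Num.sqrt (\sum_(i < d) (tnth x i : R) ^+ 2).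
Definition eball x (s : R) : set (euclidean R d) := [set y | enorm (esub y x) <= s].

Definition locally_finite (X : set (euclidean R d)) :=
  forall s : R, finite_set (X `&` eball origin s).

(* The edge relation of G(X, r). *)
Definition geom_graph (X : set (euclidean R d)) (r : R) : rel (euclidean R d) :=
  fun x y => [&& x \in X, y \in X, x != y & enorm (esub x y) <= r].

Definition component (X : set (euclidean R d)) (r : R) x : set (euclidean R d) :=
  [set y | X x /\ exists2 p, path (geom_graph X r) x p & last x p = y].

Definition cluster (X : set (euclidean R d)) : set (euclidean R d) :=
  component (X `|` [set origin]) 1 origin.

End geometry.

Definition theta (R : realType) (d : nat) : R :=
  fine (lebesgue_rd (eball (origin : euclidean R d) 1)).

Section poisson_process.
Context {R : realType} {d : nat} {disp : measure_display}
  {Omega : measurableType disp}.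
Variables (P : probability Omega R).

Definition count_event (H : Omega -> set (euclidean R d)) (A : set (euclidean R d))
  (n : nat) : set Omega := [set w | H w `&` A #= `I_n].

(* The Poisson mass function is written out because [poisson_pmf] is
   constantly 1 at rate 0, which occurs here for Lebesgue-null [A]. *)
Record poisson_process (lambda : R) (H : Omega -> set (euclidean R d)) : Prop := {
  pp_locally_finite : forall w, locally_finite (H w) ;
  pp_measurable : forall A n, measurable A -> measurable (count_event H A n) ;
  pp_poisson : forall A n, measurable A -> (lebesgue_rd A < +oo)%E ->
    let r := lambda * fine (lebesgue_rd A) in
    P (count_event H A n) = (expR (- r) * r ^+ n / n`!%:R)%:E ;
  pp_independent : forall (m : nat) (A : 'I_m -> set (euclidean R d))
      (n : 'I_m -> nat),
    (forall i, measurable (A i)) -> (forall i, (lebesgue_rd (A i) < +oo)%E) ->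
    trivIset setT A ->
    P (\bigcap_i count_event H (A i) (n i)) =
      (\prod_(i < m) P (count_event H (A i) (n i)))%E
}.

Definition cluster_prob (H : Omega -> set (euclidean R d)) (k : nat) : R :=
  fine (P [set w | cluster (H w) #= `I_k]).

End poisson_process.

Section alpha.
Context {R : realType}.

Definition Dset d k (z : k.-tuple (euclidean R d)) : set (euclidean R d) :=
  \bigcup_(i : 'I_k) eball (escale 2^-1 (tnth z i)) (enorm (tnth z i) / 2).

(* [enorm x ^- (d - 1)] is [enorm x] to the power 1 - d for [0 < d], except
   that for [1 < d] it takes the value 0 instead of +oo at the origin. *)
Definition gfun d k (z : k.-tuple (euclidean R d)) : R :=
  \int[@lebesgue_rd R d]_(x in Dset z) (enorm x ^- (d - 1)).

(* Meaningful for [0 < n] only. *)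
Definition alpha d n : R :=
  match n with
  | 0 => 0
  | 1 => 1
  | k.+1 => k`!%:R^-1 *
      \int[power_measure (@lebesgue_rd R d) k]_(z in setT) expR (- gfun z)
  end.

End alpha.

(* Main.v *)
(* A discretization of space yields the exact formula
     p_{k+1} = lambda^k / k! \int 1{o, z_1, .., z_k connected} e^{-lambda |U(z)|} dz,
   where U(z) is the union of the unit balls around o, z_1, .., z_k.  It consists
   of the unit ball, of volume theta, and of an outer region of volume V(z), so
   that the substitution z = x / lambda turns the left-hand side into
     1 / k! \int 1{o, x / lambda connected} e^{-lambda V(x / lambda)} dx.
   With m(u) the maximum of 0 and of the z_i.u, the ray of direction u meets
   D(z) in an interval of length m(u), and the outer region in an interval which
   starts at distance 1 and has length m(u) + O(|z|^2).  Integrating along rays,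
   lambda V(x / lambda) - g(x) = O(|x|^2 / lambda).  Both exponents are at least
   c |x| when o, x / lambda are connected, so the two integrals differ by at most
   lambda^-1 \int O(|x| + |x|^2) e^{-c |x|} dx. *)

Require Import Defs.
From HB Require Import structures.
From mathcomp Require Import all_boot all_order all_algebra.
From mathcomp Require Import all_classical all_reals all_analysis.
From mathcomp Require Import measurable_realfun.
From mathcomp Require Import ring lra.

Set Implicit Arguments.
Unset Strict Implicit.
Unset Printing Implicit Defensive.

Import Order.TTheory GRing.Theory Num.Theory.
Import numFieldNormedType.Exports.

Local Open Scope classical_set_scope.
Local Open Scope card_scope.
Local Open Scope ring_scope.

(** * Integration against power measures *)

(** [poisson_process] speaks only of counts in sets, so the exact formula is extracted from events
    that prescribe 0 or 1 points in finitely many grid cells. For each outcome such an event agrees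
    with the cluster event once the grid is fine enough, but with no uniformity in the outcome;
    dominated convergence, on the probability space and on the space of tuples, absorbs this. A
    bounded window suffices, since the points of a connected k-tuple have norm at most k. The lower
    bound on V is the delicate one: V - g = O(|z|^2) gives V >= c |z| for small |z| only, and larger
    tuples need an explicit ball outside the unit ball. The bound |z_i| <= k on connected tuples
    makes all constants uniform in lambda. The linear term |x| of the final error comes from the
    disconnected tuples: there |x| >= lambda, hence e^{-g(x)} <= lambda^-1 |x| e^{-c |x|}. *)

Section power_measure_integral.
Context {R : realType} {d : measure_display} {T : measurableType d}.
Variable mu : {sigma_finite_measure set T -> \bar R}.
Local Open Scope ereal_scope.

Lemma measurable_cons_tuple n (x : T) :
  measurable_fun setT (fun t : n.-tuple T => [tuple of x :: t]).
Proof.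
by apply: measurable_cons => //; exact: measurable_cst.
Qed.

Lemma ge0_integral_power_measure0 (f : 0%N.-tuple T -> \bar R) :
  measurable_fun setT f -> (forall t, 0 <= f t) ->
  \int[power_measure mu 0]_t f t = f [tuple].
Proof. by move=> mf f0; rewrite integral_dirac// diracT mul1e. Qed.

Section succ.
Variables (n : nat) (f : n.+1.-tuple T -> \bar R).
Hypothesis mf : measurable_fun setT f.
Hypothesis f0 : forall t, 0 <= f t.

(** Tonelli for the product underlying [power_measure]; the inductions on the number of entries
    below all go through this unfolding. *)
Lemma ge0_integral_power_measureS :
  \int[power_measure mu n.+1]_t f t =
  \int[mu]_x \int[power_measure mu n]_t f [tuple of x :: t].
Proof.
rewrite -[LHS]/(\int[pushforward (mu \x power_measure mu n) (@cons_pair _ T n)]_t f t).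
rewrite ge0_integral_pushforward//; last exact: measurable_cons_pair.
rewrite preimage_setT (fubini_tonelli1 (f \o @cons_pair _ T n))//; last by move=> x; exact: f0.
exact: (measurableT_comp mf (@measurable_cons_pair _ T n)).
Qed.

Lemma measurable_integral_cons :
  measurable_fun setT (fun x => \int[power_measure mu n]_t f [tuple of x :: t]).
Proof.
apply: (measurable_fun_fubini_tonelli_F (m2 := power_measure mu n) (f \o @cons_pair _ T n)).
- exact: (measurableT_comp mf (@measurable_cons_pair _ T n)).
- by move=> x; exact: f0.
Qed.

End succ.

Lemma tnth_cons0 n (x : T) (t : n.-tuple T) : tnth [tuple of x :: t] ord0 = x.
Proof. by []. Qed.

Lemma tnth_consS n (x : T) (t : n.-tuple T) (i : 'I_n) :
  tnth [tuple of x :: t] (lift ord0 i) = tnth t i.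
Proof. by rewrite (tnth_nth x) /= (tnth_nth x). Qed.

Lemma measurable_prode (d' : measure_display) (U : measurableType d') (I : Type)
    (s : seq I) (f : I -> U -> \bar R) :
  (forall i, measurable_fun setT (f i)) ->
  measurable_fun setT (fun x => \prod_(i <- s) f i x).
Proof.
move=> mf; elim: s => [|i s ih].
  by under eq_fun do rewrite big_nil; exact: measurable_cst.
by under eq_fun do rewrite big_cons; exact: emeasurable_funM.
Qed.

Lemma ge0_integral_power_measure_prod n (f : 'I_n -> T -> \bar R) :
  (forall i, measurable_fun setT (f i)) -> (forall i x, 0 <= f i x) ->
  \int[power_measure mu n]_t (\prod_(i < n) f i (tnth t i)) =
  \prod_(i < n) \int[mu]_x f i x.
Proof.
have mft m (g : 'I_m -> T -> \bar R) : (forall i, measurable_fun setT (g i)) ->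
  measurable_fun setT (fun t : m.-tuple T => \prod_(i < m) g i (tnth t i)).
  move=> mg; apply: measurable_prode => i.
  by apply: (measurableT_comp (mg i)) => //; exact: measurable_tnth.
elim: n f => [|n ih] f mf f0.
  rewrite big_ord0 ge0_integral_power_measure0//; first by rewrite big_ord0.
    exact: mft.
  by move=> t; rewrite big_ord0.
rewrite ge0_integral_power_measureS//; [|exact: mft|by move=> t; exact: prode_ge0].
rewrite big_ord_recl.
under eq_integral => x _.
  under eq_integral => t _.
    rewrite big_ord_recl tnth_cons0.
    under eq_bigr do rewrite tnth_consS.
    over.
  rewrite ge0_integralZl//; last first.
  - by move=> t _; exact: prode_ge0.
  - exact: (mft n (fun i => f (lift ord0 i))).
  rewrite (ih (fun i => f (lift ord0 i)))//.
  over.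
rewrite ge0_integralZr//; apply: prode_ge0 => i _; exact: integral_ge0.
Qed.

Lemma measurable_tuple_box n (A : 'I_n -> set T) : (forall i, measurable (A i)) ->
  measurable [set t : n.-tuple T | forall i, A i (tnth t i)].
Proof.
move=> mA; rewrite (_ : [set _ | _] = \bigcap_i ((@tnth n T)^~ i @^-1` A i)); last first.
  by apply/seteqP; split=> t /= h i; [move=> _; exact: h|exact: h].
apply: fin_bigcap_measurable => // i _; rewrite -[X in measurable X]setTI.
exact: measurable_tnth.
Qed.

Lemma power_measure_box n (A : 'I_n -> set T) : (forall i, measurable (A i)) ->
  power_measure mu n [set t | forall i, A i (tnth t i)] = \prod_(i < n) mu (A i).
Proof.
move=> mA; rewrite -[X in power_measure _ _ X]setIT -integral_indic//; last exact: measurable_tuple_box.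
under [RHS]eq_bigr => i _ do rewrite -[A i]setIT -integral_indic//.
rewrite -ge0_integral_power_measure_prod//.
- apply: eq_integral => t _; rewrite prodEFin; congr EFin; rewrite indicE.
  have [h|h] := boolP (t \in _).
    rewrite big1// => i _; rewrite indicE mem_set//; exact: (set_mem h).
  have /existsNP[i Ai] : ~ forall i, A i (tnth t i) by move=> h'; case/negP: h; rewrite inE.
  by rewrite (bigD1 i)//= indicE memNset// mul0r.
- by move=> i; apply/measurable_EFinP; exact: measurable_indic.
Qed.

Lemma measurable_map_tuple n (phi : T -> T) : measurable_fun setT phi ->
  measurable_fun setT (fun t : n.-tuple T => [tuple of map phi t]).
Proof.
move=> mphi; apply/measurable_fun_tnthP => i.
rewrite (_ : _ \o _ = phi \o (@tnth n T)^~ i); last by apply/funext => t /=; rewrite tnth_map.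
by apply: measurableT_comp => //; exact: measurable_tnth.
Qed.

(** The map is abstract so that the lemma serves twice: from the line to R^d with c = 1/a, then from
    R^d to k-tuples of points with c = a^-d. *)
Lemma ge0_integral_power_measure_scale (phi : T -> T) (c : R) n :
  (0 <= c)%R -> measurable_fun setT phi ->
  (forall f : T -> \bar R, measurable_fun setT f -> (forall x, 0 <= f x) ->
     \int[mu]_x f (phi x) = c%:E * \int[mu]_x f x) ->
  forall f : n.-tuple T -> \bar R, measurable_fun setT f -> (forall t, 0 <= f t) ->
  \int[power_measure mu n]_t f [tuple of map phi t] =
    (c ^+ n)%:E * \int[power_measure mu n]_t f t.
Proof.
move=> c0 mphi hphi; elim: n => [|n ih] f mf f0.
  rewrite !ge0_integral_power_measure0//; first by rewrite expr0 mul1e; congr f; exact/val_inj.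
  by apply: (measurableT_comp mf) => //; exact: measurable_map_tuple.
rewrite !ge0_integral_power_measureS//; last first.
  by apply: (measurableT_comp mf) => //; exact: measurable_map_tuple.
rewrite exprS EFinM -muleA -ge0_integralZl//; last 3 first.
- exact: measurable_integral_cons.
- by move=> x _; exact: integral_ge0.
- by rewrite lee_fin exprn_ge0.
rewrite -(hphi (fun x => (c ^+ n)%:E * _)); last 2 first.
- by apply: measurable_funeM; exact: measurable_integral_cons.
- by move=> x; rewrite mule_ge0 ?lee_fin ?exprn_ge0//; exact: integral_ge0.
apply: eq_integral => x _.
rewrite -(ih (fun t => f [tuple of phi x :: t]))//; last first.
  by apply: (measurableT_comp mf) => //; exact: measurable_cons_tuple.
by apply: eq_integral => t _; congr f; exact/val_inj.
Qed.

(** Given a tail t with a :: t free of repetitions, the bad heads are the finitely many entries of a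
    :: t, a null set as [mu] has no atoms. With a the origin, this discards the tuples on which the
    grid approximation fails. *)
Lemma power_measure_not_uniq n (a : T) : (forall x, mu [set x] = 0) ->
  (forall x : T, measurable [set x]) ->
  (forall m, measurable [set t : m.-tuple T | ~~ uniq (a :: t)]) ->
  power_measure mu n [set t : n.-tuple T | ~~ uniq (a :: t)] = 0.
Proof.
move=> mu0 m1 mU; elim: n => [|n ih].
  rewrite (_ : [set _ | _] = set0) ?measure0// -subset0 => t /=; by rewrite (tuple0 t).
rewrite -[X in power_measure _ _ X]setIT -integral_indic//; last exact: mU.
have mI : measurable_fun setT (fun t : n.+1.-tuple T => (\1_[set t : n.+1.-tuple T | ~~ uniq (a :: t)] t)%:E : \bar R).
  by apply/measurable_EFinP; apply: measurable_indic; exact: mU.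
rewrite ge0_integral_power_measureS//.
(* The order is swapped so that the tail is fixed first; the tails that are already bad form a null
   set by induction. *)
rewrite (fubini_tonelli (m1 := mu) (m2 := power_measure mu n)
  (fun p => (\1_[set t : n.+1.-tuple T | ~~ uniq (a :: t)] (cons_pair p))%:E))//; last first.
  exact: (measurableT_comp mI (@measurable_cons_pair _ T n)).
have mG : measurable_fun setT (fun t => \int[mu]_x
    (\1_[set t : n.+1.-tuple T | ~~ uniq (a :: t)] (cons_pair (x, t)))%:E).
  apply: (measurable_fun_fubini_tonelli_G (m1 := mu)
    (fun p => (\1_[set t : n.+1.-tuple T | ~~ uniq (a :: t)] (cons_pair p))%:E)) => //.
  exact: (measurableT_comp mI (@measurable_cons_pair _ T n)).
rewrite (ae_eq_integral (cst 0)) ?integral_cst ?mul0e//.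
exists [set t : n.-tuple T | ~~ uniq (a :: t)]; split; [exact: mU|exact: ih|] => t /= /not_implyP[_] h.
apply/negP => u; apply: h.
pose B : set T := [set x | ~~ uniq [:: a, x & t]].
have BE : B = [set` (a :: t)].
  case/andP: u => /negbTE at0 ut; apply/seteqP.
  by split=> x; rewrite /B /= !inE at0 orbF ut andbT negb_and !negbK eq_sym.
transitivity (\int[mu]_x (\1_B x)%:E).
  by apply: eq_integral => x _; rewrite !indicE.
have h2 (s : seq T) : measurable [set` s] /\ mu [set` s] = 0.
  elim: s => [|x s [ms s0]]; first by rewrite classical_sets.set_nil measure0.
  have -> : [set` (x :: s)] = [set x] `|` [set` s].
    by apply/seteqP; split=> y /=; rewrite inE => /predU1P.
  split; first exact: measurableU.
  by rewrite measureU0//; exact: mu0.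
have [ms s0] := h2 (a :: t).
by rewrite BE integral_indic// setIT.
Qed.

End power_measure_integral.

(** * Lebesgue measure under dilations *)

Section lebesgue_scaling.
Context {R : realType}.
Local Open Scope ereal_scope.
Local Notation mul := ( *%R : measurableTypeR R -> measurableTypeR R -> measurableTypeR R).

(** The right-hand side is a measure in [A] with the same values on half-open intervals, so
    uniqueness of Lebesgue measure applies. *)
Lemma lebesgue_measure_scale (a : R) (A : set (measurableTypeR R)) :
  (0 < a)%R -> measurable A ->
  lebesgue_measure A = a%:E * lebesgue_measure (mul a @^-1` A).
Proof.
move=> a0 mA; have ma : measurable_fun setT (mul a) by exact: mulrl_measurable.
have [nu nuE] : exists nu : {measure set (measurableTypeR R) -> \bar R},
    (forall A, nu A = a%:E * lebesgue_measure (mul a @^-1` A)).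
  have [nu0 nu0E] : exists nu : {measure set (measurableTypeR R) -> \bar R},
    forall B, nu B = lebesgue_measure (mul a @^-1` B).
    by unshelve eexists (pushforward lebesgue_measure (mul a)).
  by exists (mscale (NngNum (ltW a0)) nu0) => B; rewrite -nu0E.
rewrite -nuE; apply: lebesgue_measure_unique => // _ [[b c] _ <-]/=.
rewrite nuE (_ : _ @^-1` _ = `](b / a)%R, (c / a)%R]%classic); last first.
  apply/seteqP; split=> x /=; rewrite !in_itv/= ltr_pdivrMr// ler_pdivlMr// [(x * a)%R]mulrC.
    by [].
  by [].
rewrite !lebesgue_measure_itv/= !lte_fin ltr_pM2r ?invr_gt0//.
case: ifP => _; last by rewrite mule0.
rewrite -!EFinD -EFinM; congr EFin; field.
by rewrite gt_eqF.
Qed.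

Lemma ge0_integral_lebesgue_scale (a : R) (f : measurableTypeR R -> \bar R) :
  (0 < a)%R -> measurable_fun setT f -> (forall x, 0 <= f x) ->
  \int[lebesgue_measure]_x f (mul a x) = (a^-1)%:E * \int[lebesgue_measure]_x f x.
Proof.
move=> a0 mf f0; have ma : measurable_fun setT (mul a) by exact: mulrl_measurable.
have am0 : (0 <= a^-1)%R by rewrite invr_ge0 ltW.
rewrite -(@ge0_integral_mscale _ _ _ _ _ _ (NngNum am0))//.
transitivity (\int[pushforward lebesgue_measure (mul a)]_x f x).
  by rewrite ge0_integral_pushforward// preimage_setT.
apply: eq_measure_integral => A mA _.
rewrite -[RHS]/(a^-1%:E * lebesgue_measure A) (lebesgue_measure_scale a0 mA).
by rewrite muleA -EFinM mulVf ?gt_eqF// mul1e.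
Qed.

End lebesgue_scaling.

Section rd_scaling.
Context {R : realType} {d : nat}.
Local Open Scope ereal_scope.

Lemma measurable_escale (a : R) : measurable_fun setT (@escale R d a).
Proof.
apply/measurable_fun_tnthP => i.
rewrite (_ : _ \o _ = (fun x => a * tnth x i)%R).
  by apply: measurable_funM => //; exact: measurable_tnth.
by apply/funext => x; rewrite /= tnth_mktuple.
Qed.

Lemma ge0_integral_rd_scale (a : R) (f : euclidean R d -> \bar R) :
  (0 < a)%R -> measurable_fun setT f -> (forall x, 0 <= f x) ->
  \int[@lebesgue_rd R d]_x f (escale a x) = (a ^- d)%:E * \int[@lebesgue_rd R d]_x f x.
Proof.
move=> a0 mf f0.
have ma : measurable_fun setT ( *%R a : measurableTypeR R -> measurableTypeR R).
  exact: mulrl_measurable.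
have ai0 : (0 <= a^-1)%R by rewrite invr_ge0 ltW.
have h := @ge0_integral_power_measure_scale R _ _ lebesgue_measure
  ( *%R a : measurableTypeR R -> measurableTypeR R) a^-1 d ai0 ma _ f mf f0.
rewrite -exprVn -h; last by move=> g mg g0; exact: ge0_integral_lebesgue_scale.
by apply: eq_integral => x _; congr f; apply: eq_from_tnth => i; rewrite tnth_mktuple tnth_map.
Qed.

Lemma ge0_integral_rdk_scale k (a : R) (f : k.-tuple (euclidean R d) -> \bar R) :
  (0 < a)%R -> measurable_fun setT f -> (forall x, 0 <= f x) ->
  \int[power_measure (@lebesgue_rd R d) k]_x f [tuple of map (escale a) x] =
  (a ^- (d * k))%:E * \int[power_measure (@lebesgue_rd R d) k]_x f x.
Proof.
move=> a0 mf f0; rewrite exprM -exprVn (ge0_integral_power_measure_scale (phi := escale a) (c := a ^- d))//.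
- by rewrite invr_ge0 exprn_ge0// ltW.
- exact: measurable_escale.
- by move=> g mg g0; exact: ge0_integral_rd_scale.
Qed.

End rd_scaling.

(** * Euclidean geometry *)

Section euclidean_geometry.
Context {R : realType} {d : nat}.
Implicit Types x y z : euclidean R d.

Definition edot x y : R := \sum_(i < d) (tnth x i : R) * tnth y i.

Definition eadd x y : euclidean R d := [tuple (tnth x i : R) + tnth y i | i < d].

Lemma enorm_ge0 x : 0 <= enorm x. Proof. exact: sqrtr_ge0. Qed.
Hint Resolve enorm_ge0 : core.

Lemma edotC x y : edot x y = edot y x.
Proof. by apply: eq_bigr => i _; rewrite mulrC. Qed.

Lemma edotZl a x y : edot (escale a x) y = a * edot x y.
Proof. by rewrite big_distrr/=; apply: eq_bigr => i _; rewrite tnth_mktuple mulrA. Qed.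

Lemma edotZr a x y : edot x (escale a y) = a * edot x y.
Proof. by rewrite edotC edotZl edotC. Qed.

Lemma edotBl x y z : edot (esub x y) z = edot x z - edot y z.
Proof. by rewrite -sumrB; apply: eq_bigr => i _; rewrite tnth_mktuple mulrBl. Qed.

Lemma edotBr x y z : edot z (esub x y) = edot z x - edot z y.
Proof. by rewrite edotC edotBl !(edotC z). Qed.

Lemma edotDl x y z : edot (eadd x y) z = edot x z + edot y z.
Proof. by rewrite -big_split; apply: eq_bigr => i _; rewrite tnth_mktuple mulrDl. Qed.

Lemma edotDr x y z : edot z (eadd x y) = edot z x + edot z y.
Proof. by rewrite edotC edotDl !(edotC z). Qed.

Lemma enorm_sqr x : enorm x ^+ 2 = edot x x.
Proof. by rewrite sqr_sqrtr// sumr_ge0// => i _; rewrite sqr_ge0. Qed.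

Lemma ler_enorm x (r : R) : 0 <= r -> (enorm x <= r) = (edot x x <= r ^+ 2).
Proof. by move=> r0; rewrite -enorm_sqr ler_sqr ?nnegrE. Qed.

Lemma enorm_eq0 x : (enorm x == 0) = (x == origin).
Proof.
apply/eqP/eqP => [x0|->].
  have : edot x x == 0 by rewrite -enorm_sqr x0 expr0n.
  rewrite psumr_eq0 => [/allP h|i _]; last exact: sqr_ge0.
  apply: eq_from_tnth => i; rewrite tnth_mktuple.
  by have := h i (mem_index_enum _); rewrite mulf_eq0 orbb => /eqP.
by rewrite /enorm big1 ?sqrtr0// => i _; rewrite tnth_mktuple expr0n.
Qed.

Lemma enorm0 : enorm (origin : euclidean R d) = 0.
Proof. by apply/eqP; rewrite enorm_eq0. Qed.

Lemma enormZ a x : enorm (escale a x) = `|a| * enorm x.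
Proof.
apply/eqP; rewrite -(@eqrXn2 _ 2)// ?mulr_ge0//.
by rewrite exprMn !enorm_sqr edotZl edotZr mulrA -expr2 real_normK ?num_real.
Qed.

(** Cauchy-Schwarz: x/|x| - y/|y| has a nonnegative squared norm, equal to 2 (1 - x.y /
    (|x||y|)). *)
Lemma edot_le x y : edot x y <= enorm x * enorm y.
Proof.
have [/eqP|x0] := eqVneq (enorm x) 0.
  rewrite enorm_eq0 => /eqP ->; rewrite enorm0 mul0r.
  by rewrite /edot big1// => i _; rewrite tnth_mktuple mul0r.
have [/eqP|y0] := eqVneq (enorm y) 0.
  rewrite enorm_eq0 => /eqP ->; rewrite enorm0 mulr0.
  by rewrite /edot big1// => i _; rewrite tnth_mktuple mulr0.
pose w := esub (escale (enorm x)^-1 x) (escale (enorm y)^-1 y).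
have : 0 <= edot w w by rewrite -enorm_sqr exprn_ge0.
rewrite /w !(edotBl, edotBr, edotZl, edotZr) -!enorm_sqr [edot y x]edotC.
set a := enorm x; set b := enorm y; set p := edot x y.
have -> : a^-1 * (a^-1 * a ^+ 2) - a^-1 * (b^-1 * p) -
   (b^-1 * (a^-1 * p) - b^-1 * (b^-1 * b ^+ 2)) = 2 * (1 - p / (a * b)).
  by field; rewrite x0 y0.
have ab0 : 0 < a * b by rewrite mulr_gt0// lt0r ?x0 ?y0/= enorm_ge0.
by rewrite pmulr_rge0// subr_ge0 ler_pdivrMr// mul1r.
Qed.

Lemma edot_ge x y : - (enorm x * enorm y) <= edot x y.
Proof.
have := edot_le (escale (-1) x) y; rewrite edotZl enormZ normrN1 mul1r mulN1r.
by rewrite lerNl.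
Qed.

Lemma enormD x y : enorm (eadd x y) <= enorm x + enorm y.
Proof.
rewrite ler_enorm ?addr_ge0// !(edotDl, edotDr) [edot y x]edotC sqrrD !enorm_sqr.
by have := edot_le x y; lra.
Qed.

Lemma esubC x y : enorm (esub x y) = enorm (esub y x).
Proof.
apply/eqP; rewrite -(@eqrXn2 _ 2)// !enorm_sqr !(edotBl, edotBr) [edot y x]edotC.
by apply/eqP; ring.
Qed.

Lemma edist_triangle y x z : enorm (esub x z) <= enorm (esub x y) + enorm (esub y z).
Proof.
suff -> : esub x z = eadd (esub x y) (esub y z) by exact: enormD.
by apply: eq_from_tnth => i; rewrite !tnth_mktuple; ring.
Qed.

Lemma esub0 x : esub x origin = x.
Proof. by apply: eq_from_tnth => i; rewrite !tnth_mktuple subr0. Qed.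

Lemma edist_eq0 x y : (enorm (esub x y) == 0) = (x == y).
Proof.
rewrite enorm_eq0; apply/eqP/eqP => [h|->]; last first.
  by apply: eq_from_tnth => i; rewrite !tnth_mktuple subrr.
apply: eq_from_tnth => i; apply/eqP; rewrite -subr_eq0.
by have := congr1 (fun t => tnth t i) h; rewrite !tnth_mktuple => ->.
Qed.

(** With [enorm_le_sum], this sandwiches Euclidean balls between boxes, whose volume is explicit. *)
Lemma coord_le_enorm x (i : 'I_d) : `|tnth x i : R| <= enorm x.
Proof.
rewrite -(@ler_pXn2r _ 2) ?nnegrE// enorm_sqr real_normK ?num_real//.
rewrite /edot (bigD1 i)//= -expr2 lerDl sumr_ge0// => j _.
by rewrite -expr2 sqr_ge0.
Qed.

Lemma enorm_le_sum x : enorm x <= \sum_(i < d) `|tnth x i : R|.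
Proof.
rewrite ler_enorm ?sumr_ge0//.
rewrite expr2 mulr_suml; apply: ler_sum => i _.
apply: (le_trans (ler_norm _)); rewrite normrM; apply: ler_wpM2l => //.
by rewrite (bigD1 i)//= lerDl sumr_ge0.
Qed.

Lemma measurable_enorm : measurable_fun setT (@enorm R d).
Proof.
have ms : measurable_fun setT (Num.sqrt : R -> R).
  by apply: continuous_measurable_fun; exact: sqrt_continuous.
apply: (measurableT_comp (g := fun x : euclidean R d => \sum_(i < d) (tnth x i : R) ^+ 2) ms).
apply: measurable_sum => i; apply: (@measurable_funX _ _ R _ (fun x : euclidean R d => tnth x i)).
exact: measurable_tnth.
Qed.

Section measurable_ops.
Context {disp : measure_display} {T : measurableType disp}.
Variables f g : T -> euclidean R d.
Hypotheses (mf : measurable_fun setT f) (mg : measurable_fun setT g).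

Let mt (h : T -> euclidean R d) i : measurable_fun setT h ->
  measurable_fun setT (fun t => tnth (h t) i : R).
Proof. by move=> mh; exact: (measurableT_comp (@measurable_tnth _ _ d i) mh). Qed.

Lemma measurable_esub : measurable_fun setT (fun t => esub (f t) (g t)).
Proof.
apply/measurable_fun_tnthP => i.
rewrite (_ : _ \o _ = fun t => (tnth (f t) i - tnth (g t) i)%R); last first.
  by apply/funext => t /=; rewrite tnth_mktuple.
by apply: measurable_funB; exact: mt.
Qed.

Lemma measurable_edist : measurable_fun setT (fun t => enorm (esub (f t) (g t))).
Proof. exact: measurableT_comp measurable_enorm measurable_esub. Qed.

Lemma measurable_edot : measurable_fun setT (fun t => edot (f t) (g t)).
Proof. by apply: measurable_sum => i; apply: measurable_funM; exact: mt. Qed.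

End measurable_ops.

End euclidean_geometry.
#[global] Hint Extern 0 (is_true (0 <= enorm _)) => solve [apply: enorm_ge0] : core.

(** * Integration along rays *)

Section lebesgue_rd.
Context {R : realType} {d : nat}.
Local Notation E := (euclidean R d).
Local Notation mu := (@lebesgue_rd R d).

Lemma measurable_euclidean_set1 (x : E) : measurable [set x].
Proof.
rewrite (_ : [set x] = [set y | forall i, [set tnth x i] (tnth y i)]).
  apply: (@measurable_tuple_box _ _ d (fun i => [set tnth x i])) => i.
  exact: measurable_set1.
apply/seteqP; split => [y -> //|y /= h]; apply: eq_from_tnth => i; exact: h.
Qed.

Lemma lebesgue_rd_box (a b : 'I_d -> R) : (forall i, a i <= b i) ->
  mu [set x | forall i, a i <= tnth x i <= b i] = (\prod_(i < d) (b i - a i))%:E.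
Proof.
move=> ab; rewrite [LHS](@power_measure_box R _ _ lebesgue_measure d (fun i => `[a i, b i]%classic)).
  rewrite -prodEFin; apply: eq_bigr => i _ /=; rewrite lebesgue_measure_itv/= lte_fin.
  case: ltP => // h; rewrite (_ : a i = b i) ?subrr//; exact/le_anti/andP.
by move=> i; exact: measurable_itv.
Qed.

Lemma measurable_box (a b : 'I_d -> R) :
  measurable [set x : E | forall i, a i <= tnth x i <= b i].
Proof.
apply: (@measurable_tuple_box _ _ d (fun i => `[a i, b i]%classic)) => i.
exact: measurable_itv.
Qed.

Lemma lebesgue_rd_set1 (x : E) : (0 < d)%N -> mu [set x] = 0%E.
Proof.
move=> d0; rewrite (_ : [set x] = [set y | forall i, tnth x i <= tnth y i <= (tnth x i : R)]).
  by rewrite lebesgue_rd_box// (bigD1 (Ordinal d0))//= subrr mul0r.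
apply/seteqP; split => [y -> /= i|y /= h]; first by rewrite lexx.
by apply: eq_from_tnth => i; apply/le_anti; rewrite andbC h.
Qed.

Lemma measurable_eball (x : E) r : measurable (eball x r).
Proof.
rewrite -[eball x r]setTI.
rewrite (_ : eball x r = (fun y => enorm (esub y x) <= r) @^-1` [set true]); last first.
  by apply/seteqP; split.
have : measurable_fun setT (fun y : E => enorm (esub y x) <= r).
  apply: measurable_fun_ler => //.
  by apply: measurable_edist => //; exact: measurable_cst.
by apply.
Qed.

Lemma lebesgue_rd_eball_lty (x : E) r : (mu (eball x r) < +oo)%E.
Proof.
have [r0|r0] := leP 0 r; last first.
  rewrite (_ : eball x r = set0) ?measure0// -subset0 => y.
  by rewrite /eball/= leNgt (lt_le_trans r0).
apply: (@le_lt_trans _ _ (mu [set y | forall i, tnth x i - r <= tnth y i <= (tnth x i : R) + r])).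
  apply: le_measure; rewrite ?inE; [exact: measurable_eball|exact: measurable_box|].
  move=> y; rewrite /eball /= => yr i.
  have := le_trans (coord_le_enorm _ i) yr; rewrite tnth_mktuple ler_norml.
  by move=> /andP[h1 h2]; apply/andP; split; lra.
by rewrite lebesgue_rd_box ?ltry// => i; lra.
Qed.

(** The cube of half-side r/d lies in the ball, the norm being at most the sum of the d
    coordinates. *)
Lemma lebesgue_rd_eball_ge (x : E) r : (0 < d)%N -> 0 <= r ->
  (((2 * r / d%:R) ^+ d)%:E <= mu (eball x r))%E.
Proof.
move=> d0 r0; have dr : 0 < d%:R :> R by rewrite ltr0n.
have rd0 : 0 <= r / d%:R by rewrite divr_ge0// ltW.
apply: (@le_trans _ _ (mu [set y | forall i, tnth x i - r / d%:R <= tnth y i <= (tnth x i : R) + r / d%:R])).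
  rewrite lebesgue_rd_box => [|i]; last by lra.
  rewrite lee_fin (eq_bigr (fun=> 2 * r / d%:R)) ?prodr_const ?card_ord//.
  by move=> i _; lra.
apply: le_measure; rewrite ?inE; [exact: measurable_box|exact: measurable_eball|].
move=> y /= h; apply: (le_trans (enorm_le_sum _)).
apply: (@le_trans _ _ (\sum_(i < d) r / d%:R)).
  apply: ler_sum => i _; rewrite tnth_mktuple ler_norml; have /andP[] := h i; lra.
by rewrite sumr_const card_ord -[_ *+ _]mulr_natr divfK// gt_eqF.
Qed.

Lemma measurable_escale2 : measurable_fun setT (fun p : E * measurableTypeR R => escale p.2 p.1).
Proof.
apply/measurable_fun_tnthP => i.
rewrite (_ : _ \o _ = fun p => (p.2 : R) * tnth p.1 i); last first.
  by apply/funext => p /=; rewrite tnth_mktuple.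
apply: measurable_funM; first exact: measurable_snd.
exact: (measurableT_comp (@measurable_tnth _ _ d i) measurable_fst).
Qed.

Definition shell_weight (w : E) : R :=
  if 1 <= enorm w <= 2 then 2 / enorm w else 0.

(** The polar Jacobian, extended by 0 so that rays can be integrated over the whole line. *)
Definition ray_density (s : R) : R := if 0 < s then s ^+ d.-1 else 0.

Lemma shell_weight_ge0 w : 0 <= shell_weight w.
Proof. by rewrite /shell_weight; case: ifP => // _; rewrite divr_ge0. Qed.

Lemma ray_density_ge0 s : 0 <= ray_density s.
Proof. by rewrite /ray_density; case: ifP => // s0; rewrite exprn_ge0// ltW. Qed.

(** The inverse is x (x^2)^-1, a product with a power of a nonnegative number; at 0 both sides
    vanish by convention. *)
Lemma measurable_invr : measurable_fun setT (fun x : R => x^-1).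
Proof.
rewrite (_ : (fun _ => _) = (fun x => x * (x ^+ 2) `^ (-1))).
  apply: measurable_funM => //.
  by apply: (measurableT_comp (measurable_powR (-1))); exact: exprn_measurable.
apply/funext => x; rewrite powR_inv1 ?sqr_ge0//.
have [->|x0] := eqVneq x 0; first by rewrite invr0 mul0r.
by rewrite expr2 invfM mulrA divff// mul1r.
Qed.

Lemma measurable_enormV : measurable_fun setT (fun x : E => (enorm x)^-1).
Proof. exact: (measurableT_comp measurable_invr (@measurable_enorm R d)). Qed.

Lemma measurable_shell_weight : measurable_fun setT shell_weight.
Proof.
apply: measurable_fun_ifT => //.
- by apply: measurable_and; apply: measurable_fun_ler => //; exact: measurable_enorm.
- apply: measurable_funM => //.
  exact: measurable_enormV.
Qed.

Lemma measurable_ray_density : measurable_fun setT (ray_density : measurableTypeR R -> R).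
Proof.
apply: measurable_fun_ifT => //; first exact: measurable_fun_ltr.
Qed.

Local Open Scope ereal_scope.

(** The integrand is K(y/s)/s with K the shell weight. It equals 2/|y| for s between |y|/2 and |y|
    and 0 elsewhere: the factor 2 in [shell_weight] is this normalization. *)
Lemma shell_ray_weight (y : E) : (0 < d)%N -> y != origin ->
  \int[lebesgue_measure]_s
    (ray_density s * (if 0 < s then s ^- d else 0) * shell_weight (escale s^-1 y))%:E = 1.
Proof.
move=> d0 y0; have n0 : (0 < enorm y)%R by rewrite lt0r enorm_eq0 y0 enorm_ge0.
transitivity (\int[lebesgue_measure]_(s in `[(enorm y / 2)%R, enorm y]) ((2 / enorm y)%:E : \bar R)).
  rewrite [RHS]integral_mkcond; apply: eq_integral => s _.
  rewrite patchE; have -> : (s \in (`[(enorm y / 2)%R, enorm y]%classic : set R)) =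
    (enorm y / 2 <= s <= enorm y)%R by rewrite mem_setE in_itv.
  rewrite /ray_density /shell_weight; case: ltP => s0; last first.
    rewrite mul0r mul0r; case: ifP => // /andP[h _].
    have := le_trans h s0; rewrite leNgt divr_gt0//.
  rewrite enormZ gtr0_norm ?invr_gt0// [(s^-1 * _)%R]mulrC ler_pdivlMr// mul1r ler_pdivrMr//.
  rewrite [(enorm y / 2 <= s)%R]ler_pdivrMr// [(s * 2)%R]mulrC.
  rewrite andbC; case: ifP => // _; last by rewrite mulr0.
  congr EFin; rewrite -{2}(prednK d0) exprS; field.
  by rewrite !gt_eqF// exprn_gt0.
rewrite integral_cst//= lebesgue_measure_itv/= lte_fin ltr_pdivrMr// ltr_pMr// ltr1n.
rewrite -EFinD -EFinM; congr EFin; field.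
by rewrite gt_eqF.
Qed.

(* Polar coordinates without the sphere: the direction [w] ranges over a shell,
   with a radial weight [K] such that [\int K (y / s) ds / s = 1] for [y != 0]. *)
Lemma ge0_integral_ray (F : E -> \bar R) : (0 < d)%N ->
  measurable_fun setT F -> (forall x, 0 <= F x) ->
  \int[mu]_y F y = \int[mu]_w ((shell_weight w)%:E *
     \int[lebesgue_measure]_s ((ray_density s)%:E * F (escale s w))).
Proof.
move=> d0 mF F0.
pose G (p : E * measurableTypeR R) := (shell_weight p.1)%:E *
  ((ray_density p.2)%:E * F (escale p.2 p.1)).
have mK := measurable_shell_weight.
have mr := measurable_ray_density.
have mFs : measurable_fun setT (fun p : E * measurableTypeR R => F (escale p.2 p.1)).
  exact: measurableT_comp mF measurable_escale2.
have mG : measurable_fun setT G.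
  apply: emeasurable_funM.
    by apply/measurable_EFinP; exact: (measurableT_comp mK measurable_fst).
  apply: emeasurable_funM => //.
  by apply/measurable_EFinP; exact: (measurableT_comp mr measurable_snd).
have G0 p : 0 <= G p.
  by rewrite !mule_ge0// lee_fin ?shell_weight_ge0 ?ray_density_ge0.
have mpair (w : E) : measurable_fun setT (fun s : measurableTypeR R => (w, s)).
  exact: pair1_measurable.
have Fw w : measurable_fun setT (fun s => (ray_density s)%:E * F (escale s w)).
  apply: emeasurable_funM; first exact/measurable_EFinP.
  exact: (measurableT_comp mFs (mpair w)).
transitivity (\int[mu]_w \int[lebesgue_measure]_s G (w, s)); last first.
  apply: eq_integral => w _; rewrite /G/= ge0_integralZl//.
  - exact: Fw.
  - by move=> s _; rewrite mule_ge0// lee_fin ray_density_ge0.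
  - by rewrite lee_fin shell_weight_ge0.
rewrite (fubini_tonelli (m1 := mu) (m2 := lebesgue_measure) G)//.
(* The total weight after substituting y = s w for fixed s > 0, which costs the Jacobian s^-d. *)
pose W (p : E * measurableTypeR R) : R := (ray_density p.2 * (if (0 < p.2)%R then p.2 ^- d else 0) *
   shell_weight (escale p.2^-1 p.1))%R.
have mV2 : measurable_fun setT (fun p : E * measurableTypeR R => ((p.2 : R)^-1)%R).
  exact: (measurableT_comp measurable_invr measurable_snd).
have mW : measurable_fun setT W.
  apply: measurable_funM; first apply: measurable_funM.
  - exact: (measurableT_comp mr measurable_snd).
  - apply: measurable_fun_ifT => //; first exact: measurable_fun_ltr.
    rewrite (_ : (fun _ => _) = fun p : E * measurableTypeR R => ((p.2 : R)^-1 ^+ d)%R); last first.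
      by apply/funext => p; rewrite exprVn.
    exact: measurable_funX.
  - apply: (measurableT_comp mK).
    apply: (measurableT_comp measurable_escale2 (g := fun p : E * measurableTypeR R => (p.1, ((p.2 : R)^-1)%R))).
    exact: measurable_fun_pair.
have W0 p : (0 <= W p)%R.
  rewrite /W !mulr_ge0 ?shell_weight_ge0 ?ray_density_ge0//.
  by case: ifPn => // h; rewrite invr_ge0 exprn_ge0// ltW.
transitivity (\int[lebesgue_measure]_s \int[mu]_y ((W (y, s))%:E * F y)); last first.
  apply: eq_integral => s _; rewrite /W/=; have [s0|s0] := ltP 0%R s; last first.
    have r0 : ray_density s = 0%R by rewrite /ray_density ltNge s0.
    by rewrite !integral0_eq// => y _; rewrite /G/= r0 ?mul0r ?mul0e ?mule0.
  apply/esym; pose g y := (shell_weight (escale s^-1 y))%:E * ((ray_density s)%:E * F y).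
  transitivity (\int[mu]_y g (escale s y)).
    apply: eq_integral => y _; rewrite /G/g/=; suff -> : escale s^-1 (escale s y) = y by [].
    by apply: eq_from_tnth => i; rewrite !tnth_mktuple mulrA mulVf ?gt_eqF// mul1r.
  have g0 y : 0 <= g y.
    by rewrite !mule_ge0// lee_fin ?shell_weight_ge0 ?ray_density_ge0.
  have mg : measurable_fun setT g.
    apply: emeasurable_funM; last exact: measurable_funeM.
    by apply/measurable_EFinP; apply: (measurableT_comp mK); exact: measurable_escale.
  rewrite ge0_integral_rd_scale// -ge0_integralZl//; last first.
    by rewrite lee_fin invr_ge0 exprn_ge0// ltW.
  apply: eq_integral => y _; rewrite /g !muleA -!EFinM; congr (_%:E * _).
  by ring.
rewrite -(fubini_tonelli (m1 := mu) (m2 := lebesgue_measure) (fun p => (W p)%:E * F p.1))//; last 2 first.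
- apply: emeasurable_funM; first exact/measurable_EFinP.
  exact: (measurableT_comp mF measurable_fst).
- by move=> p; rewrite mule_ge0// lee_fin.
have ms1 : measurable ([set origin] : set E) by exact: measurable_euclidean_set1.
have mWF : measurable_fun setT (fun p : E * measurableTypeR R => (W p)%:E * F p.1).
  apply: emeasurable_funM; first exact/measurable_EFinP.
  exact: (measurableT_comp mF measurable_fst).
have WF0 p : 0 <= (W p)%:E * F p.1 by rewrite mule_ge0// lee_fin.
apply: ae_eq_integral => //.
  exact: (measurable_fun_fubini_tonelli_F (m2 := lebesgue_measure) (fun p => (W p)%:E * F p.1)).
(* For y other than the origin [W] integrates to 1 in s; the origin is a null set. *)
exists [set origin]; split => //; first exact: lebesgue_rd_set1.
move=> y /= /not_implyP[_ h]; apply/eqP/negPn/negP => y0; apply: h.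
rewrite ge0_integralZr//.
- by rewrite [X in _ = X * _](shell_ray_weight d0 y0) mul1e.
- apply/measurable_EFinP; exact: (measurableT_comp mW (mpair y)).
- by move=> s _; rewrite lee_fin.
Qed.

End lebesgue_rd.

(** * The region outside the unit ball *)

Section outer_region.
Context {R : realType} {d : nat}.
Local Notation E := (euclidean R d).
Local Notation mu := (@lebesgue_rd R d).
Implicit Types (x y w : E).

(** Thales: y lies in the ball with diameter from o to x exactly when y.(y - x) <= 0. *)
Lemma in_ball_diameter x y :
  eball (escale 2^-1 x) (enorm x / 2) y <-> edot y y <= edot y x.
Proof.
rewrite /eball/= ler_enorm ?divr_ge0// !(edotBl, edotBr, edotZl, edotZr) exprMn enorm_sqr.
by rewrite [edot x y]edotC; split => h; lra.
Qed.

Lemma in_unit_ball x y :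
  eball x 1 y <-> edot y y - 2 * edot y x + edot x x <= 1.
Proof.
rewrite /eball/= ler_enorm// !(edotBl, edotBr) expr1n [edot x y]edotC.
by split => h; lra.
Qed.

Section points.
Variables (k : nat).
Implicit Types z : k.-tuple E.

Definition outer_region z : set E :=
  [set y | 1 < enorm y /\ exists i : 'I_k, eball (tnth z i) 1 y].

(** The support function of the convex hull of the origin and the z_i: the m of the overview,
    extended to directions w of any length. *)
Definition support_fun z w : R := \big[Order.max/0]_(i < k) edot w (tnth z i).

Lemma support_fun_ge0 z w : 0 <= support_fun z w.
Proof. exact: bigmax_ge_id. Qed.

Lemma support_fun_ge z w i : edot w (tnth z i) <= support_fun z w.
Proof. exact: le_bigmax. Qed.

Lemma support_fun_attained z w : 0 < support_fun z w ->
  exists i, support_fun z w = edot w (tnth z i).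
Proof.
suff [->|//] : support_fun z w = 0 \/ exists i, support_fun z w = edot w (tnth z i).
  by rewrite ltxx.
rewrite /support_fun; elim/big_ind : _ => [|x y hx hy|i _]; [by left| |by right; exists i].
by rewrite maxEle; case: ifP.
Qed.

Lemma support_fun_le z w S : (forall i, enorm (tnth z i) <= S) -> 0 <= S ->
  support_fun z w <= enorm w * S.
Proof.
move=> zS S0; apply/bigmax_leP; split; first by rewrite mulr_ge0.
by move=> i _; apply: (le_trans (edot_le _ _)); rewrite ler_wpM2l.
Qed.

Lemma in_Dset_ray z w (s : R) : 0 < s -> w != origin ->
  Dset z (escale s w) <-> s * edot w w <= support_fun z w.
Proof.
move=> s0 w0; have ww : 0 < edot w w by rewrite -enorm_sqr exprn_gt0// lt0r enorm_eq0 w0 enorm_ge0.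
split => [[i _ /in_ball_diameter]|h].
  rewrite !(edotZl, edotZr) ler_pM2l// => h.
  exact: (le_trans h (support_fun_ge z w i)).
have [i zi] := support_fun_attained (lt_le_trans (mulr_gt0 s0 ww) h).
exists i => //; apply/in_ball_diameter; rewrite !(edotZl, edotZr) ler_pM2l//.
by rewrite -zi.
Qed.

(* [t] is the distance to the origin and [a] the component of the centre [x],
   of norm [b], along the ray. *)
Lemma ray_ball_le (t a b : R) : 1 < t -> `|a| <= b -> t ^+ 2 - 2 * t * a + b ^+ 2 <= 1 ->
  t - 1 <= a + b ^+ 2 / 2.
Proof.
rewrite ler_norml => t1 /andP[ab1 ab2] h.
have b0 : 0 <= b by lra.
(* Since a <= b, the hypothesis gives (t - b)^2 <= 1. *)
have tb : t - 1 <= b by nra.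
(* The hypothesis yields 2t (a + b^2/2 - (t - 1)) >= b^2 - (t - 1)^2 + t b^2, which is nonnegative
   by the previous bound. *)
nra.
Qed.

(** At the smallest admissible a, the left-hand side is 1 - (t - 1)^2 - (t - 1) b^2. *)
Lemma ray_ball_ge (t a b : R) : 1 < t -> t - 1 <= a - b ^+ 2 / 2 ->
  t ^+ 2 - 2 * t * a + b ^+ 2 <= 1.
Proof. by move=> t1 h; nra. Qed.

(** With [outer_region_ray_ge], this encloses the trace of the region on a ray, measured by the
    distance s |w| to the origin, between two intervals that start at 1; the slack S^2/2 pays for
    the curvature of the unit spheres. *)
Lemma outer_region_ray_le z w (s S : R) : 0 < s -> w != origin ->
  (forall i, enorm (tnth z i) <= S) ->
  outer_region z (escale s w) ->
  1 < s * enorm w <= 1 + support_fun z w / enorm w + S ^+ 2 / 2.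
Proof.
move=> s0 w0 zS [+ [i /in_unit_ball]]; rewrite enormZ gtr0_norm// => t1 h.
have n0 : 0 < enorm w by rewrite lt0r enorm_eq0 w0 enorm_ge0.
rewrite t1/=; set b := enorm (tnth z i); set a := edot w (tnth z i) / enorm w.
have aE : edot w (tnth z i) = a * enorm w by rewrite /a divfK// gt_eqF.
have ab : `|a| <= b.
  rewrite ler_norml /a ler_pdivlMr// ler_pdivrMr// mulNr [b * _]mulrC.
  by rewrite edot_ge edot_le.
have : s * enorm w - 1 <= a + b ^+ 2 / 2.
  apply: ray_ball_le => //; move: h.
  by rewrite !(edotZl, edotZr) aE -!enorm_sqr -/b => h; lra.
have : b ^+ 2 <= S ^+ 2 by rewrite lerXn2r ?nnegrE ?(le_trans _ (zS i)) ?enorm_ge0.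
have : a <= support_fun z w / enorm w.
  by rewrite /a ler_pM2r ?invr_gt0// support_fun_ge.
lra.
Qed.

Lemma outer_region_ray_ge z w (s S : R) : 0 < s -> w != origin ->
  (forall i, enorm (tnth z i) <= S) ->
  1 < s * enorm w <= 1 + support_fun z w / enorm w - S ^+ 2 / 2 ->
  outer_region z (escale s w).
Proof.
move=> s0 w0 zS /andP[t1 h].
have n0 : 0 < enorm w by rewrite lt0r enorm_eq0 w0 enorm_ge0.
have S0 : 0 <= S ^+ 2 := sqr_ge0 S.
have /support_fun_attained[i zi] : 0 < support_fun z w.
  have : 0 < support_fun z w / enorm w by lra.
  by rewrite pmulr_lgt0// invr_gt0.
split; first by rewrite enormZ gtr0_norm.
exists i; apply/in_unit_ball.
set b := enorm (tnth z i); set a := edot w (tnth z i) / enorm w.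
have aE : edot w (tnth z i) = a * enorm w by rewrite /a divfK// gt_eqF.
have bS : b ^+ 2 <= S ^+ 2 by rewrite lerXn2r ?nnegrE ?(le_trans _ (zS i)) ?enorm_ge0.
have := @ray_ball_ge (s * enorm w) a b t1; rewrite !(edotZl, edotZr) aE -!enorm_sqr -/b.
have : support_fun z w / enorm w = a by rewrite zi.
move=> aE' /(_ _); move: h; rewrite aE' => h H.
have := H ltac:(lra); lra.
Qed.

End points.
End outer_region.

(** * Integrals along a single ray *)

Section ray_integrals.
Context {R : realType} {d : nat}.
Hypothesis d0 : (0 < d)%N.
Local Notation E := (euclidean R d).
Local Notation mu := (@lebesgue_rd R d).
Local Notation rho := (@ray_density R d).
Variable k : nat.
Implicit Types (x y w : E) (z : k.-tuple E).
Local Open Scope ereal_scope.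

Lemma measurable_Dset z : measurable (Dset z).
Proof. by apply: fin_bigcup_measurable => // i _; exact: measurable_eball. Qed.

Lemma measurable_outer_region z : measurable (outer_region z).
Proof.
rewrite (_ : outer_region z = ~` eball origin 1 `&` \bigcup_(i : 'I_k) eball (tnth z i) 1).
  apply: measurableI; first by apply: measurableC; exact: measurable_eball.
  by apply: fin_bigcup_measurable => // i _; exact: measurable_eball.
apply/seteqP; split => y.
  move=> [y1 [i yi]]; split; last by exists i.
  by rewrite /= /eball /= esub0; apply/negP; rewrite -ltNge.
move=> [y1 [i _ yi]]; split; last by exists i.
by move: y1; rewrite /= /eball /= esub0 => /negP; rewrite -ltNge.
Qed.

Lemma expr_pred (x : R) : (x ^+ d = x * x ^+ d.-1)%R.
Proof. by rewrite -exprS prednK. Qed.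

Lemma integral_cst_itv (a b c : R) : (a <= b)%R ->
  \int[lebesgue_measure]_(s in `]a, b]) (c%:E : \bar R) = (c * (b - a))%:E.
Proof.
move=> ab; rewrite integral_cst//= lebesgue_measure_itv/= lte_fin EFinM; congr (_ * _).
by case: ltP => // ba; rewrite (_ : a = b) ?subrr//; apply/le_anti/andP.
Qed.

Definition weight x : R := (enorm x ^- (d - 1))%R.

Lemma weight_ge0 x : (0 <= weight x)%R.
Proof. by rewrite invr_ge0 exprn_ge0. Qed.

Lemma measurable_weight : measurable_fun setT weight.
Proof.
rewrite (_ : weight = fun x => ((enorm x)^-1 ^+ (d - 1))%R).
  by apply: measurable_funX; exact: measurable_enormV.
by apply/funext => x; rewrite /weight exprVn.
Qed.

Lemma in_itvoc_set (a b s : R) : (s \in (`]a, b]%classic : set R)) = (a < s <= b)%R.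
Proof. by rewrite mem_setE in_itv. Qed.

(** The weight |x|^(1-d) cancels the Jacobian s^(d-1), so only the length m(w)/|w|^2 of the trace of
    [Dset z] on the ray remains. This makes [gfun] homogeneous of degree 1. *)
Lemma Dset_ray_integral z w : w != origin ->
  \int[lebesgue_measure]_s ((rho s)%:E *
    (\1_(Dset z) (escale s w) * weight (escale s w))%:E) =
  (support_fun z w / enorm w ^+ d.+1)%:E.
Proof.
move=> w0; have n0 : (0 < enorm w)%R by rewrite lt0r enorm_eq0 w0 enorm_ge0.
have ww : (0 < edot w w)%R by rewrite -enorm_sqr exprn_gt0.
have M0 := support_fun_ge0 z w.
transitivity (\int[lebesgue_measure]_(s in `]0%R, (support_fun z w / edot w w)%R])
   ((enorm w ^- (d - 1))%:E : \bar R)).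
  rewrite [RHS]integral_mkcond; apply: eq_integral => s _.
  rewrite patchE in_itvoc_set /ray_density indicE.
  case: ltP => s0 /=; last by rewrite mul0e.
  have -> : (escale s w \in Dset z) = (s <= support_fun z w / edot w w)%R.
    rewrite ler_pdivlMr//; apply/idP/idP; first by move/set_mem/(in_Dset_ray z s0 w0).
    by move=> h; apply/mem_set/(in_Dset_ray z s0 w0).
  case: leP => h; last by rewrite mul0r mule0.
  rewrite mul1r -EFinM; congr EFin; rewrite /weight enormZ gtr0_norm// exprMn subn1.
  by field; rewrite !expf_neq0 ?gt_eqF.
rewrite integral_cst_itv; last by rewrite divr_ge0// ltW.
rewrite subr0 -enorm_sqr; congr EFin.
rewrite [in RHS]exprS expr_pred subn1; field.
by rewrite !expf_neq0 ?gt_eqF.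
Qed.

Lemma measurable_indic_ray (A : set E) w : measurable A ->
  measurable_fun setT (fun s : measurableTypeR R => (\1_A (escale s w))%:E : \bar R).
Proof.
move=> mA; apply/measurable_EFinP.
have mp : measurable_fun setT (fun s : measurableTypeR R => (w, s)).
  exact: pair1_measurable.
have mI : measurable_fun setT (\1_A : E -> R) by exact: measurable_indic.
exact: (measurableT_comp mI (measurableT_comp measurable_escale2 mp)).
Qed.

(** Here the Jacobian is not cancelled: it is bounded by its value at the far end of the enclosing
    interval. *)
Lemma outer_ray_integral_le z w (S : R) : w != origin ->
  (forall i, enorm (tnth z i) <= S)%R ->
  \int[lebesgue_measure]_s ((rho s)%:E * (\1_(outer_region z) (escale s w))%:E)
    <= (((1 + (support_fun z w / enorm w + S ^+ 2 / 2)) ^+ d.-1 *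
          (support_fun z w / enorm w + S ^+ 2 / 2)) / enorm w ^+ d)%:E.
Proof.
set a := (_ / enorm w + _)%R => w0 zS; have n0 : (0 < enorm w)%R by rewrite lt0r enorm_eq0 w0 enorm_ge0.
have a0 : (0 <= a)%R by rewrite addr_ge0 ?divr_ge0 ?sqr_ge0 ?support_fun_ge0.
have mV : measurable_fun setT (fun s : measurableTypeR R => (\1_(outer_region z) (escale s w))%:E : \bar R).
  exact: measurable_indic_ray (measurable_outer_region z).
apply: (@le_trans _ _ (\int[lebesgue_measure]_(s in `](1 / enorm w)%R, ((1 + a) / enorm w)%R])
   ((((1 + a) / enorm w) ^+ d.-1)%:E : \bar R))); last first.
  rewrite integral_cst_itv; last by rewrite ler_pM2r ?invr_gt0// lerDl.
  rewrite lee_fin le_eqVlt; apply/orP; left; apply/eqP.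
  rewrite exprMn exprVn expr_pred; field.
  by rewrite !expf_neq0 ?gt_eqF.
rewrite [leRHS]integral_mkcond; apply: ge0_le_integral => //.
- by move=> s _; rewrite mule_ge0// lee_fin ray_density_ge0.
- by apply: emeasurable_funM => //; apply/measurable_EFinP; exact: measurable_ray_density.
- by apply/(measurable_restrictT _ _).1 => //; exact: measurable_cst.
move=> s _; rewrite patchE in_itvoc_set /ray_density indicE.
case: ltP => s0; last first.
  by rewrite mul0e; case: ifP => // _; rewrite lee_fin exprn_ge0// divr_ge0// addr_ge0.
have [/set_mem h|_] := boolP (_ \in _); last first.
  by rewrite mule0; case: ifP => // _; rewrite lee_fin exprn_ge0// divr_ge0// addr_ge0.
have /andP[h1 h2] := outer_region_ray_le s0 w0 zS h.
have h3 : (s <= (1 + a) / enorm w)%R by rewrite ler_pdivlMr// /a addrA.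
rewrite ltr_pdivrMr// h1 h3 mule1 lee_fin; apply: lerXn2r => //; rewrite nnegrE ltW//.
by rewrite divr_gt0// ltr_pwDl.
Qed.

(** The Jacobian is at least its value at the near end 1/|w|. If the inner interval is empty, the
    left-hand side is nonpositive. *)
Lemma outer_ray_integral_ge z w (S : R) : w != origin ->
  (forall i, enorm (tnth z i) <= S)%R ->
  ((support_fun z w / enorm w - S ^+ 2 / 2) / enorm w ^+ d)%:E <=
  \int[lebesgue_measure]_s ((rho s)%:E * (\1_(outer_region z) (escale s w))%:E).
Proof.
move=> w0 zS; have n0 : (0 < enorm w)%R by rewrite lt0r enorm_eq0 w0 enorm_ge0.
set a := (_ / _ - _)%R; have [a0|a0] := leP a 0%R.
  apply: (@le_trans _ _ 0).
    by rewrite lee_fin mulr_le0_ge0// invr_ge0 exprn_ge0.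
  by apply: integral_ge0 => s _; rewrite mule_ge0// lee_fin ray_density_ge0.
have mV : measurable_fun setT (fun s : measurableTypeR R => (\1_(outer_region z) (escale s w))%:E : \bar R).
  exact: measurable_indic_ray (measurable_outer_region z).
apply: (@le_trans _ _ (\int[lebesgue_measure]_(s in `](1 / enorm w)%R, ((1 + a) / enorm w)%R])
   (((1 / enorm w) ^+ d.-1)%:E : \bar R))).
  rewrite integral_cst_itv; last by rewrite ler_pM2r ?invr_gt0// lerDl ltW.
  rewrite lee_fin le_eqVlt; apply/orP; left; apply/eqP.
  rewrite exprMn exprVn expr1n expr_pred; field.
  by rewrite !expf_neq0 ?gt_eqF.
rewrite [leLHS]integral_mkcond; apply: ge0_le_integral => //.
- by move=> s _; rewrite patchE; case: ifP => // _; rewrite lee_fin exprn_ge0// divr_ge0.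
- by apply/(measurable_restrictT _ _).1 => //; exact: measurable_cst.
- by apply: emeasurable_funM => //; apply/measurable_EFinP; exact: measurable_ray_density.
move=> s _; rewrite patchE in_itvoc_set /ray_density indicE.
case: ifPn => [/andP[h1 h2]|_]; last first.
  by rewrite mule_ge0// lee_fin; exact: ray_density_ge0.
have s0 : (0 < s)%R by apply: lt_trans h1; rewrite divr_gt0.
rewrite s0 mem_set ?mule1 ?lee_fin; last first.
  apply: (outer_region_ray_ge s0 w0 zS).
  by rewrite -ltr_pdivrMr// h1/= -addrA -ler_pdivlMr.
apply: lerXn2r; rewrite ?nnegrE ?(ltW s0)//; last exact: ltW.
by rewrite ltW// divr_gt0.
Qed.

End ray_integrals.

(** Keeps the Jacobian factor (1 + a)^(d-1) within O(a) of 1, uniformly over a bounded range of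
    a. *)
Lemma exprD1_le_linear (R : realFieldType) (n : nat) (A : R) : 0 <= A ->
  exists2 C : R, 0 <= C & forall a, 0 <= a <= A -> (1 + a) ^+ n <= 1 + C * a.
Proof.
move=> A0; elim: n => [|n [C C0 ih]].
  by exists 0 => // a _; rewrite expr0 mul0r addr0.
(* In (1 + C a)(1 + a) the quadratic term C a^2 is at most C A a. *)
exists (C + 1 + C * A) => [|a /andP[a0 aA]]; first by rewrite !addr_ge0// mulr_ge0.
rewrite exprSr; apply: (@le_trans _ _ ((1 + C * a) * (1 + a))).
  by rewrite ler_wpM2r ?addr_ge0// ih// a0.
have : C * a * a <= C * A * a by rewrite ler_wpM2r// ler_wpM2l.
nra.
Qed.

Lemma measurable_bigmax (R : realType) (disp : measure_display) (T : measurableType disp)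
    (I : Type) (s : seq I) (f : I -> T -> R) (x0 : R) :
  (forall i, measurable_fun setT (f i)) ->
  measurable_fun setT (fun x => \big[Order.max/x0]_(i <- s) f i x).
Proof.
move=> mf; elim: s => [|i s ih].
  by under eq_fun do rewrite big_nil; exact: measurable_cst.
by under eq_fun do rewrite big_cons; exact: measurable_maxr.
Qed.

(** * Comparison of the outer volume with the integral defining [gfun] *)

Section volume_comparison.
Context {R : realType} {d : nat}.
Hypothesis d0 : (0 < d)%N.
Local Notation E := (euclidean R d).
Local Notation mu := (@lebesgue_rd R d).
Local Notation rho := (@ray_density R d).
Local Open Scope ereal_scope.

Definition cone_integral k (z : k.-tuple E) : \bar R :=
  \int[mu]_(x in Dset z) (weight x)%:E.

Section points.
Variable k : nat.
Implicit Types (x y w : E) (z : k.-tuple E).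

Lemma measurable_support_fun z : measurable_fun setT (support_fun z).
Proof.
apply: measurable_bigmax => i; apply: measurable_edot.
- exact: measurable_id.
- exact: measurable_cst.
Qed.

Lemma measurable_enormVX n : measurable_fun setT (fun w : E => (enorm w ^- n)%R).
Proof.
rewrite (_ : (fun _ => _) = fun x : E => ((enorm x)^-1 ^+ n)%R).
  by apply: measurable_funX; exact: measurable_enormV.
by apply/funext => x; rewrite exprVn.
Qed.

Lemma shell_weight0 : shell_weight (origin : E) = 0%R.
Proof. by rewrite /shell_weight enorm0 ler10. Qed.

Lemma shell_weight_neq0 w : shell_weight w != 0%R ->
  [/\ (1 <= enorm w)%R, (enorm w <= 2)%R & w != origin].
Proof.
rewrite /shell_weight; case: ifPn => [/andP[h1 h2] _|]; last by rewrite eqxx.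
split => //; apply/eqP => w0; move: h1; rewrite w0 enorm0 ler10; exact/negP.
Qed.

Lemma outer_region_ray z : mu (outer_region z) = \int[mu]_w ((shell_weight w)%:E *
  \int[lebesgue_measure]_s ((rho s)%:E * (\1_(outer_region z) (escale s w))%:E)).
Proof.
have mV := @measurable_outer_region R d k z.
rewrite -[X in mu X]setIT -integral_indic//.
rewrite (ge0_integral_ray (F := fun y => (\1_(outer_region z) y)%:E))//.
by apply/measurable_EFinP; exact: measurable_indic.
Qed.

Lemma cone_integral_ray z : cone_integral z =
  \int[mu]_w (shell_weight w * (support_fun z w / enorm w ^+ d.+1))%:E.
Proof.
have mD := @measurable_Dset R d k z.
have mW : measurable_fun setT (fun x : E => (\1_(Dset z) x * weight x)%R).
  by apply: measurable_funM; [exact: measurable_indic|exact: measurable_weight].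
rewrite /cone_integral integral_mkcond.
transitivity (\int[mu]_x (\1_(Dset z) x * weight x)%:E).
  apply: eq_integral => x _; rewrite patchE indicE.
  by case: ifP => _; rewrite ?mul1r ?mul0r.
rewrite (ge0_integral_ray (F := fun y => (\1_(Dset z) y * weight y)%:E))//; first last.
- by move=> x; rewrite lee_fin mulr_ge0// weight_ge0.
- exact/measurable_EFinP.
apply: eq_integral => w _; have [->|w0] := eqVneq w origin.
  by rewrite shell_weight0 mul0e mul0r.
by rewrite Dset_ray_integral// EFinM.
Qed.

(** The surface area of the unit sphere, since 2 r^-2 integrates to 1 over [1, 2]. It converts an
    error bound per direction into a bound on volumes. *)
Definition shell_constant : \bar R := \int[mu]_w (shell_weight w / enorm w ^+ d)%:E.

Lemma shell_constant_fin : shell_constant \is a fin_num.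
Proof.
rewrite ge0_fin_numE; last first.
  by apply: integral_ge0 => w _; rewrite lee_fin mulr_ge0 ?shell_weight_ge0// invr_ge0 exprn_ge0.
apply: (@le_lt_trans _ _ (\int[mu]_w (2 * \1_(eball origin 2) w)%:E)).
  apply: ge0_le_integral => //.
  - by move=> w _; rewrite lee_fin mulr_ge0 ?shell_weight_ge0// invr_ge0 exprn_ge0.
  - apply/measurable_EFinP; apply: measurable_funM; first exact: measurable_shell_weight.
    exact: measurable_enormVX.
  - apply/measurable_EFinP; apply: measurable_funM => //.
    by apply: measurable_indic; exact: measurable_eball.
  move=> w _; rewrite lee_fin /shell_weight indicE; case: ifPn => [/andP[h1 h2]|_]; last first.
    by rewrite mul0r mulr_ge0.
  rewrite mem_set ?mulr1; last by rewrite /eball/= esub0.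
  rewrite -mulrA ler_piMr// -invfM invf_le1 ?mulr_gt0 ?exprn_gt0 ?(lt_le_trans ltr01)//.
  by rewrite mulr_ege1// exprn_ege1.
under eq_integral do rewrite EFinM.
rewrite ge0_integralZl//.
- rewrite integral_indic//; last exact: measurable_eball.
  rewrite setIT lte_mul_pinfty ?lee_fin//; exact: lebesgue_rd_eball_lty.
- by apply/measurable_EFinP; apply: measurable_indic; exact: measurable_eball.
Qed.

Lemma measurable_cone_integrand z :
  measurable_fun setT (fun w => (shell_weight w * (support_fun z w / enorm w ^+ d.+1))%:E : \bar R).
Proof.
apply/measurable_EFinP; apply: measurable_funM; first exact: measurable_shell_weight.
by apply: measurable_funM; [exact: measurable_support_fun|exact: measurable_enormVX].
Qed.

Lemma cone_integrand_ge0 z w :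
  (0 <= shell_weight w * (support_fun z w / enorm w ^+ d.+1))%R.
Proof.
by rewrite !mulr_ge0 ?shell_weight_ge0 ?support_fun_ge0// invr_ge0 exprn_ge0.
Qed.

Lemma shell_support_le z w (S : R) : shell_weight w != 0%R ->
  (0 <= S)%R -> (forall i, enorm (tnth z i) <= S)%R ->
  (0 <= support_fun z w / enorm w <= S)%R.
Proof.
move=> /shell_weight_neq0[w1 _ _] S0 zS; have w0 := lt_le_trans ltr01 w1.
by rewrite divr_ge0 ?support_fun_ge0//= ler_pdivrMr// mulrC support_fun_le.
Qed.

End points.

(** Direction by direction the ray integrals are m and at most (1 + a)^(d-1) a with a = m + S^2/2,
    which is m + O(S^2). The constant is uniform in z and in the number of points, so the comparison
    can later be applied to a single point. *)
Lemma outer_region_cone_integral (K : R) : (0 <= K)%R ->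
  exists2 C : R, (0 <= C)%R & forall k (z : k.-tuple E) (S : R), (0 <= S <= K)%R ->
    (forall i, enorm (tnth z i) <= S)%R ->
    mu (outer_region z) <= cone_integral z + (C * S ^+ 2)%:E /\
    cone_integral z <= mu (outer_region z) + (C * S ^+ 2)%:E.
Proof.
move=> K0.
(* The largest possible value of a = m + S^2/2, as m <= S <= K. *)
have A0 : (0 <= K + K ^+ 2 / 2)%R by rewrite addr_ge0// divr_ge0// exprn_ge0.
have [C1 C10 hC1] := exprD1_le_linear d.-1 A0.
(* The term 1/2 comes from S^2/2 in a, the other from C1 a^2 with a <= S (1 + K/2). *)
pose C2 := (2^-1 + C1 * (1 + K / 2) ^+ 2)%R.
have C20 : (0 <= C2)%R by rewrite addr_ge0// mulr_ge0// sqr_ge0.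
pose ka := fine shell_constant.
have kaE : (ka%:E = shell_constant) by rewrite fineK// shell_constant_fin.
have ka0 : (0 <= ka)%R.
  rewrite -lee_fin kaE; apply: integral_ge0 => w _.
  by rewrite lee_fin mulr_ge0 ?shell_weight_ge0// invr_ge0 exprn_ge0.
exists (C2 * ka)%R => [|k z S /andP[S0 SK] zS]; first exact: mulr_ge0.
have -> : (C2 * ka * S ^+ 2)%:E = \int[mu]_w ((C2 * S ^+ 2) * (shell_weight w / enorm w ^+ d))%:E.
  under eq_integral do rewrite EFinM.
  rewrite ge0_integralZl//.
  - by rewrite -[X in _ * X]/shell_constant -kaE -EFinM; congr EFin; ring.
  - apply/measurable_EFinP; apply: measurable_funM; first exact: measurable_shell_weight.
    exact: measurable_enormVX.
  - by move=> w _; rewrite lee_fin mulr_ge0 ?shell_weight_ge0// invr_ge0 exprn_ge0.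
  - by rewrite lee_fin mulr_ge0// sqr_ge0.
have e0 w : (0 <= (C2 * S ^+ 2) * (shell_weight w / enorm w ^+ d))%R.
  by rewrite !mulr_ge0 ?shell_weight_ge0 ?sqr_ge0// invr_ge0 exprn_ge0.
have me : measurable_fun setT (fun w : E => ((C2 * S ^+ 2) * (shell_weight w / enorm w ^+ d))%:E : \bar R).
  apply/measurable_EFinP; do 2 apply: measurable_funM => //.
    exact: measurable_shell_weight.
  exact: measurable_enormVX.
have mray : measurable_fun setT (fun w : E => (shell_weight w)%:E *
  \int[lebesgue_measure]_s ((rho s)%:E * (\1_(outer_region z) (escale s w))%:E)).
  apply: emeasurable_funM; first by apply/measurable_EFinP; exact: measurable_shell_weight.
  apply: (measurable_fun_fubini_tonelli_F (m2 := lebesgue_measure) (fun p : E * measurableTypeR R => (rho p.2)%:E *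
     (\1_(outer_region z) (escale p.2 p.1))%:E)).
    apply/measurable_EFinP; apply: measurable_funM.
      exact: (measurableT_comp (@measurable_ray_density R d) measurable_snd).
    have mI : measurable_fun setT (\1_(outer_region z) : E -> R).
      by apply: measurable_indic; exact: measurable_outer_region.
    exact: (measurableT_comp mI measurable_escale2).
  by move=> p; rewrite mule_ge0// lee_fin ray_density_ge0.
have ray0 w : 0 <= (shell_weight w)%:E *
  \int[lebesgue_measure]_s ((rho s)%:E * (\1_(outer_region z) (escale s w))%:E).
  rewrite mule_ge0 ?lee_fin ?shell_weight_ge0//; apply: integral_ge0 => s _.
  by rewrite mule_ge0// lee_fin ray_density_ge0.
have mc := measurable_cone_integrand z.
have c0 := cone_integrand_ge0 z.
rewrite outer_region_ray// cone_integral_ray; split; rewrite -ge0_integralD//;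
  try (by move=> w _; rewrite lee_fin).
- apply: ge0_le_integral => //; first exact: emeasurable_funD.
  move=> w _; have [->|K1] := eqVneq (shell_weight w) 0%R.
    by rewrite mul0e !mul0r mulr0 adde0.
  have [w1 w2 w0] := shell_weight_neq0 K1.
  have := outer_ray_integral_le d0 w0 zS.
  have /andP[m0 mS] := shell_support_le K1 S0 zS.
  set m := (support_fun z w / enorm w)%R in m0 mS *.
  set a := (m + _)%R => h.
  have -> : (support_fun z w / enorm w ^+ d.+1 = m / enorm w ^+ d)%R.
    by rewrite /m exprS invfM mulrA.
  apply: (le_trans (lee_wpmul2l _ h)); first by rewrite lee_fin shell_weight_ge0.
  rewrite -EFinM -EFinD lee_fin.
  rewrite (_ : C2 * S ^+ 2 * (shell_weight w / enorm w ^+ d) =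
    shell_weight w * ((C2 * S ^+ 2) / enorm w ^+ d))%R; last by ring.
  rewrite -mulrDr ler_wpM2l ?shell_weight_ge0// -mulrDl ler_wpM2r ?invr_ge0 ?exprn_ge0//.
  have S20 : (0 <= S ^+ 2 / 2)%R by rewrite divr_ge0// sqr_ge0.
  have a0 : (0 <= a)%R by rewrite addr_ge0.
  have aS : (a <= S * (1 + K / 2))%R.
    have : (S ^+ 2 <= S * K)%R by rewrite expr2 ler_wpM2l.
    by rewrite /a; nra.
  have aA : (a <= K + K ^+ 2 / 2)%R.
    have : (S ^+ 2 <= K ^+ 2)%R by rewrite lerXn2r.
    by rewrite /a; lra.
  have h1 : ((1 + a) ^+ d.-1 <= 1 + C1 * a)%R by apply: hC1; rewrite a0.
  have h2 : (a ^+ 2 <= S ^+ 2 * (1 + K / 2) ^+ 2)%R.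
    rewrite -exprMn lerXn2r// nnegrE mulr_ge0// addr_ge0// divr_ge0//.
  apply: (@le_trans _ _ ((1 + C1 * a) * a)%R); first by rewrite ler_wpM2r.
  have h3 : (C1 * a ^+ 2 <= C1 * (S ^+ 2 * (1 + K / 2) ^+ 2))%R by rewrite ler_wpM2l.
  rewrite (_ : (1 + C1 * a) * a = m + S ^+ 2 / 2 + C1 * a ^+ 2)%R; last by rewrite /a; ring.
  by rewrite /C2; lra.
- apply: ge0_le_integral => //.
  + by move=> w _; rewrite lee_fin.
  + exact: emeasurable_funD.
  move=> w _; have [->|K1] := eqVneq (shell_weight w) 0%R.
    by rewrite mul0e !mul0r mulr0 adde0.
  have [w1 w2 w0] := shell_weight_neq0 K1.
  have := outer_ray_integral_ge d0 w0 zS.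
  set m := (support_fun z w / enorm w)%R => h.
  have -> : (support_fun z w / enorm w ^+ d.+1 = m / enorm w ^+ d)%R.
    by rewrite /m exprS invfM mulrA.
  apply: le_trans; last first.
    by apply: leeD2r; apply: lee_wpmul2l h; rewrite lee_fin shell_weight_ge0.
  rewrite -EFinM -EFinD lee_fin.
  rewrite (_ : C2 * S ^+ 2 * (shell_weight w / enorm w ^+ d) =
    shell_weight w * ((C2 * S ^+ 2) / enorm w ^+ d))%R; last by ring.
  rewrite -mulrDr ler_wpM2l ?shell_weight_ge0// -mulrDl ler_wpM2r ?invr_ge0 ?exprn_ge0//.
  have : (0 <= C1 * (1 + K / 2) ^+ 2 * S ^+ 2)%R.
    by apply: mulr_ge0; [apply: mulr_ge0 => //|]; exact: sqr_ge0.
  by rewrite /C2; lra.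
Qed.

End volume_comparison.

(** * Homogeneity, finiteness and linear lower bounds *)

Section volume_bounds.
Context {R : realType} {d : nat}.
Hypothesis d0 : (0 < d)%N.
Local Notation E := (euclidean R d).
Local Notation mu := (@lebesgue_rd R d).
Local Open Scope ereal_scope.

Lemma cone_integral_ge0 k (z : k.-tuple E) : 0 <= cone_integral z.
Proof. by apply: integral_ge0 => x _; rewrite lee_fin weight_ge0. Qed.

Lemma support_fun_scale k (z : k.-tuple E) (a : R) w : (0 <= a)%R ->
  support_fun [tuple of map (escale a) z] w = (a * support_fun z w)%R.
Proof.
move=> a0; rewrite /support_fun (big_morph ( *%R a) (id1 := 0%R) (op1 := Order.max)).
- by apply: eq_bigr => i _; rewrite tnth_map edotZr.
- by move=> x y; rewrite maxr_pMr.
- by rewrite mulr0.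
Qed.

Lemma cone_integral_scale k (z : k.-tuple E) (a : R) : (0 <= a)%R ->
  cone_integral [tuple of map (escale a) z] = a%:E * cone_integral z.
Proof.
move=> a0; rewrite !cone_integral_ray// -ge0_integralZl//.
- apply: eq_integral => w _; rewrite support_fun_scale// -EFinM; congr EFin; ring.
- exact: measurable_cone_integrand.
- by move=> w _; rewrite lee_fin cone_integrand_ge0.
Qed.

Lemma enorm_le_sumT k (z : k.-tuple E) i : (enorm (tnth z i) <= \sum_(j < k) enorm (tnth z j))%R.
Proof. by rewrite (bigD1 i)//= lerDl sumr_ge0. Qed.

Lemma outer_region_lty k (z : k.-tuple E) : mu (outer_region z) < +oo.
Proof.
pose S := (\sum_(j < k) enorm (tnth z j))%R.
apply: (le_lt_trans _ (lebesgue_rd_eball_lty origin (S + 1))).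
apply: le_measure; rewrite ?inE; [exact: measurable_outer_region|exact: measurable_eball|].
move=> y [_ [i yi]]; rewrite /eball/= (le_trans (edist_triangle (tnth z i) _ _))//.
by rewrite addrC lerD// esub0 enorm_le_sumT.
Qed.

(** The singular weight is never estimated: the integral exceeds the volume of a bounded region by a
    finite amount. *)
Lemma cone_integral_lty k (z : k.-tuple E) : cone_integral z < +oo.
Proof.
pose S := (\sum_(j < k) enorm (tnth z j))%R.
have S0 : (0 <= S)%R by exact: sumr_ge0.
have [C C0 /(_ k z S)[]] := outer_region_cone_integral d0 S0.
- by rewrite S0 lexx.
- by move=> i; exact: enorm_le_sumT.
move=> _ h; apply: (le_lt_trans h).
by rewrite lte_add_pinfty ?ltry// outer_region_lty.
Qed.

(* All [w] in a fixed box of the orthant of [tnth z i] satisfy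
   [edot w (tnth z i) >= r * enorm (tnth z i)]. *)
Lemma cone_integral_ge : exists2 c : R, (0 < c)%R &
  forall k (z : k.-tuple E) i, (c * enorm (tnth z i))%:E <= cone_integral z.
Proof.
(* Coordinates of absolute value between r and 2r give 1 <= |w| <= 2, so the box below lies in the
   shell. *)
pose r : R := ((Num.sqrt d%:R)^-1)%R.
have r0 : (0 < r)%R by rewrite invr_gt0 sqrtr_gt0 ltr0n.
have r2 : (r ^+ 2 * d%:R = 1)%R by rewrite exprVn sqr_sqrtr// mulVf// pnatr_eq0 -lt0n.
(* The box has volume r^d, and on it the integrand is at least r |x| / 2^(d+1), because the shell
   weight is at least 1 and |w| <= 2. *)
exists (r / 2 ^+ d.+1 * r ^+ d)%R => [|k z i].
  by rewrite mulr_gt0 ?divr_gt0 ?exprn_gt0.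
set x := tnth z i.
(* The signs follow those of x, so that w_j x_j >= r |x_j| for every j. *)
pose lo j := (if 0 <= (tnth x j : R) then r else - (2 * r))%R.
pose hi j := (if 0 <= (tnth x j : R) then 2 * r else - r)%R.
pose B : set E := [set w | forall j, lo j <= tnth w j <= hi j]%R.
have mB : measurable B by exact: measurable_box.
have Babs w j : B w -> (r <= `|tnth w j : R| <= 2 * r)%R.
  move=> /(_ j); rewrite /lo /hi; case: ifP => _ /andP[h1 h2].
    by rewrite ger0_norm ?h1//; lra.
  by rewrite ler0_norm; [apply/andP; split|]; lra.
have Bprod w j : B w -> (r * `|tnth x j : R| <= (tnth w j : R) * tnth x j)%R.
  move=> /(_ j); rewrite /lo /hi; move: (tnth x j : R) (tnth w j : R) => b a.
  case: (leP 0%R b) => b0 /andP[h1 h2]; first by rewrite (ger0_norm b0); exact: ler_wpM2r.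
  by rewrite ltr0_norm//; nra.
have muB : mu B = (r ^+ d)%:E.
  rewrite lebesgue_rd_box; last by move=> j; rewrite /lo /hi; case: ifP => _; lra.
  rewrite (eq_bigr (fun=> r)) ?prodr_const ?card_ord//.
  by move=> j _; rewrite /lo /hi; case: ifP => _; lra.
rewrite cone_integral_ray//.
apply: (@le_trans _ _ (\int[mu]_w ((r / 2 ^+ d.+1 * enorm x) * \1_B w)%:E)).
  under eq_integral do rewrite EFinM.
  rewrite ge0_integralZl//.
  - by rewrite integral_indic// setIT [X in _ * X]muB -EFinM lee_fin; lra.
  - by apply/measurable_EFinP; exact: measurable_indic.
  - by rewrite lee_fin !mulr_ge0// ltW.
apply: ge0_le_integral => //.
- by move=> w _; rewrite lee_fin !mulr_ge0// ltW.
- apply/measurable_EFinP; apply: measurable_funM => //; exact: measurable_indic.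
- exact: measurable_cone_integrand.
move=> w _; rewrite lee_fin indicE.
have [/set_mem wB|_] := boolP (w \in B); last by rewrite mulr0 cone_integrand_ge0.
have sum2 : (enorm w ^+ 2)%R = (\sum_(j < d) `|tnth w j : R| ^+ 2)%R.
  by rewrite enorm_sqr; apply: eq_bigr => j _; rewrite real_normK ?num_real// expr2.
have w1 : (1 <= enorm w)%R.
  rewrite -(@ler_pXn2r _ 2) ?nnegrE// expr1n sum2 -r2 mulr_natr -[X in (_ *+ X)%R]card_ord -sumr_const.
  apply: ler_sum => j _; rewrite lerXn2r ?nnegrE ?(ltW r0)//.
  by have /andP[] := Babs _ j wB.
have w2 : (enorm w <= 2)%R.
  rewrite -(@ler_pXn2r _ 2) ?nnegrE// sum2.
  apply: (@le_trans _ _ (\sum_(j < d) (2 * r) ^+ 2)%R).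
    apply: ler_sum => j _; rewrite lerXn2r ?nnegrE ?mulr_ge0// ?(ltW r0)//.
    by have /andP[] := Babs _ j wB.
  by rewrite sumr_const card_ord exprMn -mulrnAr -(mulr_natr (r ^+ 2)%R) r2 mulr1.
have n0 := lt_le_trans ltr01 w1.
rewrite /shell_weight w1 w2/= mulr1.
have h1 : (1 <= 2 / enorm w)%R by rewrite ler_pdivlMr// mul1r.
have h2 : (r * enorm x <= support_fun z w)%R.
  apply: (le_trans _ (support_fun_ge z w i)).
  apply: (@le_trans _ _ (\sum_(j < d) r * `|tnth x j : R|)%R); last first.
    by apply: ler_sum => j _; exact: Bprod.
  by rewrite -mulr_sumr ler_wpM2l ?enorm_le_sum// ltW.
apply: (@le_trans _ _ (support_fun z w / enorm w ^+ d.+1)%R); last first.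
  by rewrite ler_peMl// divr_ge0 ?support_fun_ge0// exprn_ge0.
have h3 : ((2 ^+ d.+1)^-1 <= (enorm w ^+ d.+1)^-1)%R.
  by rewrite lef_pV2 ?posrE ?exprn_gt0// lerXn2r ?nnegrE.
rewrite mulrAC; apply: ler_pM => //; by rewrite mulr_ge0// ltW.
Qed.

(* For [enorm (tnth z i)] small this follows from [cone_integral_ge]; otherwise
   the ball around [tnth z i] contains a ball of fixed radius [b0 / 4] lying
   outside the unit ball. *)
Lemma outer_region_ge (K : R) : (0 < K)%R -> exists2 c : R, (0 < c)%R &
  forall k (z : k.-tuple E) i, (enorm (tnth z i) <= K)%R ->
    (c * enorm (tnth z i))%:E <= mu (outer_region z).
Proof.
move=> K0; have [c0 c00 hc0] := cone_integral_ge.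
have [C C0 hC] := outer_region_cone_integral d0 (ltW K0).
(* Below [b0] the error C |x|^2 is at most half of the lower bound c0 |x|; the minimum with 2 keeps
   1 - b0/2 nonnegative for the large case. *)
pose b0 := Num.min 2%R (c0 / (2 * (C + 1)))%R.
have C1 : (0 < C + 1)%R by lra.
have b00 : (0 < b0)%R by rewrite lt_min ltr0n/= divr_gt0// mulr_gt0.
have b02 : (b0 <= 2)%R by rewrite ge_min lexx.
have b0c : (C * b0 <= c0 / 2)%R.
  have : (b0 <= c0 / (2 * (C + 1)))%R by rewrite ge_min lexx orbT.
  by rewrite ler_pdivlMr ?mulr_gt0//; nra.
pose v0 := ((2 * (b0 / 4) / d%:R) ^+ d)%R.
have v00 : (0 < v0)%R by rewrite exprn_gt0// divr_gt0 ?ltr0n// mulr_gt0// divr_gt0.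
exists (Num.min (c0 / 2) (v0 / K))%R.
  by rewrite lt_min !divr_gt0.
move=> k z i; set x := tnth z i => xK.
(* One point suffices for a lower bound, and with it the error in [hC] is C |x|^2, whatever the
   other points are. *)
pose z1 : 1.-tuple E := [tuple x].
have sub : outer_region z1 `<=` outer_region z.
  by move=> y [y1 [j yj]]; split => //; exists i; move: yj; rewrite (ord1 j).
have zsub : mu (outer_region z1) <= mu (outer_region z).
  by apply: le_measure => //; rewrite inE; exact: measurable_outer_region.
apply: le_trans zsub.
have [xb|bx] := leP (enorm x) b0.
  apply: (@le_trans _ _ (c0 / 2 * enorm x)%:E).
    by rewrite lee_fin ler_wpM2r// ge_min lexx.
  have [||_] := hC _ z1 (enorm x).
  - by rewrite enorm_ge0.
  - by move=> j; rewrite (ord1 j).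
  move=> /(le_trans (hc0 _ z1 ord0)); rewrite -[tnth z1 ord0]/x => h.
  have m1 := outer_region_lty z1; have m0 : 0 <= mu (outer_region z1) by [].
  have mf : mu (outer_region z1) \is a fin_num by rewrite ge0_fin_numE.
  move: h; rewrite -(fineK mf) -EFinD !lee_fin.
  have : (C * enorm x * enorm x <= c0 / 2 * enorm x)%R.
    by rewrite ler_wpM2r// (le_trans _ b0c)// ler_wpM2l.
  by rewrite expr2; lra.
have n0 := lt_trans b00 bx.
apply: (@le_trans _ _ v0%:E).
  rewrite lee_fin; apply: (@le_trans _ _ (v0 / K * enorm x)%R).
    by rewrite ler_wpM2r// ge_min lexx orbT.
  by rewrite -mulrA ler_piMr ?(ltW v00)// mulrC ler_pdivrMr// mul1r.
(* The point t x is at distance 1 - b0/2 from x and has norm |x| + 1 - b0/2. A ball of radius b0/4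
   around it stays within distance 1 of x and, as |x| > b0, outside the unit ball. *)
pose t := ((enorm x + 1 - b0 / 2) / enorm x)%R.
have t0 : (0 <= t)%R by rewrite divr_ge0//; lra.
apply: (le_trans (lebesgue_rd_eball_ge (escale t x) d0 _)); first by rewrite divr_ge0// ltW.
apply: le_measure; rewrite ?inE; [exact: measurable_eball|exact: measurable_outer_region|].
have tx : enorm (escale t x) = (enorm x + 1 - b0 / 2)%R.
  by rewrite enormZ ger0_norm// divfK// gt_eqF.
have txx : enorm (esub (escale t x) x) = (1 - b0 / 2)%R.
  have -> : esub (escale t x) x = escale (t - 1)%R x.
    by apply: eq_from_tnth => j; rewrite !tnth_mktuple mulrBl mul1r.
  have -> : (t - 1 = (1 - b0 / 2) / enorm x)%R by rewrite /t; field; rewrite gt_eqF.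
  by rewrite enormZ ger0_norm ?divfK ?gt_eqF// divr_ge0//; lra.
move=> y; rewrite /eball/= => yt; split.
  have := edist_triangle y (escale t x) origin; rewrite !esub0 tx esubC; lra.
exists ord0; suff : eball x 1 y by [].
rewrite /eball/=.
have := edist_triangle (escale t x) y x; rewrite txx; lra.
Qed.

End volume_bounds.

(** * Finite clusters *)

Section rooted_connected.

(** Connectedness of I with an extra root whose neighbours satisfy [e0], encoded as an induction
    principle over subsets. It is a boolean function of finitely many booleans, which makes it
    measurable and easy to transport. *)
Definition rooted_connected (I : finType) (e0 : pred I) (e : rel I) : bool :=
  [forall A : {set I}, [forall i, e0 i ==> (i \in A)] &&
     [forall i, forall j, (i \in A) && e i j ==> (j \in A)] ==> (A == [set: I]%SET)].

Lemma rooted_connectedP (I : finType) (e0 : pred I) (e : rel I) :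
  reflect (forall A : {set I}, (forall i, e0 i -> i \in A) ->
     (forall i j, i \in A -> e i j -> j \in A) -> A = [set: I]%SET)
    (rooted_connected e0 e).
Proof.
apply: (iffP forallP) => h A.
  move=> h0 h1; apply/eqP; apply: (implyP (h A)); apply/andP; split.
    by apply/forallP => i; apply/implyP; exact: h0.
  by apply/forallP => i; apply/forallP => j; apply/implyP => /andP[]; exact: h1.
apply/implyP => /andP[/forallP h0 /forallP h1]; apply/eqP; apply: h.
  by move=> i; exact/implyP.
by move=> i j iA ij; have /forallP/(_ j)/implyP := h1 i; apply; rewrite iA.
Qed.

Lemma eq_rooted_connected (I : finType) (e0 f0 : pred I) (e f : rel I) :
  e0 =1 f0 -> e =2 f -> rooted_connected e0 e = rooted_connected f0 f.
Proof.
move=> ef0 ef; apply/rooted_connectedP/rooted_connectedP => h A A0 A1; apply: h.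
- by move=> i; rewrite ef0; exact: A0.
- by move=> i j iA; rewrite ef; exact: A1.
- by move=> i; rewrite -ef0; exact: A0.
- by move=> i j iA; rewrite -ef; exact: A1.
Qed.

Lemma rooted_connected_surj (I J : finType) (e0 : pred I) (e : rel I)
    (f0 : pred J) (f : rel J) (s : I -> J) :
  (forall j, exists i, s i = j) ->
  (forall i, e0 i -> f0 (s i)) -> (forall i i', e i i' -> f (s i) (s i')) ->
  rooted_connected e0 e -> rooted_connected f0 f.
Proof.
move=> surj h0 h1 /rooted_connectedP h; apply/rooted_connectedP => A A0 A1.
have /setP hA := h (s @^-1: A)%SET
  ltac:(by move=> i /h0/A0; rewrite inE)
  ltac:(by move=> i j; rewrite !inE => + /h1; exact: A1).
apply/setP => j; have [i <-] := surj j.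
by have := hA i; rewrite !inE.
Qed.

End rooted_connected.

Lemma card_set_uniq (T : pointedType) (s : seq T) : uniq s -> [set` s] #= `I_(size s).
Proof.
move=> us; have -> : [set` s] = nth point s @` `I_(size s).
  apply/seteqP; split=> [y /= yz|_ [i /= ik <-]]; last by rewrite mem_nth.
  by exists (index y s); [rewrite /= index_mem|exact: nth_index].
apply: inj_card_eq => i j; rewrite !inE/= => ik jk /eqP.
by rewrite nth_uniq// => /eqP.
Qed.

(** * The cluster of the origin as a finite configuration *)

Section cluster.
Context {R : realType} {d : nat}.
Local Notation E := (euclidean R d).
Local Notation cluster := Defs.cluster.
Implicit Types (x y : E) (X : set E).

Definition points_connected k (r : R) (z : k.-tuple E) : bool :=
  rooted_connected (fun i : 'I_k => enorm (tnth z i) <= r)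
    (fun i j => enorm (esub (tnth z i) (tnth z j)) <= r).

Definition near_points k (r : R) (z : k.-tuple E) y : bool :=
  (enorm y <= r) || [exists i, enorm (esub y (tnth z i)) <= r].

(* As long as some point has norm above [m], connectedness provides one of norm
   in [(m, m + 1]]: at least [m] points have norm at most [m]. *)
Lemma points_connected_bound k (z : k.-tuple E) i : points_connected 1 z ->
  enorm (tnth z i) <= k%:R.
Proof.
move=> /rooted_connectedP h.
pose A m : {set 'I_k} := [set i | enorm (tnth z i) <= m%:R]%SET.
have AS m : A m \subset A m.+1.
  by apply/fintype.subsetP => j; rewrite !inE => /le_trans; apply; rewrite ler_nat.
suff : A k = [set: 'I_k]%SET by move=> /setP/(_ i); rewrite !inE.
have hA m : A m = [set: 'I_k]%SET \/ (m <= #|A m|)%N.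
  elim: m => [|m [Am|ih]]; [by right|left|].
    by apply/eqP; rewrite finset.eqEsubset finset.subsetT -Am AS.
  have [->|AmT] := eqVneq (A m.+1) [set: 'I_k]%SET; [by left|right].
  apply: (leq_ltn_trans ih); apply: proper_card; rewrite properE AS/=.
  apply/negP => AmS; case/eqP: AmT; have AE : A m = A m.+1 by apply/eqP; rewrite finset.eqEsubset AS.
  apply: h.
    by move=> j zj; rewrite inE (le_trans zj)// ler1n.
  move=> j j' jA jj'; rewrite inE; move: jA; rewrite -AE inE => jA.
  have := edist_triangle (tnth z j) (tnth z j') origin.
  rewrite !esub0 esubC -natr1; lra.
have [//|kA] := hA k.
by apply/eqP; rewrite eqEcard finset.subsetT cardsT card_ord.
Qed.

Lemma cluster_origin X : cluster X origin.
Proof. by split; [right|exists [::]]. Qed.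

Lemma cluster_sub X y : cluster X y -> X y \/ y = origin.
Proof.
move=> [_ [p]]; elim/last_ind: p => [_ <-|p x _ + <-]; first by right.
rewrite rcons_path last_rcons => /andP[_ /and4P[_ /set_mem + _ _]].
by move=> [|]; [left|right].
Qed.

Lemma cluster_closed X x y : cluster X x -> enorm (esub x y) <= 1 ->
  (X y \/ y = origin) -> cluster X y.
Proof.
move=> Cx xy yX; have [<-//|xny] := eqVneq x y.
have xX := cluster_sub Cx; case: Cx => Xo [p hp lp]; split => //.
exists (rcons p y); last by rewrite last_rcons.
rewrite rcons_path hp lp/= /geom_graph xny xy andbT; apply/andP.
by split; rewrite ?andbT; apply/mem_set; [case: xX|case: yX]; by [left|right].
Qed.

(** With [cluster_closed], characterizes the cluster as the smallest set that contains the origin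
    and is closed under unit steps within X; paths are not mentioned afterwards. *)
Lemma cluster_ind X (A : set E) : A origin ->
  (forall x y, A x -> cluster X x -> cluster X y -> enorm (esub x y) <= 1 -> A y) ->
  cluster X `<=` A.
Proof.
move=> A0 AS y [Xo [p]]; elim/last_ind: p y => [y _ <-//|p x ih y].
rewrite rcons_path last_rcons => /andP[hp hx] <-.
have Cl : cluster X (last origin p) by split => //; exists p.
case/and4P: hx => _ /set_mem xX _ xl.
by apply: (AS (last origin p)) => //; [exact: ih|exact: cluster_closed xl xX].
Qed.

(** A certificate that the cluster consists of the origin and the k entries of [z]; the last clause
    is maximality. The origin is exempted from it, since X may contain the origin. *)
Definition is_cluster k X (z : k.-tuple E) : Prop :=
  [/\ uniq (origin :: z), (forall i, X (tnth z i)), points_connected 1 z &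
     forall y, X y -> y != origin -> near_points 1 z y -> y \in z].

Lemma is_cluster_eq k X (z : k.-tuple E) : is_cluster X z ->
  cluster X = [set` (origin :: z : seq E)].
Proof.
move=> [uz zX /rooted_connectedP zc zn]; apply/seteqP; split.
  apply: cluster_ind => [|x y /=]; first by rewrite /= inE eqxx.
  move=> xz _ /cluster_sub yX xy; rewrite inE.
  have [//|y0] := eqVneq y origin; case: yX => [yX|/eqP]; last by rewrite (negbTE y0).
  apply: zn => //; move: xz; rewrite inE /near_points => /predU1P[xo|/tnthP[i xi]].
    by move: xy; rewrite xo esubC esub0 => ->.
  by apply/orP; right; apply/existsP; exists i; rewrite -xi esubC.
move=> y /=; rewrite inE => /predU1P[->|/tnthP[i ->]]; first exact: cluster_origin.
have /setP/(_ i) : [set i | `[< cluster X (tnth z i) >]]%SET = [set: 'I_k]%SET.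
  apply: zc => [j zj|j j']; rewrite !inE.
    apply: (cluster_closed (cluster_origin X)); last by left; exact: zX.
    by rewrite esubC esub0.
  move=> hj jj'; apply: (cluster_closed hj jj').
  by left; exact: zX.
by rewrite !inE => /asboolW.
Qed.

Lemma cluster_cardP k X : cluster X #= `I_k.+1 <-> exists z : k.-tuple E, is_cluster X z.
Proof.
split; last first.
  move=> [z zX]; rewrite (is_cluster_eq zX).
  have uz : uniq (origin :: z : seq E) by case: zX.
  by have := card_set_uniq uz; rewrite /= size_tuple.
move=> Ck; have fC : finite_set (cluster X) by exists k.+1.
have [s0 s0E] := (finite_seqP _).1 fC.
pose s := undup s0; have us : uniq s by exact: undup_uniq.
have sE y : (y \in s) <-> cluster X y by rewrite s0E /= mem_undup.
have ss : size s = k.+1.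
  apply/card_eq_II; apply: card_eq_trans Ck; rewrite card_eq_sym.
  rewrite (_ : cluster X = [set` s]); first exact: card_set_uniq.
  by apply/seteqP; split => y /sE.
have os : origin \in s by apply/sE; exact: cluster_origin.
have rs : size (rem origin s) == k by rewrite size_rem// ss.
pose z := Tuple rs; exists z.
have zE y : (y \in z) <-> (y != origin /\ cluster X y).
  rewrite memtE/= mem_rem_uniq// inE/=; split=> [/andP[-> /sE]//|[-> /sE ->]//].
have zi i : tnth z i \in z by exact: mem_tnth.
have uz : uniq (origin :: z).
  rewrite /= rem_uniq// andbT; apply/negP => /zE[]; by rewrite eqxx.
split => //.
- by move=> i; have /zE[z0 /cluster_sub[//|/eqP]] := zi i; rewrite (negbTE z0).
- apply/rooted_connectedP => A A0 A1; apply/setP => i; rewrite inE.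
  (* Cluster induction on [B] transfers closedness of the index set [A] to closedness of a set of
     points. *)
  pose B : set E := [set y | y = origin \/ exists2 j, j \in A & tnth z j = y].
  have /zE[z0 Cz] := zi i.
  have : B (tnth z i).
    apply: (cluster_ind _ _ Cz); first by left.
    move=> x y Bx Cx Cy xy; have [->|y0] := eqVneq y origin; first by left.
    have /tnthP[j yj] : y \in z by apply/zE.
    right; exists j => //; case: Bx => [xo|[l lA lx]].
      by apply: A0; rewrite -yj; move: xy; rewrite xo esubC esub0.
    by apply: (A1 l) => //; rewrite lx -yj.
  case=> [/eqP|[j jA zji]]; first by rewrite (negbTE z0).
  suff -> : i = j by [].
  have /andP[_ /tuple_uniqP uz'] := uz.
  by apply: uz'; rewrite zji.
- move=> y Xy y0; rewrite /near_points => h; apply/zE; split => //.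
  case/orP: h => [yo|/existsP[i yi]].
    by apply: (cluster_closed (cluster_origin X)); [rewrite esubC esub0|left].
  have /zE[_ Cz] := zi i.
  by apply: (cluster_closed Cz); [rewrite esubC|left].
Qed.

End cluster.

(** * Discretization of space *)

Lemma near_seq (T : eqType) (t : seq T) (Q : nat -> T -> Prop) :
  (forall x, x \in t -> \forall n \near \oo, Q n x) ->
  \forall n \near \oo, forall x, x \in t -> Q n x.
Proof.
elim: t => [|a t ih] h; first by near=> n.
have ha := h a (mem_head _ _).
have ht : \forall n \near \oo, forall x, x \in t -> Q n x.
  by apply: ih => x xt; apply: h; rewrite inE xt orbT.
apply: filterS2 ha ht => n Qa Qt x; rewrite inE => /predU1P[->//|]; exact: Qt.
Unshelve. all: by end_near. Qed.

(** An injection into the image of s is onto it by cardinality, so these are the injections between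
    two sets of size |I|. *)
Lemma card_injective_image (I J : finType) (s : {ffun I -> J}) : injective s ->
  #|[set s' : {ffun I -> J} | injectiveb s' & [forall j, (j \in codom s') == (j \in codom s)]]%SET|
   = (#|I|) `!%N.
Proof.
move=> is_.
have cs : #|codom s| = #|I| by rewrite card_codom.
rewrite -ffactnn -{1}cs -(card_inj_ffuns_on I (mem (codom s))); apply: eq_card => s'.
rewrite !inE; apply/andP/andP => -[h1 h2]; split => //.
  by apply/ffun_onP => i; have /forallP/(_ (s' i))/eqP <- := h2; rewrite codom_f.
have /subset_cardP h3 : #|codom s'| = #|codom s|.
  by rewrite !card_codom//; exact/injectiveP.
apply/forallP => j; apply/eqP; apply: h3; apply/fintype.subsetP => j' /codomP[i ->].
by move/ffun_onP : h1; apply.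
Qed.

Section grid.
Context {R : realType} {d k : nat}.
Local Notation E := (euclidean R d).
Variables (W : set E) (J : nat -> finType) (q : forall n, E -> J n)
  (c : forall n, J n -> E) (delta : nat -> R).
Hypothesis q_center : forall n y, W y -> enorm (esub y (c (q n y))) <= delta n.
Hypothesis delta_cvg : delta @ \oo --> (0 : R).
Hypothesis delta_ge0 : forall n, 0 <= delta n.
Implicit Types (x y : E) (z : k.-tuple E).

(* Enlarging the unit radius by twice the mesh makes the graph on the centres of
   the cells agree with the unit graph on any given finite set of points as soon
   as the grid is fine enough, even for pairs at distance exactly 1. *)
Definition radius n : R := 1 + 2 * delta n.

Definition centers n (s : {ffun 'I_k -> J n}) : k.-tuple E := [tuple c (s i) | i < k].

(** The three tests on which connectedness, proximity and distinctness rest can be read off from the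
    cells of x and y. *)
Definition faithful n x y : Prop :=
  [/\ (enorm (esub (c (q n x)) (c (q n y))) <= radius n) = (enorm (esub x y) <= 1),
      (enorm (c (q n x)) <= radius n) = (enorm x <= 1) &
      q n x = q n y -> x = y].

(** Distances between centres differ from true ones by at most 2 delta: a distance <= 1 stays within
    [radius], and a fixed distance > 1 eventually exceeds 1 + 4 delta. *)
Lemma near_faithful x y : W x -> W y -> \forall n \near \oo, faithful n x y.
Proof.
move=> Wx Wy.
have small (e : R) : 0 < e -> \forall n \near \oo, delta n < e.
  move=> e0; have /cvgr0Pnorm_lt/(_ _ e0) := delta_cvg.
  by apply: filterS => n; apply: le_lt_trans; exact: ler_norm.
have hd (a : R) : \forall n \near \oo, 1 < a -> radius n + 2 * delta n < a.
  have [a1|a1] := ltP 1 a; last by near=> n.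
  have : 0 < (a - 1) / 4 by rewrite divr_gt0// subr_gt0.
  move=> /small; apply: filterS => n; rewrite /radius => h _; lra.
have hz : \forall n \near \oo, x != y -> 2 * delta n < enorm (esub x y).
  have [_|xy] := eqVneq x y; first by near=> n.
  have : 0 < enorm (esub x y) / 2.
    by rewrite divr_gt0// lt0r edist_eq0 xy enorm_ge0.
  by move=> /small; apply: filterS => n h _; lra.
near=> n.
have h1 : 1 < enorm (esub x y) -> radius n + 2 * delta n < enorm (esub x y).
  by near: n; exact: hd.
have h2 : 1 < enorm x -> radius n + 2 * delta n < enorm x by near: n; exact: hd.
have h3 : x != y -> 2 * delta n < enorm (esub x y) by near: n.
have qx := q_center n Wx; have qy := q_center n Wy; have dn := delta_ge0 n.
have t1 := edist_triangle x (c (q n x)) (c (q n y)).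
have t2 := edist_triangle y x (c (q n y)).
have t3 := edist_triangle (c (q n x)) x y.
have t4 := edist_triangle (c (q n y)) (c (q n x)) y.
have t5 := edist_triangle x (c (q n x)) origin.
have t6 := edist_triangle (c (q n x)) x origin.
rewrite !esub0 in t5 t6.
rewrite [enorm (esub (c (q n x)) x)]esubC in t1 t5.
rewrite [enorm (esub (c (q n y)) y)]esubC in t4.
split.
- apply/idP/idP => h; last by rewrite /radius; lra.
  by rewrite leNgt; apply/negP => /h1; lra.
- apply/idP/idP => h; last by rewrite /radius; lra.
  by rewrite leNgt; apply/negP => /h2; rewrite /radius in h *; lra.
- move=> qxy; apply/eqP/negPn/negP => /h3; rewrite qxy in t3 qx.
  have t7 := edist_triangle (c (q n y)) x y.
  by rewrite [enorm (esub (c (q n y)) y)]esubC in t7; lra.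
Unshelve. all: by end_near. Qed.

Lemma near_faithful_seq (t : seq E) : (forall x, x \in t -> W x) ->
  \forall n \near \oo, forall x y, x \in t -> y \in t -> faithful n x y.
Proof.
move=> tW.
have : \forall n \near \oo, forall x, x \in t -> forall y, y \in t -> faithful n x y.
  apply: near_seq => x xt; apply: near_seq => y yt.
  by apply: near_faithful; exact: tW.
by apply: filterS => n h x y xt yt; exact: h.
Qed.

(* The origin is removed: the cluster counts it once, even if [H w] contains it. *)
Definition grid_cell n (j : J n) : set E := (W `\` [set origin]) `&` q n @^-1` [set j].

(* A set of [k] cells is represented by its [k`!] injective enumerations [s]. *)
Definition good_choice n (s : {ffun 'I_k -> J n}) : bool :=
  injectiveb s && points_connected (radius n) (centers s).

Definition watches n (s : {ffun 'I_k -> J n}) (j : J n) : bool :=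
  near_points (radius n) (centers s) (c j).

(** The membership boolean is read as 0 or 1: exactly one point in each chosen cell and none in the
    other watched cells. *)
Definition selects_choice n (X : set E) (s : {ffun 'I_k -> J n}) : Prop :=
  forall j, watches s j -> X `&` grid_cell j #= `I_(j \in codom s).

Lemma radius_ge0 n : 0 <= radius n.
Proof. by rewrite /radius addr_ge0// mulr_ge0. Qed.

Lemma watched_codom n (s : {ffun 'I_k -> J n}) i : watches s (s i).
Proof.
apply/orP; right; apply/existsP; exists i; rewrite tnth_mktuple.
by have /eqP -> : enorm (esub (c (s i)) (c (s i))) == 0; rewrite ?edist_eq0 ?radius_ge0.
Qed.

Lemma eq_codom_good n (s s' : {ffun 'I_k -> J n}) : injective s' ->
  (forall j, (j \in codom s') = (j \in codom s)) -> good_choice s -> good_choice s'.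
Proof.
move=> is' ss' /andP[/injectiveP is_ gs]; apply/andP; split; first exact/injectiveP.
have /fin_all_exists[p pE] : forall i, exists i', s i = s' i'.
  by move=> i; apply/codomP; rewrite ss' codom_f.
apply: (rooted_connected_surj (s := p)) gs.
- move=> i'; have /codomP[i sE] : s' i' \in codom s by rewrite -ss' codom_f.
  by exists i; apply: is'; rewrite -pE.
- by move=> i; rewrite !tnth_mktuple pE.
- by move=> i i'; rewrite !tnth_mktuple !pE.
Qed.

Lemma eq_codom_watched n (s s' : {ffun 'I_k -> J n}) j :
  (forall j, (j \in codom s') = (j \in codom s)) -> watches s j -> watches s' j.
Proof.
move=> ss' /orP[h|/existsP[i h]]; apply/orP; [by left|right].
have /codomP[i' sE] : s i \in codom s' by rewrite ss' codom_f.
by apply/existsP; exists i'; move: h; rewrite !tnth_mktuple sE.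
Qed.

Lemma eq_codom_selects n X (s s' : {ffun 'I_k -> J n}) :
  (forall j, (j \in codom s') = (j \in codom s)) -> selects_choice X s -> selects_choice X s'.
Proof.
by move=> ss' h j js'; rewrite ss'; apply: h; apply: eq_codom_watched js' => j'; rewrite ss'.
Qed.

(** A cell watched by both choices cannot hold both 0 and 1 points, so they agree there. Cells near
    the origin are watched by every choice, and connectedness of [s] propagates the agreement. *)
Lemma selects_sub n X (s s' : {ffun 'I_k -> J n}) : good_choice s -> selects_choice X s -> selects_choice X s' ->
  {subset codom s <= codom s'}.
Proof.
move=> /andP[_ /rooted_connectedP gs] Xs Xs'.
have one j : watches s j -> watches s' j -> (j \in codom s) = (j \in codom s').
  move=> /Xs h /Xs' h'; have /card_eq_II := card_eq_trans (card_esym h) h'.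
  by case: (j \in codom s); case: (j \in codom s').
have h : [set i | s i \in codom s']%SET = [set: 'I_k]%SET.
  apply: gs => [i'|i1 i2].
    rewrite tnth_mktuple inE => hi.
    by rewrite -one ?codom_f ?watched_codom// /watches /near_points hi.
  rewrite !tnth_mktuple !inE => /codomP[i3 si3] h12.
  rewrite -one ?codom_f ?watched_codom//; apply/orP; right; apply/existsP; exists i3.
  by rewrite tnth_mktuple -si3 esubC.
by move=> _ /codomP[i ->]; have := finset.in_setT i; rewrite -h inE.
Qed.

Lemma card_selects n X (s : {ffun 'I_k -> J n}) : good_choice s -> selects_choice X s ->
  #|[set s' : {ffun 'I_k -> J n} | good_choice s' && `[< selects_choice X s' >]]%SET| = k`!.
Proof.
move=> gs Xs; have [/injectiveP is_ _] := andP gs.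
rewrite -[k in RHS]card_ord -(card_injective_image is_); apply: eq_card => s'.
rewrite !inE; apply/andP/andP => -[].
  move=> gs' Xs'; split; first by case/andP: gs'.
  move/asboolW: Xs' => Xs'; apply/forallP => j; apply/eqP.
  by apply/idP/idP; [exact: (selects_sub gs' Xs' Xs)|exact: (selects_sub gs Xs Xs')].
move=> /injectiveP is' /forallP h.
have ss' j : (j \in codom s') = (j \in codom s) by exact/eqP.
by split; [exact: eq_codom_good gs|apply: asboolT; exact: eq_codom_selects Xs].
Qed.

Definition quantize n z : {ffun 'I_k -> J n} := [ffun i => q n (tnth z i)].

Lemma faithful_connected n z : (forall i j, faithful n (tnth z i) (tnth z j)) ->
  points_connected (radius n) (centers (quantize n z)) = points_connected 1 z.
Proof.
move=> fz; apply: eq_rooted_connected => [i|i j]; rewrite !tnth_mktuple !ffunE.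
  by have [_ ->] := fz i i.
by have [-> _ _] := fz i j.
Qed.

Lemma faithful_near n z y : faithful n y y -> (forall i, faithful n y (tnth z i)) ->
  watches (quantize n z) (q n y) = near_points 1 z y.
Proof.
move=> [_ fy _] fz; rewrite /watches /near_points fy; congr (_ || _).
by apply: eq_existsb => i; rewrite tnth_mktuple ffunE; have [-> _ _] := fz i.
Qed.

(** Once the grid is faithful on the finitely many points of X in W, quantizing a cluster and
    picking the point in each chosen cell translate the two sides into each other. How fine the grid
    must be depends on X. *)
Lemma near_selects (X : set E) : finite_set (X `&` W) ->
  eball origin k.+1%:R `<=` W ->
  \forall n \near \oo, (exists s : {ffun 'I_k -> J n}, good_choice s /\ selects_choice X s) <->
    exists z : k.-tuple E, is_cluster X z.
Proof.
move=> /finite_seqP[t tE] BW.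
have tP y : y \in t <-> X y /\ W y.
  by have : [set` t] y <-> (X `&` W) y by rewrite tE.
have := @near_faithful_seq t; move=> /(_ (fun y yt => ((tP y).1 yt).2)).
apply: filterS => n ft; split.
  move=> [s [gs Xs]]; have [/injectiveP is_ cs] := andP gs.
  have ex i : exists y, X y /\ grid_cell (s i) y.
    have := Xs _ (watched_codom s i); rewrite codom_f.
    have [->|/set0P[y [Xy sy]] _] := eqVneq (X `&` grid_cell (s i)) set0; last by exists y.
    by rewrite card_eq_sym card_eq0 => /eqP/seteqP[/(_ 0%N)]/(_ isT).
  have [z0 z0P] := choice ex.
  pose z := [tuple z0 i | i < k].
  have zE i : tnth z i = z0 i by rewrite tnth_mktuple.
  have zt i : tnth z i \in t by rewrite zE; apply/tP; have [? [[? _] _]] := z0P i.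
  have qz i : q n (tnth z i) = s i by rewrite zE; have [_ [_ ?]] := z0P i.
  have zo i : tnth z i != origin by rewrite zE; apply/eqP; have [_ [[_ ?] _]] := z0P i.
  have sz : s = quantize n z by apply/ffunP => i; rewrite ffunE qz.
  have cz : points_connected 1 z.
    by have := @faithful_connected n z (fun i j => ft _ _ (zt i) (zt j)); rewrite -sz cs => <-.
  have iz : injective (tnth z) by move=> i j zij; apply: is_; rewrite -!qz zij.
  clearbody z.
  exists z; split => //.
  - rewrite /=; apply/andP; split.
      by apply/negP => /tnthP[i /esym/eqP]; rewrite (negbTE (zo i)).
    exact/tuple_uniqP.
  - by move=> i; rewrite zE; have [] := z0P i.
  - move=> y Xy y0 yz.
    (* Entries of a connected tuple have norm at most k, so a point within 1 of them has norm at
       most k + 1: hence the size required of W. *)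
    have Wy : W y.
      apply: BW; rewrite /eball/= esub0; case/orP: yz => [y1|/existsP[i yi]].
        by apply: le_trans y1 _; rewrite ler1n.
      have := points_connected_bound i cz.
      by have := edist_triangle (tnth z i) y origin; rewrite !esub0 -natr1; lra.
    have yt : y \in t by apply/tP.
    have := faithful_near (ft _ _ yt yt) (fun i => ft _ _ yt (zt i)); rewrite yz -sz.
    move=> /Xs; case: (boolP (q n y \in codom s)) => [/codomP[i qys] _|_].
      rewrite -qz in qys; have [_ _ /(_ qys) ->] := ft _ _ yt (zt i).
      exact: mem_tnth.
    rewrite II0 card_eq0 => /eqP h.
    by have : (X `&` grid_cell (q n y)) y; [split => //; split => //; split => //; exact/eqP|rewrite h].
move=> [z [uz zX cz zn]].
have zt i : tnth z i \in t.
  apply/tP; split => //; apply: BW; rewrite /eball/= esub0.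
  by rewrite (le_trans (points_connected_bound i cz))// ler_nat.
have zo i : tnth z i != origin.
  by case/andP: uz => oz _; apply: contraNneq oz => <-; exact: mem_tnth.
have [_ /tuple_uniqP iz] := andP uz.
exists (quantize n z); split.
  apply/andP; split.
    apply/injectiveP => i j; rewrite !ffunE => qij; apply: iz.
    by have [_ _ ->] := ft _ _ (zt i) (zt j).
  by rewrite faithful_connected// => i j; exact: ft.
move=> j; case: (boolP (j \in codom _)) => [/codomP[i ->] _|jz wj].
  rewrite (_ : _ `&` _ = [set tnth z i]); first exact: card_set1.
  apply/seteqP; split=> [y [Xy [[Wy y0] ]]|_ ->].
    rewrite /= ffunE => qy.
    by have [_ _ ->] := ft _ _ (proj2 (tP y) (conj Xy Wy)) (zt i).
  split => //; split; last by rewrite /= ffunE.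
  by split; [exact: ((tP _).1 (zt i)).2|exact/eqP].
rewrite II0 card_eq0; apply/eqP; rewrite -subset0 => y [Xy [[Wy y0] /= qy]].
have yt : y \in t by apply/tP.
move: wj; rewrite -qy faithful_near//; [|exact: ft|by move=> i; exact: ft].
move=> /(zn _ Xy (introN eqP y0)) /tnthP[i yz].
by case/negP: jz; rewrite -qy yz; apply/codomP; exists i; rewrite ffunE.
Qed.

End grid.

(** * Limits of pointwise eventually constant sequences of sets *)

Section eventually_equal_sets.
Context {disp : measure_display} {T : measurableType disp} {R : realType}.
Variables (m : {measure set T -> \bar R}) (F : nat -> set T) (A B : set T).
Hypothesis mF : forall n, measurable (F n).
Hypothesis FA : forall x, \forall n \near \oo, F n x <-> A x.

Lemma measurable_eventually_eq : measurable A.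
Proof.
(* [A] is the lower limit of the [F n]. *)
rewrite (_ : A = \bigcup_N \bigcap_(n in [set n | (N <= n)%N]) F n).
  apply: bigcup_measurable => N _; apply: bigcap_measurableType => n _; exact: mF.
apply/seteqP; split=> [x Ax|x [N _ h]].
  have [N _ hN] := FA x; exists N => // n Nn; exact/(hN n Nn).
have [M _ hM] := FA x.
apply/(hM (maxn N M)); first by rewrite /= leq_maxr.
by apply: h; rewrite /= leq_maxl.
Qed.

Lemma cvg_measure_eventually_eq : measurable B -> (m B < +oo)%E ->
  (forall n, F n `<=` B) -> m (F n) @[n --> \oo] --> m A.
Proof.
move=> mB Boo FB; have mA := measurable_eventually_eq.
have iB : m.-integrable setT (EFin \o \1_B).
  apply/integrableP; split; first by apply/measurable_EFinP; exact: measurable_indic.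
  under eq_integral do rewrite /= ger0_norm//.
  by rewrite integral_indic// setIT.
have [|||||_ _] := @dominated_convergence _ T R m setT measurableT
  (fun n => EFin \o \1_(F n)) (EFin \o \1_A) (EFin \o \1_B).
- by move=> n; apply/measurable_EFinP; exact: measurable_indic.
- by apply/measurable_EFinP; exact: measurable_indic.
- apply: aeW => x _; apply: cvg_near_cst.
  have := FA x; apply: filterS => n h; rewrite /= !indicE; congr (_%:R%:E).
  by congr nat_of_bool; apply/idP/idP => /set_mem/h/mem_set.
- exact: iB.
- apply: aeW => x n _; rewrite /= ger0_norm// lee_fin !indicE.
  have [/set_mem/FB/mem_set -> //|_] := boolP (x \in F n).
  by rewrite ler0n.
rewrite integral_indic// setIT => h.
apply: cvg_trans h; apply: near_eq_cvg; near=> n.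
by rewrite /= integral_indic// setIT.
Unshelve. all: by end_near. Qed.

End eventually_equal_sets.

Section poisson_cells.
Context {R : realType} {d k : nat} {disp : measure_display} {Omega : measurableType disp}.
Local Notation E := (euclidean R d).
Local Notation mu := (@lebesgue_rd R d).
Variables (P : probability Omega R) (lambda : R) (H : Omega -> set E).
Hypothesis lambda_gt0 : 0 < lambda.
Hypothesis HP : poisson_process P lambda H.
Local Open Scope ereal_scope.

Lemma pp_independent_fin (I : finType) (A : I -> set E) (m : I -> nat) :
  (forall i, measurable (A i)) -> (forall i, mu (A i) < +oo) -> trivIset setT A ->
  P (\bigcap_i count_event H (A i) (m i)) = \prod_i P (count_event H (A i) (m i)).
Proof.
move=> mA fA tA.
have := @pp_independent _ _ _ _ _ _ _ HP #|I| (A \o enum_val) (m \o enum_val).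
move=> /(_ (fun i => mA _) (fun i => fA _)) h.
rewrite (_ : \bigcap_i _ = \bigcap_(i : 'I_#|I|) count_event H (A (enum_val i)) (m (enum_val i))).
  rewrite h; last first.
    by move=> i j _ _ [x [xi xj]]; apply: enum_val_inj; apply: tA => //; exists x.
  by rewrite [RHS](reindex (@enum_val I I))//=; exact/onW_bij/enum_val_bij.
apply/seteqP; split=> w /= h' i _; first exact: h'.
by rewrite -(enum_rankK i); exact: h'.
Qed.

End poisson_cells.

(** * Probability of a prescribed occupancy of the cells *)

Section poisson_grid.
Context {R : realType} {d k : nat} {disp : measure_display} {Omega : measurableType disp}.
Local Notation E := (euclidean R d).
Local Notation mu := (@lebesgue_rd R d).
Variables (P : probability Omega R) (lambda : R) (H : Omega -> set E).
Hypothesis lambda_gt0 : 0 < lambda.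
Hypothesis HP : poisson_process P lambda H.
Variables (W : set E) (J : nat -> finType) (q : forall n, E -> J n)
  (c : forall n, J n -> E) (delta : nat -> R).
Hypothesis mW : measurable W.
Hypothesis W_lty : (mu W < +oo)%E.
Hypothesis mq : forall n (j : J n), measurable (q n @^-1` [set j]).
Hypothesis delta_ge0 : forall n, 0 <= delta n.
Local Notation cell n j := (@grid_cell R d W J q n j).
Local Notation good n s := (@good_choice R d k J c delta n s).
Local Notation watched n s j := (@watches R d k J c delta n s j).
Local Notation selects n X s := (@selects_choice R d k W J q c delta n X s).
Implicit Types (z : k.-tuple E).

Let W' : set E := W `\` [set origin].

Lemma measurable_punctured : measurable W'.
Proof. by apply: measurableD => //; exact: measurable_euclidean_set1. Qed.

Lemma measurable_cell n (j : J n) : measurable (cell n j).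
Proof. by apply: measurableI; [exact: measurable_punctured|exact: mq]. Qed.

Local Open Scope ereal_scope.

Lemma sub_W_lty (A : set E) : measurable A -> A `<=` W -> mu A < +oo.
Proof. by move=> mA AW; apply: le_lt_trans W_lty; apply: le_measure; rewrite ?inE. Qed.

Lemma cell_lty n (j : J n) : mu (cell n j) < +oo.
Proof. by apply: sub_W_lty; [exact: measurable_cell|move=> y [[]]]. Qed.

(** Unwatched cells become empty sets, on which a count of 0 is certain: independence can then be
    applied to all indices at once. *)
Definition watched_cell n (s : {ffun 'I_k -> J n}) (j : J n) : set E :=
  if watched n s j then cell n j else set0.

Definition watched_zone n (s : {ffun 'I_k -> J n}) : set E :=
  [set y | W' y /\ watched n s (q n y)].

Lemma measurable_watched_cell n (s : {ffun 'I_k -> J n}) j : measurable (watched_cell s j).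
Proof. by rewrite /watched_cell; case: ifP => // _; exact: measurable_cell. Qed.

Lemma watched_cell_lty n (s : {ffun 'I_k -> J n}) j : mu (watched_cell s j) < +oo.
Proof. by rewrite /watched_cell; case: ifP => _; [exact: cell_lty|rewrite measure0]. Qed.

Lemma trivIset_watched_cell n (s : {ffun 'I_k -> J n}) : trivIset setT (watched_cell s).
Proof.
move=> i j _ _ [x []]; rewrite /watched_cell; case: ifP => // _; case: ifP => // _.
by move=> [_ /= <-] [_ /= <-].
Qed.

Lemma watched_zoneE n (s : {ffun 'I_k -> J n}) :
  watched_zone s = \bigcup_j watched_cell s j.
Proof.
apply/seteqP; split=> [y [Wy ys]|y [j _]]; rewrite /watched_cell.
  by exists (q n y) => //; rewrite ys.
by case: ifP => // js [Wy /= yj]; split => //; rewrite yj.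
Qed.

Lemma measurable_watched_zone n (s : {ffun 'I_k -> J n}) : measurable (watched_zone s).
Proof.
rewrite watched_zoneE; apply: fin_bigcup_measurable => // j _.
exact: measurable_watched_cell.
Qed.

Lemma watched_zone_sum n (s : {ffun 'I_k -> J n}) :
  mu (watched_zone s) = \sum_(j : J n) mu (watched_cell s j).
Proof.
rewrite watched_zoneE measure_fin_bigcup//; last 2 first.
- exact: trivIset_watched_cell.
- by move=> j _; exact: measurable_watched_cell.
rewrite (fsbigE (index_enum (J n))) ?index_enum_uniq//.
- by apply: eq_bigl => j; rewrite in_setT.
- by move=> j _; rewrite mem_index_enum.
- exact: finite_finset.
Qed.

Definition selection_event n (s : {ffun 'I_k -> J n}) : set Omega :=
  [set w | selects n (H w) s].

Lemma selection_eventE n (s : {ffun 'I_k -> J n}) :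
  selection_event s = \bigcap_j count_event H (watched_cell s j) (j \in codom s).
Proof.
apply/seteqP; split=> [w h j _|w h j js]; last first.
  by have := h j I; rewrite /watched_cell js.
rewrite /watched_cell; case: ifPn => [js|njs]; first exact: h.
have -> : (j \in codom s) = false.
  by apply: contraNF njs => /codomP[i ->]; exact: watched_codom.
by rewrite /count_event /= setI0 II0 card_eq00.
Qed.

Lemma measurable_selection_event n (s : {ffun 'I_k -> J n}) : measurable (selection_event s).
Proof.
rewrite selection_eventE; apply: fin_bigcap_measurable => // j _.
by apply: (pp_measurable HP); exact: measurable_watched_cell.
Qed.

(** Every watched cell of mean r contributes e^{-r}, and a chosen one the extra factor r.
    Injectivity turns the product over the image of [s] into a product over indices. *)
Lemma selection_prob n (s : {ffun 'I_k -> J n}) : injective s ->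
  P (selection_event s) = (lambda ^+ k * expR (- (lambda * fine (mu (watched_zone s)))))%:E *
    \prod_(i < k) mu (cell n (s i)).
Proof.
move=> is_; pose r j := (lambda * fine (mu (watched_cell s j)))%R.
rewrite selection_eventE (pp_independent_fin HP); last 3 first.
- exact: measurable_watched_cell.
- exact: watched_cell_lty.
- exact: trivIset_watched_cell.
rewrite (eq_bigr (fun j => (expR (- r j) * (if j \in codom s then r j else 1))%:E)); last first.
  move=> j _; rewrite (pp_poisson HP); [|exact: measurable_watched_cell|exact: watched_cell_lty].
  by case: (j \in codom s); rewrite ?expr1 ?expr0 divr1.
rewrite prodEFin big_split/= -expR_sum.
have -> : (\prod_j (if j \in codom s then r j else 1) = \prod_(i < k) (lambda * fine (mu (cell n (s i)))))%R.
  rewrite -big_mkcond/= -big_uniq; last by rewrite /codom map_inj_uniq ?enum_uniq.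
  rewrite big_image/=; apply: eq_bigr => i _; rewrite /r /watched_cell watched_codom//.
have -> : \prod_(i < k) mu (cell n (s i)) = (\prod_(i < k) fine (mu (cell n (s i))))%:E.
  rewrite -prodEFin; apply: eq_bigr => i _; rewrite fineK// ge0_fin_numE//; exact: cell_lty.
rewrite -EFinM big_split/= prodr_const card_ord; congr EFin.
rewrite sumrN -mulr_sumr.
have -> : (\sum_j fine (mu (watched_cell s j)) = fine (mu (watched_zone s)))%R.
  rewrite watched_zone_sum -sum_fine// => j _; rewrite ge0_fin_numE//.
  exact: watched_cell_lty.
by rewrite mulrA [(expR _ * _)%R]mulrC.
Qed.

End poisson_grid.

(** * Measurability of the geometric conditions *)

Section measurability.
Context {R : realType} {d k : nat}.
Local Notation E := (euclidean R d).
Implicit Types (z : k.-tuple E).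

(** A finite union, over the assignments accepted by [Q], of finite intersections of measurable
    sets. *)
Lemma measurable_bool_depend (disp : measure_display) (T : measurableType disp) (I : finType)
    (b : I -> T -> bool) (Q : {ffun I -> bool} -> bool) :
  (forall i, measurable_fun setT (b i)) ->
  measurable_fun setT (fun x => Q [ffun i => b i x]).
Proof.
move=> mb; apply: (measurable_fun_bool true); rewrite setTI.
rewrite (_ : _ @^-1` _ = \bigcup_(f in [set f : {ffun I -> bool} | Q f])
    \bigcap_(i : I) (b i @^-1` [set f i])).
  apply: fin_bigcup_measurable => // f _; apply: fin_bigcap_measurable => // i _.
  by rewrite -[X in measurable X]setTI; exact: mb.
apply/seteqP; split=> [x /= Qx|x [f /= Qf h]].
  by exists [ffun i => b i x] => // i _; rewrite /= ffunE.
by rewrite (_ : [ffun i => b i x] = f)//; apply/ffunP => i; rewrite ffunE; exact: h.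
Qed.

Lemma measurable_tnth_euclidean (i : 'I_k) : measurable_fun setT (fun z => tnth z i).
Proof. exact: measurable_tnth. Qed.

Lemma measurable_points_connected r : measurable_fun setT (@points_connected R d k r).
Proof.
pose b (v : 'I_k + 'I_k * 'I_k) z := match v with
  | inl i => enorm (tnth z i) <= r
  | inr p => enorm (esub (tnth z p.1) (tnth z p.2)) <= r end.
have := @measurable_bool_depend _ _ ('I_k + 'I_k * 'I_k)%type b
  (fun f => rooted_connected (fun i => f (inl i)) (fun i j => f (inr (i, j)))).
rewrite (_ : (fun x => rooted_connected _ _) = points_connected r); last first.
  by apply/funext => z; apply: eq_rooted_connected => [i|i j]; rewrite ffunE.
apply => -[i|[i j]] /=; apply: measurable_fun_ler => //.
  by apply: (measurableT_comp (@measurable_enorm R d)); exact: measurable_tnth.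
by apply: measurable_edist; exact: measurable_tnth.
Qed.

Lemma measurable_near_points r :
  measurable_fun setT (fun p : k.-tuple E * E => near_points r p.1 p.2).
Proof.
apply: measurable_or.
  apply: measurable_fun_ler => //.
  exact: (measurableT_comp (@measurable_enorm R d) measurable_snd).
pose b (i : 'I_k) (p : k.-tuple E * E) := enorm (esub p.2 (tnth p.1 i)) <= r.
have := @measurable_bool_depend _ _ 'I_k b (fun f => [exists i, f i]).
rewrite (_ : (fun x => [exists i, _]) = fun p => [exists i, enorm (esub p.2 (tnth p.1 i)) <= r]); last first.
  by apply/funext => p; apply: eq_existsb => i; rewrite ffunE.
apply=> i; apply: measurable_fun_ler => //; apply: measurable_edist; first exact: measurable_snd.
exact: (measurableT_comp (measurable_tnth_euclidean i) measurable_fst).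
Qed.

Lemma measurable_not_uniq : measurable [set z : k.-tuple E | ~~ uniq (origin :: z)].
Proof.
pose b (v : 'I_k + 'I_k * 'I_k) z := match v with
  | inl i => enorm (tnth z i) <= 0
  | inr p => enorm (esub (tnth z p.1) (tnth z p.2)) <= 0 end.
have mb : measurable_fun setT (fun z : k.-tuple E => ~~ uniq (origin :: z)).
  have := @measurable_bool_depend _ _ ('I_k + 'I_k * 'I_k)%type b
    (fun f => [exists i, f (inl i)] || [exists i, exists j, (i != j) && f (inr (i, j))]).
  rewrite (_ : (fun x => _ || _) = fun z : k.-tuple E => ~~ uniq (origin :: z)).
    apply => -[i|[i j]] /=; apply: measurable_fun_ler => //.
      by apply: (measurableT_comp (@measurable_enorm R d)); exact: measurable_tnth.
    by apply: measurable_edist; exact: measurable_tnth.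
  apply/funext => z; rewrite /= negb_and negbK; congr (_ || _).
    apply/existsP/tnthP => -[i h]; exists i; rewrite ?ffunE/= in h *.
      by apply/esym/eqP; rewrite -enorm_eq0 eq_le h/= enorm_ge0.
    by rewrite -h enorm0.
  apply/existsP/idP => [[i /existsP[j]]|].
    rewrite ffunE/= => /andP[ij h]; apply/negP => /tuple_uniqP uz.
    case/eqP: ij; apply: uz; apply/eqP; rewrite -edist_eq0 eq_le h/= enorm_ge0//.
  apply: contraNP => /forallNP h; apply/tuple_uniqP => i j zij; apply/eqP/negPn/negP => ij.
  apply: (h i); apply/existsP; exists j; rewrite ij ffunE/= zij.
  by have /eqP -> : enorm (esub (tnth z j) (tnth z j)) == 0; rewrite ?edist_eq0 ?eqxx.
by have := mb measurableT [set true] I; rewrite setTI; apply.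
Qed.

End measurability.

Definition near_region (R : realType) (d k : nat) (z : k.-tuple (euclidean R d)) : set (euclidean R d) :=
  [set y | near_points 1 z y].

Section near_region.
Context {R : realType} {d k : nat}.
Local Notation E := (euclidean R d).
Local Notation mu := (@lebesgue_rd R d).
Implicit Types (z : k.-tuple E).
Local Open Scope ereal_scope.

Lemma near_region_sub z (r : R) : (forall i, enorm (tnth z i) <= r)%R -> (0 <= r)%R ->
  near_region z `<=` eball origin (r + 1)%R.
Proof.
move=> zr r0 y; rewrite /eball/= esub0 => /orP[y1|/existsP[i yi]].
  by rewrite (le_trans y1)// lerDr.
have := edist_triangle (tnth z i) y origin; rewrite !esub0; have := zr i.
lra.
Qed.

Lemma measurable_near_set : measurable [set p : k.-tuple E * E | near_points 1 p.1 p.2].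
Proof.
by have := @measurable_near_points R d k 1 measurableT [set true] I; rewrite setTI; apply.
Qed.

Lemma measurable_near_region z : measurable (near_region z).
Proof.
have := measurable_xsection z measurable_near_set.
by rewrite (_ : xsection _ _ = near_region z)//; apply/seteqP; split=> y;
  rewrite /xsection/= inE.
Qed.

Lemma near_region_lty z : mu (near_region z) < +oo.
Proof.
pose r := (\sum_(i < k) enorm (tnth z i))%R.
have r0 : (0 <= r)%R by exact: sumr_ge0.
apply: (le_lt_trans _ (lebesgue_rd_eball_lty (origin : E) (r + 1))).
apply: le_measure; rewrite ?inE; [exact: measurable_near_region|exact: measurable_eball|].
apply: near_region_sub => // i; by rewrite /r (bigD1 i)//= lerDl sumr_ge0.
Qed.

(** The sets measured are the sections of one measurable set of pairs (z, y). *)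
Lemma measurable_near_volume (B : set E) : measurable B ->
  measurable_fun setT (fun z => mu (near_region z `&` B)).
Proof.
move=> mB.
have mA : measurable ([set p : k.-tuple E * E | near_points 1 p.1 p.2] `&` snd @^-1` B).
  apply: measurableI; first exact: measurable_near_set.
  by rewrite -[X in measurable X]setTI; exact: measurable_snd.
have := measurable_fun_xsection mu mA.
rewrite (_ : _ \o _ = fun z => mu (near_region z `&` B))//.
apply/funext => z /=; congr (mu _); apply/seteqP; split => y.
  by rewrite /xsection/= inE.
by rewrite /xsection/= inE.
Qed.

End near_region.

(** * Passage to the limit of fine grids *)

Section cluster_probability_grid.
Context {R : realType} {d k : nat} {disp : measure_display} {Omega : measurableType disp}.
Hypothesis d0 : (0 < d)%N.
Local Notation E := (euclidean R d).
Local Notation mu := (@lebesgue_rd R d).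
Local Notation muk := (power_measure (@lebesgue_rd R d) k).
Variables (P : probability Omega R) (lambda : R) (H : Omega -> set E).
Hypothesis lambda_gt0 : 0 < lambda.
Hypothesis HP : poisson_process P lambda H.
Variables (W : set E) (J : nat -> finType) (q : forall n, E -> J n)
  (c : forall n, J n -> E) (delta : nat -> R).
Hypothesis mW : measurable W.
Hypothesis W_lty : (mu W < +oo)%E.
Hypothesis W_bounded : exists r : R, W `<=` eball origin r.
Hypothesis W_large : eball origin k.+1%:R `<=` W.
Hypothesis mq : forall n (j : J n), measurable (q n @^-1` [set j]).
Hypothesis q_center : forall n y, W y -> enorm (esub y (c (q n y))) <= delta n.
Hypothesis delta_cvg : delta @ \oo --> (0 : R).
Hypothesis delta_ge0 : forall n, 0 <= delta n.
Local Notation cell n j := (@grid_cell R d W J q n j).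
Local Notation good n s := (@good_choice R d k J c delta n s).
Local Notation watched n s j := (@watches R d k J c delta n s j).
Local Notation selects n X s := (@selects_choice R d k W J q c delta n X s).
Local Notation selection_event n s := (@selection_event R d k disp Omega H W J q c delta n s).
Local Notation watched_region n s := (@watched_zone R d k W J q c delta n s).
Local Notation quantize n z := (@quantize R d k J q n z).
Local Notation cluster := Defs.cluster.
Implicit Types (z : k.-tuple E).

Let W' : set E := W `\` [set origin].
Let mW' : measurable W'. Proof. exact: measurable_punctured. Qed.

Local Open Scope ereal_scope.

Let W'_lty : mu W' < +oo.
Proof. by apply: (sub_W_lty mW W_lty) => // y []. Qed.

Definition discrete_event n : set Omega :=
  [set w | exists s : {ffun 'I_k -> J n}, good n s /\ selects n (H w) s].

Lemma measurable_discrete_event n : measurable (discrete_event n).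
Proof.
rewrite (_ : discrete_event n = \bigcup_(s in [set s | good n s]) selection_event n s).
  by apply: fin_bigcup_measurable => // s _; exact: (measurable_selection_event HP).
by apply/seteqP; split=> [w [s [gs ws]]|w [s gs ws]]; exists s.
Qed.

(** On the event exactly k! choices are selected, the enumerations of a single set of cells; off it
    there are none. Taking expectations of this count gives the formula. *)
Lemma discrete_event_prob n : (k`!%:R)%:E * P (discrete_event n) =
  \sum_(s : {ffun 'I_k -> J n}) (good n s)%:R%:E * P (selection_event n s).
Proof.
have mS s : measurable (selection_event n s) by exact: (measurable_selection_event HP).
transitivity (\int[P]_w \sum_(s : {ffun 'I_k -> J n}) ((good n s)%:R * \1_(selection_event n s) w)%:E).
  transitivity (\int[P]_w ((k`!%:R)%:E * (\1_(discrete_event n) w)%:E)).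
    rewrite ge0_integralZl//.
    - by rewrite integral_indic ?setIT//; exact: measurable_discrete_event.
    - by apply/measurable_EFinP; apply: measurable_indic; exact: measurable_discrete_event.
  apply: eq_integral => w _; rewrite sumEFin -EFinM; congr EFin.
  have -> : (\sum_(s : {ffun 'I_k -> J n}) (good n s)%:R * \1_(selection_event n s) w =
     (#|[set s : {ffun 'I_k -> J n} | good n s && `[< selects n (H w) s >]]%SET|)%:R :> R)%R.
    rewrite -sum1_card natr_sum [RHS]big_mkcond/=; apply: eq_bigr => s _; rewrite finset.inE.
    rewrite indicE; case: (good n s) => /=; rewrite ?mul0r ?mul1r//.
    have -> : (w \in selection_event n s) = `[< selects n (H w) s >].
      by apply/idP/asboolP => [/set_mem|/mem_set].
    by case: ifP.
  rewrite indicE; have [/set_mem[s [gs ws]]|nw] := boolP (w \in discrete_event n).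
    by rewrite mulr1 (card_selects delta_ge0 gs ws).
  rewrite mulr0 eq_card0// => s; rewrite !inE; apply/negP => /andP[gs /asboolW ws].
  by case/negP: nw; apply/mem_set; exists s.
rewrite ge0_integral_sum//.
- apply: eq_bigr => s _; under eq_integral do rewrite EFinM.
  rewrite ge0_integralZl//; first by rewrite integral_indic// setIT.
  by apply/measurable_EFinP; exact: measurable_indic.
- by move=> s; apply/measurable_EFinP; apply: measurable_funM => //; exact: measurable_indic.
Qed.

Definition void_weight n (s : {ffun 'I_k -> J n}) : R :=
  ((good n s)%:R * expR (- (lambda * fine (mu (watched_region n s)))))%R.

Definition discrete_density n z : R :=
  ((\prod_(i < k) \1_W' (tnth z i)) * void_weight (quantize n z))%R.

(** The products of cells are disjoint, so only the term s = [quantize n z] can survive. This turns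
    a sum over choices into the integral of a step function. *)
Lemma discrete_densityE n z : discrete_density n z =
  (\sum_(s : {ffun 'I_k -> J n}) void_weight s * \prod_(i < k) \1_(cell n (s i)) (tnth z i))%R.
Proof.
rewrite (bigD1 (quantize n z))//= [X in (_ + X)%R]big1 ?addr0 => [|s sz].
  rewrite /discrete_density [LHS]mulrC; congr (_ * _)%R; apply: eq_bigr => i _.
  rewrite !indicE; congr (_%:R); congr nat_of_bool; apply/idP/idP => /set_mem.
    by move=> h; apply/mem_set; split => //; rewrite /= ffunE.
  by move=> [h _]; apply/mem_set.
have [i si] : exists i, s i != q n (tnth z i).
  apply/existsP; rewrite -negb_forall; apply: contra sz => /forallP h.
  by apply/eqP/ffunP => i; rewrite ffunE; apply/eqP.
rewrite (bigD1 i)//= indicE memNset ?mul0r ?mulr0// => -[_ /= qs].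
by rewrite qs eqxx in si.
Qed.

Lemma void_weight_ge0 n (s : {ffun 'I_k -> J n}) : (0 <= void_weight s)%R.
Proof. by rewrite mulr_ge0 ?expR_ge0. Qed.

Lemma void_weight_le1 n (s : {ffun 'I_k -> J n}) : (void_weight s <= 1)%R.
Proof.
rewrite /void_weight; apply: mulr_ile1 => //; rewrite ?expR_ge0 ?lern1 ?leq_b1//.
by rewrite expR_le1 oppr_le0 mulr_ge0 ?(ltW lambda_gt0)// fine_ge0.
Qed.

Lemma measurable_prod_indic (A : 'I_k -> set E) : (forall i, measurable (A i)) ->
  measurable_fun setT (fun z => \prod_(i < k) \1_(A i) (tnth z i) : R)%R.
Proof.
move=> mA; apply: measurable_prod => i _.
have mI : measurable_fun setT (\1_(A i) : E -> R) by exact: measurable_indic.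
exact: (measurableT_comp mI (measurable_tnth_euclidean i)).
Qed.

Lemma measurable_discrete_density n : measurable_fun setT (discrete_density n).
Proof.
rewrite (_ : discrete_density n = fun z =>
  (\sum_(s : {ffun 'I_k -> J n}) void_weight s * \prod_(i < k) \1_(cell n (s i)) (tnth z i))%R).
  apply: measurable_sum => s; apply: measurable_funM => //.
  by apply: measurable_prod_indic => i; exact: measurable_cell.
by apply/funext => z; exact: discrete_densityE.
Qed.

Lemma discrete_event_integral n : (k`!%:R)%:E * P (discrete_event n) =
  (lambda ^+ k)%:E * \int[muk]_z (discrete_density n z)%:E.
Proof.
have mc s : measurable_fun setT (fun z => \prod_(i < k) \1_(cell n (s i)) (tnth z i) : R)%R.
  by apply: measurable_prod_indic => i; exact: measurable_cell.
rewrite discrete_event_prob.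
have -> : \int[muk]_z (discrete_density n z)%:E =
   \sum_(s : {ffun 'I_k -> J n}) (void_weight s)%:E * \prod_(i < k) mu (cell n (s i)).
  transitivity (\int[muk]_z \sum_(s : {ffun 'I_k -> J n})
      (void_weight s * \prod_(i < k) \1_(cell n (s i)) (tnth z i))%:E).
    by apply: eq_integral => z _; rewrite discrete_densityE sumEFin.
  rewrite ge0_integral_sum//.
  - apply: eq_bigr => s _; under eq_integral do rewrite EFinM.
    rewrite ge0_integralZl//.
    + congr (_ * _); under eq_integral do rewrite -prodEFin.
      rewrite (ge0_integral_power_measure_prod _ (f := fun i x => (\1_(cell n (s i)) x)%:E))//.
        by apply: eq_bigr => i _; rewrite integral_indic ?setIT//; exact: measurable_cell.
      by move=> i; apply/measurable_EFinP; apply: measurable_indic; exact: measurable_cell.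
    + exact/measurable_EFinP.
    + by move=> z _; rewrite lee_fin prodr_ge0.
    + by rewrite lee_fin void_weight_ge0.
  - by move=> s; apply/measurable_EFinP; exact: measurable_funM.
  - by move=> s z _; rewrite lee_fin mulr_ge0 ?void_weight_ge0 ?prodr_ge0.
rewrite ge0_sume_distrr; last first.
  by move=> s _; rewrite mule_ge0 ?lee_fin ?void_weight_ge0// prode_ge0.
apply: eq_bigr => s _; rewrite muleA -EFinM /void_weight.
have [gs|_] := boolP (good n s); last by rewrite !mul0r mulr0 !mul0e.
rewrite mul1e mul1r (selection_prob HP c mW W_lty mq delta_ge0)//.
by have /andP[/injectiveP] := gs.
Qed.


Definition limit_density z : R := ((\prod_(i < k) \1_W' (tnth z i)) *
  ((points_connected 1 z)%:R * expR (- (lambda * fine (mu (near_region z `&` W'))))))%R.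

Lemma prod_indic z (A : set E) : (\prod_(i < k) \1_A (tnth z i))%R =
  [forall i, tnth z i \in A]%:R :> R.
Proof.
have [/forallP h|/forallPn[i ni]] := boolP [forall i, tnth z i \in A].
  by rewrite big1// => i _; rewrite indicE h.
by rewrite (bigD1 i)//= indicE (negbTE ni) mul0r.
Qed.

(** On a grid faithful to the entries of z, goodness becomes connectedness; [uniq] is what makes the
    quantized choice injective. The volumes converge because each point y is eventually classified
    correctly. *)
Lemma discrete_density_cvg z : uniq z ->
  discrete_density n z @[n --> \oo] --> limit_density z.
Proof.
move=> uz; rewrite /discrete_density /limit_density prod_indic.
have [/forallP zW|_] := boolP [forall i, tnth z i \in W']; last first.
  rewrite mul0r; under eq_fun do rewrite mul0r; exact: cvg_cst.
have W'z i : W' (tnth z i) by have /set_mem := zW i.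
have Wt x : x \in (z : seq E) -> W x by move=> /tnthP[i ->]; have [] := W'z i.
rewrite mul1r; under eq_fun do rewrite mul1r /void_weight.
apply: cvgM.
  apply: cvg_near_cst.
  have := near_faithful_seq q_center delta_cvg delta_ge0 Wt; apply: filterS => n fz.
  have fzz i j : faithful q c delta n (tnth z i) (tnth z j) by apply: fz; exact: mem_tnth.
  congr (nat_of_bool _)%:R; rewrite /good_choice faithful_connected//.
  rewrite (_ : injectiveb _ = true)//; apply/injectiveP => i j; rewrite !ffunE => qij.
  by move/tuple_uniqP : uz; apply; have [_ _ ->] := fzz i j.
(* Faithfulness on y :: z settles the status of y; the threshold depends on y, hence the domination
   by W afterwards. *)
have hA y : \forall n \near \oo, watched_region n (quantize n z) y <-> (near_region z `&` W') y.
  have [W'y|nW'y] := pselect (W' y); last first.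
    by near=> n; split; [move=> [] | move=> []] => //.
  have Wt' x : x \in (y :: z : seq E) -> W x.
    by rewrite inE => /predU1P[->|/Wt//]; case: W'y.
  have := near_faithful_seq q_center delta_cvg delta_ge0 Wt'; apply: filterS => n fz.
  have fn := @faithful_near _ _ _ _ q c delta n z y (fz _ _ (mem_head _ _) (mem_head _ _))
    (fun i => fz _ _ (mem_head _ _) (mem_behead (s := y :: z) (mem_tnth i z))).
  rewrite /watched_zone /near_region /= -fn; split => -[] //.
have mwr n : measurable (watched_region n (quantize n z)).
  exact: measurable_watched_zone.
have mnr : mu (near_region z `&` W') < +oo.
  apply: (le_lt_trans _ (near_region_lty z)); apply: le_measure; rewrite ?inE.
  - by apply: measurableI => //; exact: measurable_near_region.
  - exact: measurable_near_region.
  - by move=> y [].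
have hm := cvg_measure_eventually_eq (m := mu) mwr hA mW W_lty (fun n y h => proj1 (proj1 h)).
have fm : mu (near_region z `&` W') \is a fin_num by rewrite ge0_fin_numE.
apply: (cvg_comp _ (@expR R)); last exact: continuous_expR.
apply: cvgN; apply: cvgMr; apply: fine_cvg; rewrite fineK//.
Unshelve. all: by end_near. Qed.

Lemma measurable_natbool (disp' : measure_display) (T : measurableType disp') (b : T -> bool) :
  measurable_fun setT b -> measurable_fun setT (fun x => (b x)%:R : R).
Proof.
move=> mb; rewrite (_ : (fun _ => _) = fun x => if b x then 1%R else 0%R).
  by apply: measurable_fun_ifT => //; exact: measurable_cst.
by apply/funext => x; case: (b x).
Qed.

Lemma measurable_limit_density : measurable_fun setT limit_density.
Proof.
apply: measurable_funM; first exact: measurable_prod_indic.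
apply: measurable_funM; first exact: measurable_natbool (@measurable_points_connected R d k 1).
have mv : measurable_fun setT (fun z => fine (mu (near_region z `&` W'))).
  have mf : measurable_fun setT (fine : \bar R -> R) by exact: fine_measurable.
  have mw := @measurable_near_volume R d k W' mW'.
  exact: (measurableT_comp mf mw).
have ml : measurable_fun setT (fun z => - (lambda * fine (mu (near_region z `&` W'))))%R.
  by apply: measurable_funN; exact: measurable_funM.
exact: (measurableT_comp (@measurable_expR R) ml).
Qed.

(** The densities are at most the indicator of the k-th power of [W'], of finite measure, and
    converge off the null set of tuples with a repetition or an entry at the origin. *)
Lemma cvg_discrete_integral :
  \int[muk]_z (discrete_density n z)%:E @[n --> \oo] --> \int[muk]_z (limit_density z)%:E.
Proof.
pose g z : R := (\prod_(i < k) \1_W' (tnth z i))%R.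
have mg : measurable_fun setT g by apply: measurable_prod_indic.
have g0 z : (0 <= g z)%R by exact: prodr_ge0.
have [|||||_ _] := @dominated_convergence _ _ R muk setT measurableT
  (fun n => EFin \o discrete_density n) (EFin \o limit_density) (EFin \o g) => //.
- by move=> n; apply/measurable_EFinP; exact: measurable_discrete_density.
- by apply/measurable_EFinP; exact: measurable_limit_density.
- exists [set z : k.-tuple E | ~~ uniq (origin :: z)]; split.
  + exact: measurable_not_uniq.
  + apply: power_measure_not_uniq.
    * by move=> x; exact: lebesgue_rd_set1.
    * exact: measurable_euclidean_set1.
    * by move=> m; exact: measurable_not_uniq.
  + move=> z /= /not_implyP[_ h]; apply/negP => /andP[_ uz]; apply: h.
    by apply: cvg_comp (discrete_density_cvg uz) _; apply: cvg_EFin; [exact: nearW|exact: cvg_id].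
- apply/integrableP; split; first exact/measurable_EFinP.
  under eq_integral do rewrite /= ger0_norm//.
  under eq_integral do rewrite /g -prodEFin.
  rewrite (ge0_integral_power_measure_prod _ (f := fun=> fun x => (\1_W' x)%:E))//; last first.
    by move=> _; apply/measurable_EFinP; exact: measurable_indic.
  rewrite -ge0_fin_numE; last by apply: prode_ge0 => i _; apply: integral_ge0 => x _; rewrite lee_fin.
  apply: prode_fin_num => i _; rewrite integral_indic// setIT ge0_fin_numE//.
- apply: aeW => z n _; rewrite /= ger0_norm; last by rewrite mulr_ge0// ?void_weight_ge0// g0.
  by rewrite lee_fin ler_piMr ?g0// void_weight_le1.
Qed.

Lemma near_discrete_event w : \forall n \near \oo,
  discrete_event n w <-> cluster (H w) #= `I_k.+1.
Proof.
have fin : finite_set (H w `&` W).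
  have [r Wr] := W_bounded; apply: sub_finite_set (pp_locally_finite HP w r).
  by move=> y [Hy /Wr].
have := near_selects q_center delta_cvg delta_ge0 fin W_large.
by apply: filterS => n h; rewrite cluster_cardP.
Qed.

(** k! P([discrete_event n]) has two limits, one on the probability space and one on the space of
    tuples; they coincide. *)
Lemma cluster_event_grid :
  measurable [set w | cluster (H w) #= `I_k.+1] /\
  (k`!%:R)%:E * P [set w | cluster (H w) #= `I_k.+1] =
    (lambda ^+ k)%:E * \int[muk]_z (limit_density z)%:E.
Proof.
have mD := measurable_discrete_event; have nD := near_discrete_event.
split; first exact: (measurable_eventually_eq mD nD).
have h1 : (k`!%:R)%:E * P (discrete_event n) @[n --> \oo] -->
    (k`!%:R)%:E * P [set w | cluster (H w) #= `I_k.+1].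
  apply: cvgeZl => //; apply: (cvg_measure_eventually_eq (m := P) mD nD (B := setT)) => //.
  exact: le_lt_trans (probability_le1 P measurableT) (ltry 1%R).
have h2 : (k`!%:R)%:E * P (discrete_event n) @[n --> \oo] -->
    (lambda ^+ k)%:E * \int[muk]_z (limit_density z)%:E.
  rewrite (_ : (fun n => _) = fun n => (lambda ^+ k)%:E * \int[muk]_z (discrete_density n z)%:E).
    by apply: cvgeZl => //; exact: cvg_discrete_integral.
  by apply/funext => n; exact: discrete_event_integral.
exact: cvg_unique h1 h2.
Qed.

End cluster_probability_grid.

(** * A cubic grid covering a ball *)

Section cubic_grid.
Context {R : realType} {d : nat}.
Local Notation E := (euclidean R d).
Variable (L : nat).

Definition grid_size n := (2 * L * n.+1)%N.
(** One index more than there are steps between -L and L: the coordinate L itself is sent to the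
    last one. *)
Definition grid_index n : finType := {ffun 'I_d -> 'I_(grid_size n).+1}.

Definition grid_coord n (y : E) (i : 'I_d) : R := ((tnth y i : R) + L%:R) * n.+1%:R.

(** For |y| <= L this is the floor of [grid_coord], written as a number of thresholds passed: a
    function of finitely many comparisons, hence measurable. *)
Definition grid_map n (y : E) : grid_index n :=
  [ffun i => inord (\sum_(m < grid_size n) (m.+1%:R <= grid_coord n y i)%R)%N].

(** The lower corner of the cell. Each coordinate is off by at most 1/(n+1), and summing over the d
    coordinates gives [grid_mesh]. *)
Definition grid_center n (j : grid_index n) : E :=
  [tuple ((j i)%:R / n.+1%:R - L%:R : R) | i < d].

Definition grid_mesh n : R := d%:R / n.+1%:R.

Lemma grid_mesh_ge0 n : 0 <= grid_mesh n.
Proof. by rewrite divr_ge0. Qed.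

Lemma cvg_grid_mesh : grid_mesh @ \oo --> (0 : R).
Proof.
rewrite -[0 in X in _ --> X](mulr0 d%:R).
by apply: cvgMr; exact: cvg_harmonic.
Qed.

Lemma measurable_grid_map n (j : grid_index n) : measurable (@grid_map n @^-1` [set j]).
Proof.
pose b (v : 'I_d * 'I_(grid_size n)) (y : E) : bool := v.2.+1%:R <= grid_coord n y v.1.
pose Q (f : {ffun 'I_d * 'I_(grid_size n) -> bool}) : bool :=
  [ffun i => inord (\sum_(m < grid_size n) f (i, m))%N] == j.
have mb v : measurable_fun setT (b v).
  apply: measurable_fun_ler => //; apply: measurable_funM => //.
  by apply: measurable_funD => //; exact: measurable_tnth.
have mQ : measurable_fun setT (fun y => Q [ffun v => b v y]).
  exact: measurable_bool_depend.
have := mQ measurableT [set true] I.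
rewrite setTI (_ : _ @^-1` _ = @grid_map n @^-1` [set j])//.
apply/seteqP; split=> y; rewrite /= /Q.
  move/eqP => <-; apply/ffunP => i; rewrite !ffunE; congr inord.
  by apply: eq_bigr => m _; rewrite ffunE.
move=> <-; apply/eqP/ffunP => i; rewrite !ffunE; congr inord.
by apply: eq_bigr => m _; rewrite ffunE.
Qed.

Lemma sum_leq_truncn (t : R) (N : nat) : 0 <= t <= N%:R ->
  (\sum_(m < N) (m.+1%:R <= t)%R)%N = Num.truncn t.
Proof.
move=> /andP[t0 tN]; have aN : (Num.truncn t <= N)%N.
  by rewrite -(ler_nat R) (le_trans _ tN)// truncn_le.
under eq_bigr do rewrite -truncn_gt_nat.
rewrite (eq_bigr (fun m : 'I_N => if (m < Num.truncn t)%N then 1 else 0)%N); last first.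
  by move=> m _; case: ifP.
rewrite -big_mkcond/= (big_ord_narrow aN)/=.
by rewrite sum1_card card_ord.
Qed.

Lemma grid_mapP n (y : E) : eball origin L%:R y ->
  enorm (esub y (grid_center (grid_map n y))) <= grid_mesh n.
Proof.
rewrite /eball/= esub0 => yL; apply: (le_trans (enorm_le_sum _)).
rewrite /grid_mesh mulr_natl -[X in _ *+ X]card_ord -sumr_const.
apply: ler_sum => i _; rewrite !tnth_mktuple ffunE.
have := le_trans (coord_le_enorm y i) yL; rewrite ler_norml => /andP[yi1 yi2].
have n0 : 0 < n.+1%:R :> R by rewrite ltr0n.
have tb : 0 <= grid_coord n y i <= (grid_size n)%:R.
  rewrite /grid_coord /grid_size mulr_ge0//=; last by lra.
  by rewrite natrM ler_pM2r// natrM; lra.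
rewrite sum_leq_truncn//.
have /andP[t0 tN] := tb.
rewrite inordK; last first.
  by rewrite ltnS -(ler_nat R) (le_trans _ tN)// truncn_le.
have /andP[h1 h2] := truncn_itv t0.
have -> : (tnth y i : R) = grid_coord n y i / n.+1%:R - L%:R.
  by rewrite /grid_coord mulfK ?gt_eqF// addrK.
rewrite opprB addrA subrK -mulrBl normrM [X in _ * X]ger0_norm ?invr_ge0 ?ler0n//.
rewrite -[leRHS]mul1r ler_wpM2r ?invr_ge0// ger0_norm ?subr_ge0//.
by rewrite lerBlDl -natr1 in h2 *; rewrite ltW.
Qed.

End cubic_grid.

(** * The exact formula for the cluster probability *)

Section cluster_probability.
Context {R : realType} {d k : nat} {disp : measure_display} {Omega : measurableType disp}.
Hypothesis d0 : (0 < d)%N.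
Local Notation E := (euclidean R d).
Local Notation mu := (@lebesgue_rd R d).
Local Notation muk := (power_measure (@lebesgue_rd R d) k).
Variables (P : probability Omega R) (lambda : R) (H : Omega -> set E).
Hypothesis lambda_gt0 : 0 < lambda.
Hypothesis HP : poisson_process P lambda H.
Local Open Scope ereal_scope.

Lemma measurable_near_volumeT : measurable_fun setT (fun z : k.-tuple E => mu (near_region z)).
Proof.
have := @measurable_near_volume R d k setT measurableT.
by under eq_fun do rewrite setIT.
Qed.

Lemma measurable_void_prob : measurable_fun setT
  (fun z : k.-tuple E => expR (- (lambda * fine (mu (near_region z))))%R).
Proof.
have mf : measurable_fun setT (fine : \bar R -> R) by exact: fine_measurable.
have ml : measurable_fun setT (fun z : k.-tuple E => - (lambda * fine (mu (near_region z))))%R.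
  apply: measurable_funN; apply: measurable_funM => //.
  exact: (measurableT_comp mf measurable_near_volumeT).
exact: (measurableT_comp (@measurable_expR R) ml).
Qed.

(** With the ball of radius k + 1 as window, the region around a connected tuple lies inside it.
    Only the removal of the origin distinguishes the limit density from the integrand, and this
    affects null sets only. *)
Lemma cluster_event_prob :
  measurable [set w | Defs.cluster (H w) #= `I_k.+1] /\
  (k`!%:R)%:E * P [set w | Defs.cluster (H w) #= `I_k.+1] = (lambda ^+ k)%:E *
    \int[muk]_z ((points_connected 1 z)%:R * expR (- (lambda * fine (mu (near_region z)))))%:E.
Proof.
pose W : set E := eball origin k.+1%:R.
have mW : measurable W by exact: measurable_eball.
have W_lty : mu W < +oo by exact: lebesgue_rd_eball_lty.
have [mCl ->] := cluster_event_grid d0 lambda_gt0 HP mW W_lty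
  (ex_intro _ k.+1%:R (@subset_refl _ W)) (@subset_refl _ W)
  (@measurable_grid_map R d k.+1) (@grid_mapP R d k.+1) (@cvg_grid_mesh R d) (@grid_mesh_ge0 R d).
split=> //; congr (_ * _).
have mW' : measurable (W `\` [set origin]).
  by apply: measurableD => //; exact: measurable_euclidean_set1.
apply: ae_eq_integral => //.
- by apply/measurable_EFinP; exact: measurable_limit_density.
- apply/measurable_EFinP; apply: measurable_funM.
    exact: measurable_natbool (@measurable_points_connected R d k 1).
  exact: measurable_void_prob.
exists [set z : k.-tuple E | ~~ uniq (origin :: z)]; split.
- exact: measurable_not_uniq.
- apply: power_measure_not_uniq.
  + by move=> x; exact: lebesgue_rd_set1.
  + exact: measurable_euclidean_set1.
  + by move=> m; exact: measurable_not_uniq.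
move=> z /= /not_implyP[_ h]; apply/negP => /andP[oz uz]; apply: h; congr EFin.
rewrite /limit_density; have [zc|] := boolP (points_connected 1 z); last by rewrite !mul0r mulr0.
have zk i : (enorm (tnth z i) <= k%:R)%R by exact: points_connected_bound.
rewrite prod_indic (_ : [forall i, _] = true) ?mul1r; last first.
  apply/forallP => i; apply/mem_set; split; last first.
    by move=> zo; case/negP: oz; rewrite -zo mem_tnth.
  by rewrite /W /eball/= esub0 (le_trans (zk i))// ler_nat.
congr (expR (- (_ * fine _))).
have sub : near_region z `<=` W.
  by have := near_region_sub zk (ler0n _ _); rewrite natr1.
have mI : measurable (near_region z `&` (W `\` [set origin])).
  by apply: measurableI => //; exact: measurable_near_region.
have m1 : measurable (near_region z `&` [set origin]).
  apply: measurableI; [exact: measurable_near_region|exact: measurable_euclidean_set1].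
rewrite [in RHS](_ : near_region z = (near_region z `&` (W `\` [set origin])) `|`
  (near_region z `&` [set origin])); last first.
  rewrite -setIUr; apply/esym/setIidPl => y /sub Wy.
  by have [->|yo] := pselect (y = origin); [right|left].
rewrite measureU0//; apply/eqP; rewrite eq_le measure_ge0 andbT.
by rewrite -(lebesgue_rd_set1 origin d0); apply: le_measure => //; rewrite inE//; exact: measurable_euclidean_set1.
Qed.

End cluster_probability.

(** * Comparison of the integrals *)

Section exponential_decay.
Context {R : realType}.
Local Open Scope ereal_scope.

Lemma measurable_expRN (disp : measure_display) (T : measurableType disp) (f : T -> R) :
  measurable_fun setT f -> measurable_fun setT (fun x => (expR (- f x))%:E : \bar R).
Proof.
move=> mf; apply/measurable_EFinP.
have mN : measurable_fun setT (fun x => - f x)%R by exact: measurable_funN.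
exact: (measurableT_comp (@measurable_expR R) mN).
Qed.

(** The integrand is at most 1/b times the exponential density of rate b plus its reflection. *)
Lemma integral_exp_abs_lty (b : R) : (0 < b)%R ->
  \int[lebesgue_measure]_t (expR (- (b * `|t|)))%:E < +oo.
Proof.
move=> b0.
pose f (t : measurableTypeR R) : \bar R := (exponential_pdf b t)%:E.
have mf : measurable_fun setT f by apply/measurable_EFinP; exact: measurable_exponential_pdf.
have f0 t : 0 <= f t by rewrite lee_fin exponential_pdf_ge0// ltW.
have mN : measurable_fun setT (-%R : measurableTypeR R -> measurableTypeR R).
  exact: oppr_measurable.
have mfN : measurable_fun setT (fun t : measurableTypeR R => f (- (t : R))%R) by exact: (measurableT_comp mf mN).
have fN : \int[lebesgue_measure]_t f (- t)%R = 1.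
  rewrite -[RHS](integral_exponential_pdf b0).
  transitivity (\int[pushforward lebesgue_measure (-%R : measurableTypeR R -> measurableTypeR R)]_x f x).
    by rewrite ge0_integral_pushforward// preimage_setT.
  by apply: eq_measure_integral => A mA _; exact: lebesgue_measureN.
apply: (@le_lt_trans _ _ ((b^-1)%:E * \int[lebesgue_measure]_t (f t + f (- t)%R))).
  have mff : measurable_fun setT (fun t : measurableTypeR R => f t + f (- (t : R))%R).
    exact: emeasurable_funD.
  rewrite -(ge0_integralZl lebesgue_measure measurableT mff); last 2 first.
  - by move=> t _; exact: adde_ge0.
  - by rewrite lee_fin invr_ge0 ltW.
  apply: ge0_le_integral => //.
  - by apply: measurable_expRN; apply: measurable_funM => //; exact: normr_measurable.
  - exact: measurable_funeM.
  move=> t _; rewrite -EFinD -EFinM lee_fin ler_pdivlMl//.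
  have [t0|t0] := leP 0%R t.
    by rewrite ger0_norm// exponential_pdfE// -mulNr lerDl exponential_pdf_ge0// ltW.
  rewrite [X in (_ <= _ + X)%R]exponential_pdfE ?oppr_ge0 ?(ltW t0)// ltr0_norm// -mulNr.
  by rewrite lerDr exponential_pdf_ge0// ltW.
by rewrite ge0_integralD// fN integral_exponential_pdf// -EFinD -EFinM ltry.
Qed.

Lemma integral_exp_enorm_lty d (a : R) : (0 < d)%N -> (0 < a)%R ->
  \int[@lebesgue_rd R d]_x (expR (- (a * enorm x)))%:E < +oo.
Proof.
(* The norm is at least the average of the |x_i|; with the rate a/d the bound is a product over
   coordinates. *)
move=> d0 a0; pose b := (a / d%:R)%R.
have b0 : (0 < b)%R by rewrite divr_gt0// ltr0n.
apply: (@le_lt_trans _ _ (\int[@lebesgue_rd R d]_x \prod_(i < d) (expR (- (b * `|tnth x i : R|)))%:E)).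
  apply: ge0_le_integral => //.
  - by apply: measurable_expRN; apply: measurable_funM => //; exact: measurable_enorm.
  - apply: measurable_prode => i; apply: measurable_expRN; apply: measurable_funM => //.
    apply: (measurableT_comp (f := fun t : R => `|t|%R)); first exact: normr_measurable.
    exact: measurable_tnth.
  move=> x _; rewrite prodEFin lee_fin -expR_sum ler_expR sumrN lerN2 -mulr_sumr.
  rewrite /b mulrAC -mulrA ler_pM2l// ler_pdivrMr ?ltr0n//.
  rewrite mulr_natr -[X in (_ *+ X)%R]card_ord -sumr_const; apply: ler_sum => i _.
  exact: coord_le_enorm.
rewrite (ge0_integral_power_measure_prod (lebesgue_measure) (f := fun _ t => (expR (- (b * `|t : R|)))%:E))//.
  rewrite -ge0_fin_numE; last by apply: prode_ge0 => i _; apply: integral_ge0 => x _; rewrite lee_fin expR_ge0.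
  apply: prode_fin_num => i _; rewrite ge0_fin_numE; first exact: integral_exp_abs_lty.
  by apply: integral_ge0 => x _; rewrite lee_fin expR_ge0.
by move=> i; apply: measurable_expRN; apply: measurable_funM => //; exact: normr_measurable.
Qed.

Lemma integral_exp_sum_enorm_lty d k (a : R) : (0 < d)%N -> (0 < a)%R ->
  \int[power_measure (@lebesgue_rd R d) k]_z
    (expR (- (a * \sum_(i < k) enorm (tnth z i))))%:E < +oo.
Proof.
move=> d0 a0.
under eq_integral do rewrite mulr_sumr -sumrN expR_sum -prodEFin.
rewrite (ge0_integral_power_measure_prod (@lebesgue_rd R d) (f := fun _ x => (expR (- (a * enorm x)))%:E))//.
  rewrite -ge0_fin_numE; last by apply: prode_ge0 => i _; apply: integral_ge0 => x _; rewrite lee_fin expR_ge0.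
  apply: prode_fin_num => i _; rewrite ge0_fin_numE; first exact: integral_exp_enorm_lty.
  by apply: integral_ge0 => x _; rewrite lee_fin expR_ge0.
by move=> i; apply: measurable_expRN; apply: measurable_funM => //; exact: measurable_enorm.
Qed.

(** For a <= b the difference is e^{-a} (1 - e^{a-b}), and 1 - e^{-t} <= t. *)
Lemma expR_dist_le (a b m : R) : (m <= a)%R -> (m <= b)%R ->
  (`|expR (- a) - expR (- b)| <= `|a - b| * expR (- m))%R.
Proof.
wlog ab : a b / (a <= b)%R => [h ma mb|].
  have [ab|/ltW ba] := leP a b; first exact: h.
  by rewrite distrC [X in (_ <= X * _)%R]distrC; exact: h.
move=> ma mb.
rewrite ger0_norm ?subr_ge0 ?ler_expR ?lerN2// distrC ger0_norm ?subr_ge0//.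
have -> : expR (- b) = (expR (- a) * expR (a - b))%R by rewrite -expRD; congr expR; ring.
have h1 : (1 - expR (a - b) <= b - a)%R by have := expR_ge1Dx (a - b); lra.
have h2 : (expR (- a) <= expR (- m))%R by rewrite ler_expR lerN2.
rewrite -[X in (X - _)%R]mulr1 -mulrBr mulrC; apply: ler_pM => //; rewrite ?expR_ge0//.
by rewrite subr_ge0 expR_le1; lra.
Qed.

(** Half of the decay absorbs the polynomial: with u = c s / 2, the bounds u <= e^u and u^2/2 <= e^u
    give s <= (2/c) e^u and s^2 <= (8/c^2) e^u. *)
Lemma poly_exp_le (C c s : R) : (0 <= C)%R -> (0 < c)%R -> (0 <= s)%R ->
  ((C * s ^+ 2 + s) * expR (- (c * s)) <= (C * (8 / c ^+ 2) + 2 / c) * expR (- (c / 2 * s)))%R.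
Proof.
move=> C0 c0 s0; pose u := (c / 2 * s)%R.
have u0 : (0 <= u)%R by rewrite mulr_ge0// divr_ge0// ltW.
have -> : expR (- (c * s)) = (expR (- u) * expR (- u))%R.
  by rewrite -expRD; congr expR; rewrite /u; field.
rewrite mulrA ler_wpM2r ?expR_ge0// expRN ler_pdivrMr ?expR_gt0//.
have h1 : (s <= 2 / c * expR u)%R.
  have : (u <= expR u)%R by have := expR_ge1Dx u; lra.
  move=> /(ler_wpM2l (ltW (divr_gt0 (ltr0n R 2) c0))); apply: le_trans.
  by rewrite le_eqVlt; apply/orP; left; apply/eqP; rewrite /u; field; rewrite gt_eqF.
have h2 : (s ^+ 2 <= 8 / c ^+ 2 * expR u)%R.
  have : (u ^+ 2 / 2 <= expR u)%R by have := @expR_ge1Dxn R u 1 u0; rewrite (_ : 2`! = 2%N)//; lra.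
  have c2 : (0 <= 8 / c ^+ 2)%R by rewrite divr_ge0// sqr_ge0.
  move=> /(ler_wpM2l c2); apply: le_trans.
  by rewrite le_eqVlt; apply/orP; left; apply/eqP; rewrite /u; field; rewrite gt_eqF.
rewrite mulrDl lerD// -mulrA ler_wpM2l//.
Qed.

End exponential_decay.

(** * Pointwise comparison of the rescaled integrand with its limit *)

Section limit_integral.
Context {R : realType} {d k : nat}.
Hypothesis d0 : (0 < d)%N.
Local Notation E := (euclidean R d).
Local Notation mu := (@lebesgue_rd R d).
Local Notation muk := (power_measure (@lebesgue_rd R d) k).
Implicit Types (z x : k.-tuple E).
Local Open Scope ereal_scope.

Definition outer_volume z : R := fine (mu (outer_region z)).

Lemma outer_volumeE z : (outer_volume z)%:E = mu (outer_region z).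
Proof. by rewrite fineK// ge0_fin_numE// outer_region_lty. Qed.

Lemma gfunE z : (gfun z)%:E = cone_integral z.
Proof.
rewrite -[gfun z]/(fine (cone_integral z)) fineK// ge0_fin_numE ?cone_integral_lty//.
exact: cone_integral_ge0.
Qed.

Lemma near_region_volume z : fine (mu (near_region z)) = (theta R d + outer_volume z)%R.
Proof.
have eb : mu (eball (origin : E) 1) \is a fin_num by rewrite ge0_fin_numE// lebesgue_rd_eball_lty.
have en : mu (near_region z) \is a fin_num by rewrite ge0_fin_numE// near_region_lty.
apply: EFin_inj; rewrite EFinD outer_volumeE /theta (fineK eb) (fineK en).
rewrite -measureU; first congr (mu _).
- apply/seteqP; split => y; rewrite /near_region /eball/= esub0.
    case: (leP (enorm y) 1%R) => y1 h; [by left|right; split => //].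
    by case/orP: h => [/(lt_le_trans y1)|/existsP[i yi]]; [rewrite ltxx|exists i].
  case=> [y1|[y1 [i yi]]]; apply/orP; first by left.
  by right; apply/existsP; exists i.
- exact: measurable_eball.
- exact: measurable_outer_region.
- rewrite -subset0 => y []; rewrite /eball/= esub0 => y1 [y2 _].
  by have := lt_le_trans y2 y1; rewrite ltxx.
Qed.

Lemma measurable_outer_volume : measurable_fun setT outer_volume.
Proof.
rewrite (_ : outer_volume = fun z => fine (mu (near_region z)) - theta R d)%R.
  apply: measurable_funB => //.
  have mf : measurable_fun setT (fine : \bar R -> R) by exact: fine_measurable.
  exact: (measurableT_comp mf measurable_near_volumeT).
by apply/funext => z; rewrite near_region_volume addrC addKr.
Qed.

(** The ray formula has an integrand jointly measurable in z and the direction, so Tonelli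
    applies. *)
Lemma measurable_gfun : measurable_fun setT (@gfun R d k).
Proof.
pose f (p : k.-tuple E * E) : R :=
  (shell_weight p.2 * (support_fun p.1 p.2 / enorm p.2 ^+ d.+1))%R.
have mf : measurable_fun setT f.
  apply: measurable_funM.
    exact: (measurableT_comp (@measurable_shell_weight R d) measurable_snd).
  apply: measurable_funM.
    apply: measurable_bigmax => i; apply: measurable_edot; first exact: measurable_snd.
    exact: (measurableT_comp (measurable_tnth_euclidean i) measurable_fst).
  exact: (measurableT_comp (@measurable_enormVX R d d.+1) measurable_snd).
have mEf : measurable_fun setT (EFin \o f) by exact/measurable_EFinP.
have mF := measurable_fun_fubini_tonelli_F (m2 := mu) (EFin \o f) mEf
  (fun p => cone_integrand_ge0 p.1 p.2).
have mfi : measurable_fun setT (fine : \bar R -> R) by exact: fine_measurable.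
rewrite (_ : @gfun R d k = fine \o fubini_F mu (EFin \o f)).
  exact: (measurableT_comp mfi mF).
by apply/funext => z; rewrite -[gfun z]/(fine (cone_integral z)) cone_integral_ray.
Qed.

Lemma gfun_scale z (a : R) : (0 <= a)%R -> gfun [tuple of map (escale a) z] = (a * gfun z)%R.
Proof. by move=> a0; apply: EFin_inj; rewrite gfunE cone_integral_scale// EFinM gfunE. Qed.

Definition norm_sum z : R := (\sum_(i < k) enorm (tnth z i))%R.

Lemma norm_sum_ge0 z : (0 <= norm_sum z)%R. Proof. exact: sumr_ge0. Qed.

Lemma norm_sum_scale z (a : R) : (0 <= a)%R ->
  norm_sum [tuple of map (escale a) z] = (a * norm_sum z)%R.
Proof.
move=> a0; rewrite /norm_sum mulr_sumr; apply: eq_bigr => i _.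
by rewrite tnth_map enormZ ger0_norm.
Qed.

(** Summing the k bounds gives at most k b; dividing by k + 1 keeps the constant positive when k =
    0. *)
Lemma norm_sum_le z (c b : R) : (0 <= b)%R -> (forall i, c * enorm (tnth z i) <= b)%R ->
  (c / k.+1%:R * norm_sum z <= b)%R.
Proof.
move=> b0 h; rewrite mulrAC ler_pdivrMr ?ltr0n// mulr_sumr.
apply: (@le_trans _ _ (\sum_(i < k) b)%R); first by apply: ler_sum.
by rewrite sumr_const card_ord -[leLHS]mulr_natr ler_wpM2l// ler_nat.
Qed.

Lemma measurable_norm_sum : measurable_fun setT norm_sum.
Proof.
apply: measurable_sum => i.
exact: (measurableT_comp (@measurable_enorm R d) (measurable_tnth_euclidean i)).
Qed.

(** If the norms sum to less than 1, every point is adjacent to the origin. *)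
Lemma not_connected_norm_sum z : ~~ points_connected 1 z -> (1 <= norm_sum z)%R.
Proof.
apply: contraNT; rewrite -ltNge => z1; apply/rooted_connectedP => A A0 _.
apply/setP => i; rewrite inE A0//.
apply: le_trans (ltW z1); rewrite /norm_sum (bigD1 i)//= lerDl.
exact: sumr_ge0.
Qed.

Definition scaled_density (lambda : R) x : R :=
  let z := [tuple of map (escale lambda^-1) x] in
  ((points_connected 1 z)%:R * expR (- (lambda * outer_volume z)))%R.

(* With [z = x / lambda], the exponents [lambda * V z] and [g x = lambda * g z]
   differ by [O(|x|^2 / lambda)] and both dominate [c * |x|]. *)
Lemma scaled_density_dist : exists C c : R, [/\ (0 <= C)%R, (0 < c)%R,
  (forall x, c * norm_sum x <= gfun x)%R &
  forall lambda x, (0 < lambda)%R ->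
  (`|scaled_density lambda x - expR (- gfun x)| <=
     lambda^-1 * ((C * norm_sum x ^+ 2 + norm_sum x) * expR (- (c * norm_sum x))))%R].
Proof.
(* A positive bound on each |z_i| of a connected tuple; [K * K] then bounds their sum. *)
pose K : R := k.+1%:R; have K0 : (0 < K)%R by rewrite ltr0n.
have [c0 c00 hc0] := @cone_integral_ge R d d0.
have [c1 c10 hc1] := outer_region_ge d0 K0.
have KK : (0 <= K * K)%R by rewrite mulr_ge0// ltW.
have [C C0 hC] := outer_region_cone_integral d0 KK.
pose c := (Num.min c0 c1 / K)%R.
have c_gt0 : (0 < c)%R by rewrite divr_gt0// lt_min c00.
have g_ge x : (c * norm_sum x <= gfun x)%R.
  apply: norm_sum_le.
    by rewrite -lee_fin gfunE cone_integral_ge0.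
  move=> i; have := hc0 _ x i; rewrite -gfunE lee_fin; apply: le_trans.
  by rewrite ler_wpM2r// ge_min lexx.
exists C, c; split => // lambda x l0; rewrite /scaled_density.
set z := [tuple of map (escale lambda^-1) x].
have li0 : (0 <= lambda^-1)%R by rewrite invr_ge0 ltW.
have gz : gfun x = (lambda * gfun z)%R by rewrite gfun_scale// mulVKf// gt_eqF.
have Sz : norm_sum x = (lambda * norm_sum z)%R by rewrite norm_sum_scale// mulVKf// gt_eqF.
have S0 := norm_sum_ge0 x; have Sz0 := norm_sum_ge0 z.
(* In the disconnected case only e^{-g(x)} is left, and the factor lambda^-1 |x| >= 1 can be
   inserted for free. *)
have [zc|znc] := boolP (points_connected 1 z); last first.
  rewrite mul0r sub0r normrN ger0_norm ?expR_ge0//.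
  have S1 : (1 <= lambda^-1 * norm_sum x)%R.
    by have := not_connected_norm_sum znc; rewrite norm_sum_scale.
  rewrite mulrA; apply: (@le_trans _ _ (1 * expR (- (c * norm_sum x)))%R).
    by rewrite mul1r ler_expR lerN2.
  rewrite ler_wpM2r ?expR_ge0//; apply: (le_trans S1); rewrite ler_wpM2l//.
  by rewrite lerDr mulr_ge0// sqr_ge0.
rewrite mul1r.
have zk i : (enorm (tnth z i) <= k%:R)%R by exact: points_connected_bound.
have V_ge : (c * norm_sum z <= outer_volume z)%R.
  apply: norm_sum_le; first by rewrite -lee_fin outer_volumeE.
  move=> i; have := hc1 _ z i; rewrite -outer_volumeE lee_fin => h.
  apply: le_trans (h _); last by rewrite (le_trans (zk i))// ler_nat.
  by rewrite ler_wpM2r// ge_min lexx orbT.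
have SK : (norm_sum z <= K * K)%R.
  apply: (@le_trans _ _ (\sum_(i < k) K)%R).
    by apply: ler_sum => i _; rewrite (le_trans (zk i))// ler_nat.
  by rewrite sumr_const card_ord -[leLHS]mulr_natr ler_wpM2l ?ltW// ltr_nat.
have [||h1 h2] := hC k z (norm_sum z); first by rewrite Sz0.
  by move=> i; exact: enorm_le_sumT.
have dVg : (`|outer_volume z - gfun z| <= C * norm_sum z ^+ 2)%R.
  move: h1 h2; rewrite -outer_volumeE -gfunE -!EFinD !lee_fin => h1 h2.
  by rewrite ler_distl h1 andbT lerBlDr.
apply: (le_trans (@expR_dist_le _ _ _ (c * norm_sum x)%R _ _)) => //.
  by rewrite Sz mulrCA ler_wpM2l// ltW.
rewrite mulrA ler_wpM2r ?expR_ge0// gz -mulrBr normrM gtr0_norm//.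
apply: (@le_trans _ _ (lambda * (C * norm_sum z ^+ 2))%R); first by rewrite ler_wpM2l// ltW.
(* As |x| = lambda |z|, lambda times C |z|^2 equals C |x|^2 / lambda: the source of the rate. *)
apply: (@le_trans _ _ (lambda^-1 * (C * norm_sum x ^+ 2))%R).
  by rewrite le_eqVlt; apply/orP; left; apply/eqP; rewrite Sz; field; rewrite gt_eqF.
by rewrite ler_wpM2l// lerDl.
Qed.

End limit_integral.

(** * The rescaled cluster probability and its limit *)

Section final.
Context {R : realType} {d k : nat}.
Hypothesis d0 : (0 < d)%N.
Local Notation E := (euclidean R d).
Local Notation mu := (@lebesgue_rd R d).
Local Notation muk := (power_measure (@lebesgue_rd R d) k).
Implicit Types (z x : k.-tuple E).

(** For k = 0 the separate value 1 agrees with the general formula: the only tuple is empty, its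
    [Dset] is empty, and e^0 = 1. *)
Lemma alphaE : alpha d k.+1 = k`!%:R^-1 * \int[muk]_z expR (- gfun z) :> R.
Proof.
case: k => [|k'] //=; rewrite invr1 mul1r.
rewrite -[RHS]/(fine (\int[power_measure mu 0]_z (expR (- gfun z))%:E)%E).
rewrite ge0_integral_power_measure0.
- rewrite /gfun (_ : Dset _ = set0).
    by rewrite /Rintegral integral_set0 oppr0 expR0.
  by rewrite -subset0 => y [[]].
- by apply: measurable_expRN; exact: measurable_gfun.
- by move=> t; rewrite lee_fin expR_ge0.
Qed.

Lemma measurable_scaled_density (lambda : R) : measurable_fun setT (scaled_density (k := k) (d := d) lambda).
Proof.
have ms : measurable_fun setT (fun x : k.-tuple E => [tuple of map (escale lambda^-1) x]).
  by apply: measurable_map_tuple; exact: measurable_escale.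
have mg : measurable_fun setT (fun z : k.-tuple E =>
    ((points_connected 1 z)%:R * expR (- (lambda * outer_volume z)) : R)).
  apply: measurable_funM; first exact: measurable_natbool (@measurable_points_connected R d k 1).
  apply/measurable_EFinP; apply: (@measurable_expRN R _ _ (fun z => lambda * outer_volume z)).
  by apply: measurable_funM => //; exact: measurable_outer_volume.
exact: (measurableT_comp mg ms).
Qed.

(** The unit ball around the origin contributes e^{-theta lambda}. The powers lambda^(k(d-1)) and
    lambda^k combine into lambda^(dk), the Jacobian of z = x / lambda. *)
Lemma cluster_prob_scaled (disp : measure_display) (Omega : measurableType disp)
    (P : probability Omega R) (lambda : R) (H : Omega -> set E) :
  0 < lambda -> poisson_process P lambda H ->
  lambda ^+ (k * (d - 1)) * expR (theta R d * lambda) * cluster_prob P H k.+1 =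
  k`!%:R^-1 * \int[muk]_x scaled_density lambda x.
Proof.
move=> l0 HP; have [mCl hCl] := cluster_event_prob (k := k) d0 l0 HP.
pose Phi z : R := (points_connected 1 z)%:R * expR (- (lambda * outer_volume z)).
have mPhi : measurable_fun setT Phi.
  apply: measurable_funM; first exact: measurable_natbool (@measurable_points_connected R d k 1).
  apply/measurable_EFinP; apply: (@measurable_expRN R _ _ (fun z => lambda * outer_volume z)).
  by apply: measurable_funM => //; exact: measurable_outer_volume.
have Phi0 z : 0 <= Phi z by rewrite mulr_ge0 ?expR_ge0.
have k0 : k`!%:R != 0 :> R by rewrite pnatr_eq0 -lt0n fact_gt0.
have scal : (\int[muk]_x (scaled_density lambda x)%:E = (lambda ^+ (d * k))%:E * \int[muk]_z (Phi z)%:E)%E.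
  have := @ge0_integral_rdk_scale R d k lambda^-1 (EFin \o Phi).
  rewrite invr_gt0 exprVn invrK; apply => //.
  exact/measurable_EFinP.
have volE z : (points_connected 1 z)%:R * expR (- (lambda * fine (mu (near_region z)))) =
    expR (- (theta R d * lambda)) * Phi z.
  rewrite near_region_volume// mulrDr opprD expRD mulrCA [lambda * _]mulrC.
  by [].
have hCl' : ((k`!%:R)%:E * P [set w | Defs.cluster (H w) #= `I_k.+1])%E =
    ((lambda ^+ k * expR (- (theta R d * lambda)))%:E * \int[muk]_z (Phi z)%:E)%E.
  rewrite hCl EFinM -muleA; congr (_ * _)%E.
  under eq_integral do rewrite volE EFinM.
  rewrite ge0_integralZl//.
  - exact/measurable_EFinP.
  - by move=> z _; rewrite lee_fin; exact: Phi0.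
have Pfin : P [set w | Defs.cluster (H w) #= `I_k.+1] \is a fin_num by exact: fin_num_measure.
have c0 : lambda ^+ k * expR (- (theta R d * lambda)) != 0.
  by rewrite mulf_neq0 ?expf_neq0 ?gt_eqF ?expR_gt0.
(* Finiteness is read off the exact formula, whose other side is k! times a probability. *)
have Phifin : (\int[muk]_z (Phi z)%:E)%E \is a fin_num.
  rewrite ge0_fin_numE; last by apply: integral_ge0 => z _; rewrite lee_fin.
  rewrite ltNge leye_eq; apply/negP => /eqP Phioo; move: hCl'.
  rewrite Phioo gt0_muley ?lte_fin ?mulr_gt0 ?exprn_gt0 ?expR_gt0// => hoo.
  have : ((k`!%:R)%:E * P [set w | Defs.cluster (H w) #= `I_k.+1])%E \is a fin_num.
    by rewrite fin_numM.
  by rewrite hoo.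
have pE : k`!%:R * cluster_prob P H k.+1 =
    lambda ^+ k * expR (- (theta R d * lambda)) * fine (\int[muk]_z (Phi z)%:E)%E.
  by apply: EFin_inj; rewrite !EFinM fineK// fineK// -EFinM.
have -> : cluster_prob P H k.+1 = k`!%:R^-1 *
    (lambda ^+ k * expR (- (theta R d * lambda)) * fine (\int[muk]_z (Phi z)%:E)%E).
  by rewrite -pE mulKf.
rewrite -[\int[muk]_x scaled_density lambda x]/(fine (\int[muk]_x (scaled_density lambda x)%:E)%E).
have powE : lambda ^+ (k * (d - 1)) * expR (theta R d * lambda) *
    (lambda ^+ k * expR (- (theta R d * lambda))) = lambda ^+ (d * k).
  rewrite mulrACA -expRD subrr expR0 mulr1 -exprD; congr (_ ^+ _).
  by rewrite addnC -mulnS subn1 prednK// mulnC.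
rewrite scal fineM//= -powE; ring.
Qed.

End final.

Theorem theorem2p1 (R : realType) (d k : nat) (d_gt0 : (0 < d)%N)
    (disp : R -> measure_display)
    (Omega : forall lambda : R, measurableType (disp lambda))
    (P : forall lambda : R, probability (Omega lambda) R)
    (H : forall lambda : R, Omega lambda -> set (euclidean R d)) :
  (forall lambda : R, 0 < lambda ->
    poisson_process (P lambda) lambda (H lambda)) ->
  exists C : R, \forall lambda \near +oo_R,
    `| lambda ^+ (k * (d - 1)) * expR (theta R d * lambda) *
         cluster_prob (P lambda) (H lambda) k.+1 - alpha d k.+1 |
      <= C * lambda^-1.
Proof.
move=> HP.
have [C [c [C0 c0 g_ge hdist]]] := scaled_density_dist (R := R) (k := k) d_gt0.
set muk := power_measure (@lebesgue_rd R d) k.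
(* The constant of [poly_exp_le]; M D(x) is an integrable majorant independent of lambda. *)
pose M : R := C * (8 / c ^+ 2) + 2 / c.
pose D (x : k.-tuple (euclidean R d)) : R := expR (- (c / 2 * norm_sum x)).
have M0 : 0 <= M.
  apply: addr_ge0; last by rewrite divr_ge0// ltW.
  by apply: mulr_ge0 => //; apply: divr_ge0 => //; exact: sqr_ge0.
have c2 : 0 < c / 2 by rewrite divr_gt0.
have intexp a : 0 < a -> muk.-integrable setT (EFin \o (fun x => expR (- (a * norm_sum x)))).
  move=> a0; apply/integrableP; split.
    apply: (@measurable_expRN R _ _ (fun x => a * norm_sum x)).
    by apply: measurable_funM => //; exact: measurable_norm_sum.
  under eq_integral do rewrite /= ger0_norm ?expR_ge0//.
  exact: integral_exp_sum_enorm_lty.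
have iD := intexp _ c2.
have mB : measurable_fun setT (EFin \o (fun x : k.-tuple (euclidean R d) => expR (- gfun x))).
  by apply: measurable_expRN; exact: measurable_gfun.
have iB : muk.-integrable setT (EFin \o (fun x => expR (- gfun x))).
  apply: le_integrable (intexp _ c0) => // x _.
  by rewrite /= !ger0_norm ?expR_ge0// lee_fin ler_expR lerN2.
exists (k`!%:R^-1 * (M * \int[muk]_x D x)).
near=> lambda.
have l0 : 0 < lambda by near: lambda; exact: nbhs_pinfty_gt.
rewrite (cluster_prob_scaled d_gt0 l0 (HP _ l0)) alphaE//.
have dist x : `|scaled_density lambda x - expR (- gfun x)| <= lambda^-1 * M * D x.
  apply: (le_trans (hdist _ x l0)); rewrite -mulrA ler_wpM2l ?invr_ge0 ?(ltW l0)//.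
  exact: poly_exp_le (norm_sum_ge0 x).
have iD' : muk.-integrable setT (EFin \o (fun x => lambda^-1 * M * D x)).
  exact: (integrableZl measurableT (lambda^-1 * M) iD).
have mA : measurable_fun setT (EFin \o scaled_density (d := d) (k := k) lambda).
  by apply/measurable_EFinP; exact: measurable_scaled_density.
(* The difference is integrable by the majorant; adding back e^{-g} makes the rescaled density
   integrable, as subtracting real integrals requires. *)
have iAB : muk.-integrable setT (EFin \o (fun x => scaled_density lambda x - expR (- gfun x))).
  apply: le_integrable iD' => //.
    apply/measurable_EFinP; apply: measurable_funB; first exact: measurable_scaled_density.
    exact/measurable_EFinP.
  move=> x _; rewrite lee_fin; apply: le_trans (dist x) _; exact: ler_norm.
have iA : muk.-integrable setT (EFin \o scaled_density (d := d) (k := k) lambda).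
  apply: (eq_integrable measurableT _ _ _ (integrableD measurableT iAB iB)) => x _ /=.
  by rewrite -EFinD subrK.
rewrite -mulrBr -RintegralB// normrM ger0_norm ?invr_ge0// -[leRHS]mulrA.
rewrite ler_wpM2l ?invr_ge0//.
apply: (le_trans (le_normr_Rintegral _ _)) => //.
apply: (@le_trans _ _ (\int[muk]_x (lambda^-1 * M * D x))).
  apply: le_Rintegral => //.
  exact: integrable_norm.
rewrite RintegralZl//.
by rewrite -[leLHS]mulrA [leLHS]mulrC.
Unshelve. all: by end_near. Qed.
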